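(* Let $a\in[\frac{2\pi}{5},\frac{\pi}{2})$ be fixed. For any fixed $r\in(0,\frac{1}{2})$, there exists a constant $C_{r}>0$, depending only on $r$, such that for any two potential matrices $Q$ and $\widetilde Q$ of the form described in the context (with entries $q,p$ and $\widetilde q,\widetilde p$), with $\{\lambda_{n,1,j}\}_{n\in\mathbb{Z}}$ and $\{\widetilde\lambda_{n,1,j}\}_{n\in\mathbb{Z}}$ the spectra of $B_{1,j}(Q)$ and $B_{1,j}(\widetilde Q)$, $j=1,2$, the estimate $$\|q-\widetilde{q}\|_{L_{2}(a,\pi)}+\|p-\widetilde{p}\|_{L_{2}(a,\pi)}\leq C_{r}\Big(\|\{\lambda_{n,1,1}-\widetilde{\lambda}_{n,1,1}\}_{n\in\mathbb{Z}}\|_{l_{2}}+\|\{\lambda_{n,1,2}-\widetilde{\lambda}_{n,1,2}\}_{n\in\mathbb{Z}}\|_{l_{2}}\Big)$$ is fulfilled as soon as $\|\{\lambda_{n,1,j}-n+\frac{j-1}{2}\}_{n\in\mathbb{Z}}\|_{l_{2}}\leq r$ and $\|\{\widetilde{\lambda}_{n,1,j}-n+\frac{j-1}{2}\}_{n\in\mathbb{Z}}\|_{l_{2}}\leq r$ for $j=1,2$.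
   Context: Consider the Dirac-type system with constant delay $a$: $$By'(x)+Q(x)y(x-a)=\lambda y(x),\quad x\in(0,\pi),$$ where $$B=\begin{bmatrix} 0 & 1 \\ -1 & 0 \end{bmatrix},\quad Q(x)=\begin{bmatrix} q(x) & p(x) \\ p(x) & -q(x) \end{bmatrix},\quad y(x)=\begin{bmatrix} y_1(x) \\ y_2(x) \end{bmatrix},$$ $q,p$ are complex-valued functions in $L_2(0,\pi)$, and $Q(x)=0$ on $(0,a)$ (so the values of $y$ at negative arguments play no role). For $\nu,j\in\{1,2\}$, $B_{\nu,j}(Q)$ denotes the boundary value problem for this system with boundary conditions $y_\nu(0)=0$, $y_j(\pi)=0$. The problem $B_{\nu,j}(\widetilde Q)$ has the same form (same $a$), with $\widetilde Q=\begin{bmatrix} \widetilde q & \widetilde p \\ \widetilde p & -\widetilde q \end{bmatrix}$ satisfying the same assumptions. Let $Y(x,\lambda)=[y_{k,l}(x,\lambda)]_{k,l=1,2}$ be the fundamental matrix solution of the system with $Y(0,\lambda)$ equal to the identity matrix. The eigenvalues of $B_{\nu,j}(Q)$ are the zeros of its characteristic function, the entire function $\Delta_{\nu,j}(\lambda)=y_{j,3-\nu}(\pi,\lambda)$. The spectrum $\{\lambda_{n,\nu,j}\}_{n\in\mathbb{Z}}$ of $B_{\nu,j}(Q)$ is the sequence of these zeros, counted with multiplicity and numbered so that $$\lambda_{n,\nu,j}=n+\frac{2-\nu-j}{2}+\kappa_{n,\nu,j},\quad\{\kappa_{n,\nu,j}\}_{n\in\mathbb{Z}}\in l_2$$ (such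 a numbering always exists). *)

(* Defs.v *)
From HB Require Import structures.
From mathcomp Require Import all_boot all_order all_algebra.
From mathcomp.real_closed Require Export complex.
From mathcomp Require Import all_classical all_reals all_analysis.

Set Implicit Arguments.
Unset Strict Implicit.
Unset Printing Implicit Defensive.

Import Order.TTheory GRing.Theory Num.Theory.
Import numFieldNormedType.Exports.
Local Open Scope classical_set_scope.
Local Open Scope ring_scope.
Local Open Scope complex_scope.

Section Spaces.
Context {R : realType}.
Implicit Types (D : set R) (f : R -> R[i]) (u : int -> R[i]).

Definition L2norm D f : \bar R :=
  'N[lebesgue_measure]_(2%:E)[(fun x => (ComplexField.Normc.normc (f x))%:E) \_ D].

(* R[i] carries no sigma-algebra in the library, hence measurability by
   components *)
Definition inL2 D f : Prop :=
  [/\ measurable_fun D (fun x => complex.Re (f x)),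
      measurable_fun D (fun x => complex.Im (f x))
    & (L2norm D f < +oo)%E].

Definition l2norm u : \bar R :=
  ((\esum_(n in [set: int]) (ComplexField.Normc.normc (u n) ^+ 2)%:E) `^ 2^-1)%E.

Definition inl2 u : Prop := (l2norm u < +oo)%E.

(* The finite families of pairwise non-overlapping subintervals [s i, t i] are
   listed from left to right. *)
Definition abs_continuous (c d : R) f : Prop :=
  forall e : R, 0 < e -> exists2 del : R, 0 < del &
    forall (n : nat) (s t : 'I_n -> R),
      (forall i, c <= s i /\ s i <= t i /\ t i <= d) ->
      (forall i j : 'I_n, (i < j)%N -> t i <= s j) ->
      \sum_(i < n) (t i - s i) < del ->
      \sum_(i < n) ComplexField.Normc.normc (f (t i) - f (s i)) < e.

Definition is_cderive (x : R) f (df : R[i]) : Prop :=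
  is_derive x 1 (fun t => complex.Re (f t)) (complex.Re df) /\
  is_derive x 1 (fun t => complex.Im (f t)) (complex.Im df).

(* z is a zero of F of multiplicity m; m = 0 means that F z != 0 *)
Definition zero_mult (F : R[i] -> R[i]) (z : R[i]) (m : nat) : Prop :=
  (forall k, (k < m)%N -> derive1n k (F : R[i] -> R[i]^o) z = 0) /\
  derive1n m (F : R[i] -> R[i]^o) z <> 0.

End Spaces.

Section Dirac.
Context {R : realType}.
Implicit Types (a : R) (q p : R -> R[i]) (lambda : R[i]).

Definition mx22 (c00 c01 c10 c11 : R[i]) : 'M[R[i]]_2 :=
  \matrix_(i, j) if i == 0 then (if j == 0 then c00 else c01)
                 else (if j == 0 then c10 else c11).

Definition Bmx : 'M[R[i]]_2 := mx22 0 1 (-1) 0.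

Definition Qmx q p (x : R) : 'M[R[i]]_2 := mx22 (q x) (p x) (p x) (- q x).

(* Elements of L2(0, pi) are represented by functions on R whose values outside
   of ]0, pi[ are irrelevant. *)
Definition potential a q p : Prop :=
  [/\ inL2 `]0, pi[ q, inL2 `]0, pi[ p
    & {ae lebesgue_measure, forall x : R, x \in `]0, a[ -> Qmx q p x = 0}].

(* Caratheodory solutions.  As Q vanishes on ]0, a[, the values of Y at negative
   arguments do not matter. *)
Definition fundamental_matrix a q p lambda (Y : R -> 'M[R[i]]_2) : Prop :=
  [/\ Y 0 = 1%:M,
      forall k l, abs_continuous 0 pi (fun x => Y x k l)
    & {ae lebesgue_measure, forall x : R, x \in `]0, pi[ ->
        exists2 dY : 'M[R[i]]_2,
          forall k l, is_cderive x (fun t => Y t k l) (dY k l)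
        & Bmx *m dY + Qmx q p x *m Y (x - a) = lambda *: Y x}].

(* The indices nu, j in {1, 2} of the boundary conditions y_nu(0) = 0 and
   y_j(pi) = 0 are shifted to {0, 1}; so 3 - nu becomes rev_ord nu. *)
Definition char_fun (Y : R -> R[i] -> 'M[R[i]]_2) (nu j : 'I_2) lambda : R[i] :=
  Y pi lambda j (rev_ord nu).

(* lam lists the zeros of the characteristic function with multiplicity, and is
   numbered according to the asymptotics; with the shifted indices,
   (2 - nu - j) / 2 becomes - (nu + j) / 2. *)
Definition is_spectrum a q p (nu j : 'I_2) (lam : int -> R[i]) : Prop :=
  exists Y : R -> R[i] -> 'M[R[i]]_2,
    [/\ forall lambda, fundamental_matrix a q p lambda (fun x => Y x lambda),
        forall z : R[i], exists2 m : nat,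
          ([set n | lam n = z] #= `I_m)%card & zero_mult (char_fun Y nu j) z m
      & inl2 (fun n => lam n - (n%:~R - (nu + j)%N%:R / 2))].

End Dirac.

(* Main.v *)
(* The combinations w+ = y_1 + i y_2 and w- = y_1 - i y_2 of the second column of Y
   diagonalise B: w+' = i l w+ - i P w-(x - a) and w-' = - i l w- + i M w+(x - a) with
   P = q + i p and M = q - i p.  As pi < 3 a, the integral equations for w+ and w- close
   after two steps, so that the characteristic functions of y_1(pi) = 0 and
   y_2(pi) = 0 are, up to constant factors, sin and cos of pi l plus an integral of
   exp (i l (pi + a - 2 v)) W(v) with W supported in [a, pi].
   At an eigenvalue n - s + k_n the free term is O(|k_n|).  Since the l2-norm of k is
   at most 1/2 and pi - a <= 3 pi / 5, the exponentials at the frequencies n - s + k_n are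
   a small perturbation of an orthogonal basis, hence the L2-norm of W is controlled by
   the l2-norm of these integrals.  This bounds both functions W in terms of an absolute
   constant and, applied to differences, makes them Lipschitz functions of the spectra.
   Half the sum and half the (reflected) difference of the two W are P and M plus a quadratic
   convolution of P and M.  As 5 a >= 2 pi, that convolution only involves
   values of P and M at points where it does not modify them, so it can be computed from
   the sum and the difference themselves, and P and M are Lipschitz functions of these. *)
Require Import Defs.
From mathcomp Require Import all_boot all_order all_algebra.
From mathcomp Require Import all_classical all_reals all_analysis.
From mathcomp Require Import measurable_realfun ring lra.

Import Order.TTheory GRing.Theory Num.Theory.
Import numFieldNormedType.Exports.
Local Open Scope classical_set_scope.
Local Open Scope ring_scope.
Local Open Scope complex_scope.

Set Implicit Arguments.
Unset Strict Implicit.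
Unset Printing Implicit Defensive.

Local Notation nc := ComplexField.Normc.normc.
Local Notation Re := complex.Re.
Local Notation Im := complex.Im.
Local Notation mu := (@lebesgue_measure _).

(** * The complex exponential *)

Section ComplexExponential.
Context {R : realType}.
Implicit Types (x y : R) (z w : R[i]).

(** The room for perturbation comes from the support of W: an interval of length pi - a <= 3 pi / 5,
    well inside one period of the exponentials e^(2inv). At the exact nodes n - s the samples are,
    up to unimodular factors, Fourier coefficients, and their squares add up to at least pi times
    the squared norm. Moving the nodes by k_n costs at most (pi - a)^3 / 3 <= 9 pi^3 / 125 times
    that squared norm when the |k_n|^2 add up to at most 1/4, and 9 pi^2 / 125 < 1. Hence the
    decimal bound on pi, the threshold 1/2 for r, and a constant that depends neither on a nor on
    the potentials. The inverse problem is nonlinear: moving a frequency under W costs the norm of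
    W, and the convolution is bilinear, hence Lipschitz only on bounded sets. An a priori bound on W
    must therefore precede both Lipschitz estimates. Two general facts carry the rest: an absolutely
    continuous function is the integral of its derivative, which Caratheodory solutions require, and
    trigonometric polynomials are dense in L2, which the Parseval bound requires. *)

Lemma nonneg_derive_le (f df : R -> R) x :
  (forall t : R, is_derive t 1 f (df t)) -> (forall t, 0 <= t <= x -> 0 <= df t) ->
  0 <= x -> f 0 <= f x.
Proof.
move=> fdf df0 x0.
have cf : {within `[0, x], continuous f}.
  apply: derivable_within_continuous => y _.
  exact: (@ex_derive _ _ _ _ _ _ _ (fdf y)).
have [c cx H] := @MVT_segment R f df 0 x x0 (fun y _ => fdf y) cf.
rewrite -subr_ge0 H mulr_ge0 ?subr0//.
by apply: df0; move: cx; rewrite in_itv.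
Qed.

Lemma sin_le_id x : 0 <= x -> sin x <= x.
Proof.
move=> x0; have := @nonneg_derive_le (fun t => t - sin t) (fun t => 1 - cos t) x.
by rewrite sin0 subr0 subr_ge0; apply => // t _; rewrite subr_ge0 cos_le1.
Qed.

Lemma cos_ge_quadratic x : 1 - x ^+ 2 / 2 <= cos x.
Proof.
wlog x0 : x / 0 <= x => [H|].
  have [/H//|/ltW] := leP 0 x.
  by rewrite -oppr_ge0 => /H; rewrite sqrrN cosN.
have := @nonneg_derive_le (fun t => cos t + t ^+ 2 / 2) (fun t => - sin t + t) x.
rewrite cos0 expr0n/= mul0r addr0 lerBlDr; apply => // t.
  by apply: is_derive_eq; rewrite /GRing.scale/=; lra.
by move=> /andP[t0 _]; rewrite addrC subr_ge0 sin_le_id.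
Qed.

Lemma sin_ge_cubic x : 0 <= x -> x - x ^+ 3 / 6 <= sin x.
Proof.
move=> x0.
have := @nonneg_derive_le (fun t => (sin t + t ^+ 3 / 6) - t)
   (fun t => (cos t + t ^+ 2 / 2) - 1) x.
rewrite sin0 expr0n/= mul0r addr0 subrr subr_ge0 lerBlDr; apply => // t.
  by apply: is_derive_eq; rewrite /GRing.scale/=; lra.
by move=> _; rewrite subr_ge0 -lerBlDr cos_ge_quadratic.
Qed.

Lemma cos_le_quartic x : 0 <= x -> cos x <= 1 - x ^+ 2 / 2 + x ^+ 4 / 24.
Proof.
move=> x0.
have := @nonneg_derive_le (fun t => t ^+ 4 / 24 - (cos t + t ^+ 2 / 2))
   (fun t => t ^+ 3 / 6 - (- sin t + t)) x.
rewrite cos0 expr0n/= mul0r expr0n/= mul0r => H.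
have {}H : 0 - (1 + 0) <= x ^+ 4 / 24 - (cos x + x ^+ 2 / 2).
  apply: H => // [t|t /andP[t0 _]]; last first.
    by have := sin_ge_cubic t0; lra.
  apply: is_deriveB; last apply: is_deriveD;
    by apply: is_derive_eq; rewrite /GRing.scale/=; lra.
lra.
Qed.

(** If pi were at least 3.2, then 1.6 <= pi / 2 and cos 1.6 >= 0; but the quartic Taylor bound at
    1.6 is 1 - 1.28 + 0.2731 < 0. The sampling constant below is positive thanks to this margin. *)
Lemma pi_lt32 : pi < 32 / 10 :> R.
Proof.
rewrite ltNge; apply/negP => pi32.
have p2 := @pihalf_lt2 R.
have := @cos_ge0_pihalf R (16 / 10).
have -> : - (pi / 2) <= (16 / 10 : R) <= pi / 2 by apply/andP; split; lra.
move=> /(_ isT); have := @cos_le_quartic (16/10).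
have -> : 0 <= (16 / 10 : R) by lra.
by move=> /(_ isT); lra.
Qed.

Lemma expRB1_le2 x : `|x| <= 1 -> `|expR x - 1| <= 2 * `|x|.
Proof.
move=> x1; have [x0|x0] := leP 0 x; last first.
  rewrite ltr0_norm ?subr_lt0 ?expR_lt1//.
  by have := expR_ge1Dx x; rewrite ltr0_norm//; lra.
have e1 : 1 <= expR x by rewrite -[leLHS]expR0 ler_expR.
rewrite (ger0_norm x0) in x1 *; rewrite ger0_norm ?subr_ge0//.
(* The Pade bound (2 - t) e^t <= 2 + t gives (2 - x)(e^x - 1) <= 2 x, and 2 - x >= 1 on [0, 1]. The
   derivative is nonnegative because 1 - t <= e^(-t). *)
have := @nonneg_derive_le (fun t => 2 + t - (2 - t) * expR t)
  (fun t => 1 - (1 - t) * expR t) x.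
rewrite !expR0 subr0 addr0 mulr1 subrr => H.
have {}H : 0 <= 2 + x - (2 - x) * expR x.
  apply: H => // [t|t /andP[t0 t1]].
    by apply: is_derive_eq; rewrite /GRing.scale/= ; lra.
  have := expR_ge1Dx (- t); rewrite expRN => tt.
  rewrite subr_ge0 -ler_pdivlMr ?expR_gt0// div1r.
  by rewrite (le_trans _ tt).
have : (2 - x) * (expR x - 1) <= (2 - x) * (2 * x).
  nra.
by rewrite ler_pM2l; [|lra].
Qed.

Definition cexp z : R[i] := (expR (Re z) * cos (Im z)) +i* (expR (Re z) * sin (Im z)).

Lemma complex_ext z w : Re z = Re w -> Im z = Im w -> z = w.
Proof. by case: z => ? ?; case: w => ? ? /= -> ->. Qed.

Lemma cReM z w : Re (z * w) = Re z * Re w - Im z * Im w.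
Proof. by case: z; case: w. Qed.

Lemma cImM z w : Im (z * w) = Re z * Im w + Im z * Re w.
Proof. by case: z; case: w. Qed.

Lemma cReD z w : Re (z + w) = Re z + Re w.
Proof. by case: z; case: w. Qed.

Lemma cImD z w : Im (z + w) = Im z + Im w.
Proof. by case: z; case: w. Qed.

Lemma cReN z : Re (- z) = - Re z.
Proof. by case: z. Qed.

Lemma cImN z : Im (- z) = - Im z.
Proof. by case: z. Qed.

Lemma cRe_sum (I : Type) (s : seq I) (P : pred I) (F : I -> R[i]) :
  Re (\sum_(i <- s | P i) F i) = \sum_(i <- s | P i) Re (F i).
Proof. by elim/big_rec2: _ => // i x y _ <-; rewrite cReD. Qed.

Lemma cexp0 : cexp 0 = 1.
Proof. by apply: complex_ext => /=; rewrite expR0 ?cos0 ?sin0 ?mulr1 ?mulr0. Qed.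

Lemma cexpD z w : cexp (z + w) = cexp z * cexp w.
Proof.
by apply: complex_ext; rewrite ?cReM ?cImM /= cReD cImD expRD ?cosD ?sinD; ring.
Qed.

Lemma cexpNM z : cexp (- z) * cexp z = 1.
Proof. by rewrite -cexpD addNr cexp0. Qed.

Lemma cexp_natM z n : cexp (n%:R * z) = cexp z ^+ n.
Proof.
elim: n => [|n IH]; first by rewrite mul0r expr0 cexp0.
by rewrite -addn1 natrD mulrDl mul1r cexpD IH exprD expr1.
Qed.

Lemma normc_sqr z : nc z ^+ 2 = Re z ^+ 2 + Im z ^+ 2.
Proof. by case: z => a b /=; rewrite sqr_sqrtr// addr_ge0 ?sqr_ge0. Qed.

Lemma normc_ge0 z : 0 <= nc z.
Proof. by case: z => a b /=; rewrite sqrtr_ge0. Qed.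

Lemma normcM z w : nc (z * w) = nc z * nc w.
Proof. exact: ComplexField.Normc.normcM. Qed.

Lemma le_normcB z w : nc (z - w) <= nc z + nc w.
Proof. by rewrite -(normcN w); exact: le_normcD. Qed.

Lemma normcBC z w : nc (z - w) = nc (w - z).
Proof. by rewrite -normcN opprB. Qed.

Lemma normc_le z x : 0 <= x -> (nc z <= x) = (Re z ^+ 2 + Im z ^+ 2 <= x ^+ 2).
Proof. by move=> x0; rewrite -normc_sqr ler_sqr ?nnegrE ?normc_ge0. Qed.

Lemma Re_le_normc z : `|Re z| <= nc z.
Proof.
rewrite -(@ler_sqr R) ?nnegrE ?normc_ge0//.
by rewrite normc_sqr real_normK ?num_real// lerDl sqr_ge0.
Qed.

Lemma Im_le_normc z : `|Im z| <= nc z.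
Proof.
rewrite -(@ler_sqr R) ?nnegrE ?normc_ge0//.
by rewrite normc_sqr real_normK ?num_real// lerDr sqr_ge0.
Qed.

Lemma normc_le_ReIm z : nc z <= `|Re z| + `|Im z|.
Proof.
rewrite normc_le ?addr_ge0//.
rewrite -(real_normK (num_real (Re z))) -(real_normK (num_real (Im z))).
have := normr_ge0 (Re z); have := normr_ge0 (Im z); nra.
Qed.

Lemma normc_real x : nc x%:C = `|x|.
Proof. by rewrite /= expr0n addr0 sqrtr_sqr. Qed.

Lemma normcX z n : nc (z ^+ n) = nc z ^+ n.
Proof.
elim: n => [|n IH]; last by rewrite !exprS normcM IH.
by rewrite !expr0 ComplexField.Normc.normc1.
Qed.

Lemma normc_sum (I : Type) (s : seq I) (P : pred I) (F : I -> R[i]) :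
  nc (\sum_(i <- s | P i) F i) <= \sum_(i <- s | P i) nc (F i).
Proof.
elim/big_ind2 : _ => //.
  by rewrite ComplexField.Normc.normc0.
by move=> ? ? ? ? h1 h2; rewrite (le_trans (le_normcD _ _))// lerD.
Qed.

Lemma normc_cexp z : nc (cexp z) = expR (Re z).
Proof.
apply/eqP; rewrite -(@eqrXn2 _ 2) ?normc_ge0 ?expR_ge0//.
by rewrite normc_sqr/= !exprMn -mulrDr cos2Dsin2 mulr1.
Qed.

(* |e^z - 1|^2 = (e^x - 1)^2 + 2 e^x (1 - cos y) for z = x + i y *)
Lemma normc_cexpB1_sqr z :
  nc (cexp z - 1) ^+ 2 <= (expR (Re z) - 1) ^+ 2 + expR (Re z) * Im z ^+ 2.
Proof.
rewrite normc_sqr/= addrC subr0.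
have e0 := expR_ge0 (Re z); have := cos_ge_quadratic (Im z).
have := cos2Dsin2 (Im z).
set e := expR _ in e0 *; set c := cos _; set s := sin _; set y := Im _.
move=> cs cy.
have -> : (e * s) ^+ 2 + (e * c - 1) ^+ 2 = (e - 1) ^+ 2 + 2 * e * (1 - c) + e ^+ 2 * (c ^+ 2 + s ^+ 2 - 1).
  ring.
by rewrite cs; nra.
Qed.

(** Both terms of [normc_cexpB1_sqr] are at most four times the matching square: the first by
    [expRB1_le2], the second because e^x <= e <= 3, which is the same lemma at 1. The factor 2, free
    of exponentials, is what keeps the sampling estimate below its critical size. *)
Lemma normc_cexpB1_le2 z : `|Re z| <= 1 -> nc (cexp z - 1) <= 2 * nc z.
Proof.
move=> z1; rewrite -(@ler_sqr R) ?nnegrE ?mulr_ge0 ?normc_ge0//.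
apply: (le_trans (normc_cexpB1_sqr z)).
rewrite exprMn normc_sqr mulrDr lerD//.
  have := expRB1_le2 z1; rewrite -(@ler_sqr R) ?nnegrE ?mulr_ge0//.
  by rewrite exprMn !real_normK ?num_real.
rewrite ler_wpM2r ?sqr_ge0//.
have : expR (Re z) <= expR 1 by rewrite ler_expR (le_trans (ler_norm _)).
have := @expRB1_le2 1; rewrite normr1 => /(_ (lexx _)); have := ler_norm (expR 1 - 1 : R).
lra.
Qed.

Lemma normc_cexpB1 z : nc (cexp z - 1) <= 2 * nc z * expR `|Re z|.
Proof.
have [z1|z1] := leP `|Re z| 1.
  apply: (le_trans (normc_cexpB1_le2 z1)).
  by rewrite ler_peMr ?mulr_ge0 ?normc_ge0// -expR0 ler_expR.
apply: (le_trans (le_normcB _ _)).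
rewrite normc_cexp ComplexField.Normc.normc1.
have h1 : expR (Re z) <= expR `|Re z| by rewrite ler_expR ler_norm.
have h2 : 1 <= expR `|Re z| by rewrite -expR0 ler_expR.
have h3 : 1 <= nc z by rewrite (le_trans (ltW z1))// Re_le_normc.
nra.
Qed.

End ComplexExponential.

(** * Integration of complex-valued functions *)

Section ComplexIntegral.
Context {R : realType}.
Implicit Types (f g h : R -> R[i]) (u : R -> R) (c : R[i]) (x y : R).

Definition cmeasurable f :=
  measurable_fun [set: R] (fun x => Re (f x)) /\
  measurable_fun [set: R] (fun x => Im (f x)).

Definition cintegrable f :=
  mu.-integrable [set: R] (fun x => (Re (f x))%:E) /\
  mu.-integrable [set: R] (fun x => (Im (f x))%:E).

Definition cint f : R[i] :=
  (\int[mu]_x Re (f x)) +i* (\int[mu]_x Im (f x)).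

Lemma cmeasurable_cst c : cmeasurable (fun=> c).
Proof. by split; exact: measurable_cst. Qed.

Lemma cmeasurableD f g : cmeasurable f -> cmeasurable g ->
  cmeasurable (fun x => f x + g x).
Proof.
move=> [f1 f2] [g1 g2]; split.
- by under eq_fun do rewrite cReD; exact: measurable_funD.
- by under eq_fun do rewrite cImD; exact: measurable_funD.
Qed.

Lemma cmeasurableN f : cmeasurable f -> cmeasurable (fun x => - f x).
Proof.
move=> [f1 f2]; split.
- by under eq_fun do rewrite cReN; exact: measurableT_comp.
- by under eq_fun do rewrite cImN; exact: measurableT_comp.
Qed.

Lemma cmeasurableB f g : cmeasurable f -> cmeasurable g ->
  cmeasurable (fun x => f x - g x).
Proof. by move=> mf mg; apply: cmeasurableD => //; exact: cmeasurableN. Qed.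

Lemma cmeasurableM f g : cmeasurable f -> cmeasurable g ->
  cmeasurable (fun x => f x * g x).
Proof.
move=> [f1 f2] [g1 g2]; split.
- under eq_fun do rewrite cReM.
  by apply: measurable_funB; apply: measurable_funM.
- under eq_fun do rewrite cImM.
  by apply: measurable_funD; apply: measurable_funM.
Qed.

Lemma cmeasurable_real u : measurable_fun [set: R] u ->
  cmeasurable (fun x => (u x)%:C).
Proof. by move=> mu; split => //=; exact: measurable_cst. Qed.

Lemma cmeasurable_comp f (phi : R -> R) : measurable_fun [set: R] phi ->
  cmeasurable f -> cmeasurable (fun x => f (phi x)).
Proof.
move=> mphi [f1 f2]; split.
- exact: (measurableT_comp f1).
- exact: (measurableT_comp f2).
Qed.

Lemma cmeasurable_cexp f : cmeasurable f -> cmeasurable (fun x => cexp (f x)).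
Proof.
move=> [f1 f2]; split; apply: measurable_funM => /=.
- by apply: measurableT_comp f1; apply: continuous_measurable_fun; exact: continuous_expR.
- by apply: measurableT_comp f2; apply: continuous_measurable_fun; exact: continuous_cos.
- by apply: measurableT_comp f1; apply: continuous_measurable_fun; exact: continuous_expR.
- by apply: measurableT_comp f2; apply: continuous_measurable_fun; exact: continuous_sin.
Qed.

Lemma measurable_normc_sqr f : cmeasurable f ->
  measurable_fun [set: R] (fun x => nc (f x) ^+ 2).
Proof.
move=> [f1 f2]; under eq_fun do rewrite normc_sqr.
by apply: measurable_funD; apply: measurable_funX.
Qed.

Lemma measurable_normc f : cmeasurable f ->
  measurable_fun [set: R] (fun x => nc (f x)).
Proof.
move=> mf; have -> : (fun x => nc (f x)) = (fun x => Num.sqrt (nc (f x) ^+ 2)).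
  by apply/funext => x; rewrite sqrtr_sqr ger0_norm ?normc_ge0.
apply: measurableT_comp (measurable_normc_sqr mf).
by apply: continuous_measurable_fun; exact: sqrt_continuous.
Qed.

Lemma le_integrable_real (u v : R -> R) : measurable_fun [set: R] u ->
  (forall x, `|u x| <= v x) -> mu.-integrable [set: R] (fun x => (v x)%:E) ->
  mu.-integrable [set: R] (fun x => (u x)%:E).
Proof.
move=> mu' uv; apply: le_integrable => //.
  by apply/measurable_EFinP.
by move=> x _; rewrite /= lee_fin (le_trans (uv x)) ?ler_norm.
Qed.

Lemma cintegrable_le f u : cmeasurable f -> (forall x, nc (f x) <= u x) ->
  mu.-integrable [set: R] (fun x => (u x)%:E) -> cintegrable f.
Proof.
move=> [f1 f2] fu iu; split; apply: (le_integrable_real _ _ iu) => // x.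
- by rewrite (le_trans (Re_le_normc _)).
- by rewrite (le_trans (Im_le_normc _)).
Qed.

Lemma cintegrable_measurable f : cintegrable f -> cmeasurable f.
Proof.
move=> [/integrableP[/measurable_EFinP f1 _] /integrableP[/measurable_EFinP f2 _]].
by split.
Qed.

Lemma integrable_normc f : cintegrable f ->
  mu.-integrable [set: R] (fun x => (nc (f x))%:E).
Proof.
move=> fi; have [mr mi] := cintegrable_measurable fi; have [f1 f2] := fi.
apply: (@le_integrable_real _ (fun x => `|Re (f x)| + `|Im (f x)|)).
- by apply: measurable_normc.
- by move=> x; rewrite ger0_norm ?normc_ge0// normc_le_ReIm.
- exact: (integrableD measurableT (integrable_abse f1) (integrable_abse f2)).
Qed.

Lemma cintegrableD f g : cintegrable f -> cintegrable g ->
  cintegrable (fun x => f x + g x).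
Proof.
move=> [f1 f2] [g1 g2]; split.
- by under eq_fun do rewrite cReD; apply: (integrableD measurableT f1 g1).
- by under eq_fun do rewrite cImD; apply: (integrableD measurableT f2 g2).
Qed.

Lemma cintegrableZ c f : cintegrable f -> cintegrable (fun x => c * f x).
Proof.
move=> fi; apply: (@cintegrable_le _ (fun x => nc c * nc (f x))).
- by apply: cmeasurableM; [exact: cmeasurable_cst|exact: cintegrable_measurable].
- by move=> x; rewrite normcM.
- by under eq_fun do rewrite EFinM; apply: integrableZl => //; exact: integrable_normc.
Qed.

Lemma cintegrableN f : cintegrable f -> cintegrable (fun x => - f x).
Proof.
by move=> /(cintegrableZ (-1)); under eq_fun do rewrite mulN1r.
Qed.

Lemma cintD f g : cintegrable f -> cintegrable g ->
  cint (fun x => f x + g x) = cint f + cint g.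
Proof.
move=> [f1 f2] [g1 g2]; apply: complex_ext; rewrite ?cReD ?cImD/=.
- by under eq_Rintegral do rewrite cReD; rewrite RintegralD.
- by under eq_Rintegral do rewrite cImD; rewrite RintegralD.
Qed.

Lemma cintZ c f : cintegrable f -> cint (fun x => c * f x) = c * cint f.
Proof.
move=> [f1 f2].
have Z (a : R) (v : R -> R) : mu.-integrable setT (fun x => (v x)%:E) ->
    mu.-integrable [set: R] (fun x => (a * v x)%:E).
  by move=> vi; under eq_fun do rewrite EFinM; apply: integrableZl.
apply: complex_ext; rewrite ?cReM ?cImM/=.
- under eq_Rintegral do rewrite cReM.
  by rewrite RintegralB ?RintegralZl//; exact: Z.
- under eq_Rintegral do rewrite cImM.
  by rewrite RintegralD ?RintegralZl//; exact: Z.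
Qed.

Lemma cintN f : cintegrable f -> cint (fun x => - f x) = - cint f.
Proof.
move=> fi; rewrite -[RHS]mulN1r -cintZ//.
by congr cint; apply/funext => x; rewrite mulN1r.
Qed.

Lemma cintB f g : cintegrable f -> cintegrable g ->
  cint (fun x => f x - g x) = cint f - cint g.
Proof. by move=> fi gi; rewrite cintD ?cintN//; exact: cintegrableN. Qed.

Lemma cintegrable0 : cintegrable (fun=> 0).
Proof. by split; exact: integrable0. Qed.

Lemma cint0 : cint (fun=> 0) = 0.
Proof.
rewrite -[RHS](mul0r (cint (fun=> 0))) -(cintZ 0 cintegrable0).
by congr cint; apply/funext => x; rewrite mul0r.
Qed.

Lemma cintegrable_sum (I : Type) (s : seq I) (F : I -> R -> R[i]) :
  (forall i, cintegrable (F i)) -> cintegrable (fun x => \sum_(i <- s) F i x).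
Proof.
move=> Fi; elim: s => [|i s IH].
  by under eq_fun do rewrite big_nil; exact: cintegrable0.
by under eq_fun do rewrite big_cons; exact: cintegrableD.
Qed.

Lemma cint_sum (I : Type) (s : seq I) (F : I -> R -> R[i]) :
  (forall i, cintegrable (F i)) ->
  cint (fun x => \sum_(i <- s) F i x) = \sum_(i <- s) cint (F i).
Proof.
move=> Fi; elim: s => [|i s IH].
  by under eq_fun do rewrite big_nil; rewrite big_nil cint0.
under eq_fun do rewrite big_cons.
by rewrite cintD// ?IH ?big_cons//; exact: cintegrable_sum.
Qed.

(** Multiplying by the unimodular [c] that rotates the integral onto the positive real axis turns
    its modulus into the integral of a real part, which is bounded pointwise. *)
Lemma le_normc_cint f : cintegrable f -> nc (cint f) <= \int[mu]_x nc (f x).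
Proof.
move=> fi; have [z zE] : exists z, z = cint f by exists (cint f).
rewrite -zE.
have [->|z0] := eqVneq z 0.
  rewrite ComplexField.Normc.normc0.
  by apply: Rintegral_ge0 => x _; exact: normc_ge0.
have nz0 : nc z != 0 by apply: contra_neq z0 => /ComplexField.Normc.eq0_normc.
pose c := (Re z / nc z) +i* (- Im z / nc z).
have cz : c * z = (nc z)%:C.
  apply: complex_ext; rewrite ?cReM ?cImM /=.
    transitivity (nc z ^+ 2 / nc z); last by rewrite expr2 mulfK.
    by rewrite normc_sqr; field.
  by field.
have nc1 : nc c = 1.
  have := congr1 (fun z => nc z) cz; rewrite normcM normc_real ger0_norm ?normc_ge0//.
  by move=> /(canRL (mulfK nz0)); rewrite divff.
have -> : nc z = Re (cint (fun x => c * f x)) by rewrite cintZ// -zE cz.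
rewrite /=; have [c1 c2] := cintegrableZ c fi.
apply: le_Rintegral => //; first exact: integrable_normc.
move=> x _; apply: (le_trans (ler_norm _)); apply: (le_trans (Re_le_normc _)).
by rewrite normcM nc1 mul1r.
Qed.

End ComplexIntegral.

(** * Invariance of the Lebesgue integral under x -> s - x *)

Section Reflection.
Context {R : realType}.
Implicit Types (f g h : R -> R[i]) (u : R -> R) (c : R[i]) (x y s : R).

Lemma measurable_reflect s : measurable_fun [set: R] (fun x : R => s - x).
Proof. by apply: measurable_funB => //; exact: measurable_cst. Qed.

(** Lebesgue measure is determined by its values on half-open intervals; a reflection only moves the
    closed endpoint to the other side, which does not change the length. *)
Lemma lebesgue_measure_reflect s (A : set R) : measurable A ->
  mu A = pushforward mu (fun x : R => s - x) A.
Proof.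
have mphi : @measurable_fun _ _ (measurableTypeR R) (measurableTypeR R) setT
  (fun x => s - x) by exact: measurable_reflect.
pose m : {measure set (measurableTypeR R) -> \bar R} :=
  measure_function_pushforward__canonical__measure_function_Measure mu mphi.
move=> mA; apply: (@lebesgue_measure_unique R m) => // X [[a b] _ <-]/=.
rewrite /pushforward/= (_ : _ @^-1` _ = `[s - b, s - a[%classic); last first.
  apply/seteqP; split => x /=; rewrite !in_itv/= => /andP[h1 h2]; apply/andP; split; lra.
rewrite !lebesgue_measure_itv/= !lte_fin.
have -> : (s - b < s - a) = (a < b) by apply/idP/idP => ?; lra.
by case: ifP => // _; rewrite -!EFinB; congr EFin; lra.
Qed.

Lemma integral_reflect s (u : R -> \bar R) : measurable_fun [set: R] u ->
  (\int[mu]_x u (s - x)%R = \int[mu]_x u x)%E.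
Proof.
move=> mu'.
have ge0 (v : R -> \bar R) : measurable_fun [set: R] v -> (forall x, (0 <= v x)%E) ->
    (\int[mu]_x v (s - x)%R = \int[mu]_x v x)%E.
  move=> mv v0.
  have mphi : @measurable_fun _ _ (measurableTypeR R) (measurableTypeR R) setT
    (fun x => s - x) by exact: measurable_reflect.
  rewrite -[LHS](@ge0_integral_pushforward _ _ (measurableTypeR R) (measurableTypeR R)
    R _ mphi mu setT v measurableT mv (fun y _ => v0 y)).
  apply: (@eq_measure_integral _ (measurableTypeR R)) => A mA _.
  exact/esym/lebesgue_measure_reflect.
rewrite integralE [RHS]integralE; congr (_ - _)%E.
- have -> : ((fun x => u (s - x)%R)^\+ = (fun x => u^\+ (s - x)%R))%E.
    by apply/funext => x; rewrite !funeposE.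
  exact: (ge0 (u^\+)%E (measurable_funepos mu') (funepos_ge0 u)).
- have -> : ((fun x => u (s - x)%R)^\- = (fun x => u^\- (s - x)%R))%E.
    by apply/funext => x; rewrite !funenegE.
  exact: (ge0 (u^\-)%E (measurable_funeneg mu') (funeneg_ge0 u)).
Qed.

Lemma integrable_reflect s (u : R -> \bar R) : mu.-integrable [set: R] u ->
  mu.-integrable [set: R] (fun x => u (s - x)).
Proof.
move=> /integrableP[mu' fu]; apply/integrableP; split.
  exact: (measurableT_comp mu' (measurable_reflect s)).
by rewrite (integral_reflect s (u := fun x => `|u x|%E)) //; exact: measurableT_comp.
Qed.

Lemma cint_reflect s f : cmeasurable f -> cint (fun x => f (s - x)) = cint f.
Proof.
move=> [f1 f2]; apply: complex_ext; congr fine.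
- by apply: (integral_reflect s (u := fun x => (Re (f x))%:E)); apply/measurable_EFinP.
- by apply: (integral_reflect s (u := fun x => (Im (f x))%:E)); apply/measurable_EFinP.
Qed.

Lemma cintegrable_reflect s f : cintegrable f -> cintegrable (fun x => f (s - x)).
Proof.
move=> [f1 f2]; split.
- exact: (integrable_reflect s f1).
- exact: (integrable_reflect s f2).
Qed.

End Reflection.

(** * Square-integrable functions and the Cauchy-Schwarz inequality *)

Section SquareIntegrable.
Context {R : realType}.
Implicit Types (f g h : R -> R[i]) (u : R -> R) (c : R[i]) (x y s : R).

Definition cL2 f := cmeasurable f /\
  mu.-integrable [set: R] (fun x => (nc (f x) ^+ 2)%:E).

(** The square of the L2 norm is used throughout as a real number; [sqnormD], with its factors 2,
    replaces the triangle inequality, so that the estimates stay polynomial. *)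
Definition sqnorm f : R := \int[mu]_x nc (f x) ^+ 2.

Lemma sqnorm_ge0 f : 0 <= sqnorm f.
Proof. by apply: Rintegral_ge0 => x _; exact: sqr_ge0. Qed.

Lemma integrableZlr (a : R) u : mu.-integrable [set: R] (fun x => (u x)%:E) ->
  mu.-integrable [set: R] (fun x => (a * u x)%:E).
Proof. by move=> vi; under eq_fun do rewrite EFinM; apply: integrableZl. Qed.

Lemma integrableDr u v : mu.-integrable [set: R] (fun x => (u x)%:E) ->
  mu.-integrable [set: R] (fun x => (v x)%:E) ->
  mu.-integrable [set: R] (fun x => (u x + v x)%:E).
Proof. by move=> ui vi; exact: (integrableD measurableT ui vi). Qed.

Lemma normc_sqrD_le c c' : nc (c + c') ^+ 2 <= 2 * nc c ^+ 2 + 2 * nc c' ^+ 2.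
Proof.
rewrite !normc_sqr cReD cImD.
have := sqr_ge0 (Re c - Re c'); have := sqr_ge0 (Im c - Im c'); nra.
Qed.

Lemma cL2_le f g (b : R) : cmeasurable f -> cL2 g ->
  (forall x, nc (f x) <= b * nc (g x)) -> cL2 f.
Proof.
move=> mf [mg ig] fg; split => //.
apply: (le_integrable_real (measurable_normc_sqr mf) _ (integrableZlr (b ^+ 2) ig)) => x.
by rewrite ger0_norm ?sqr_ge0// -exprMn ler_sqr ?nnegrE ?normc_ge0// (le_trans (normc_ge0 _) (fg x)).
Qed.

Lemma cL2D f g : cL2 f -> cL2 g -> cL2 (fun x => f x + g x).
Proof.
move=> [mf fi] [mg gi]; have mfg := cmeasurableD mf mg; split => //.
apply: (le_integrable_real (measurable_normc_sqr mfg) _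
  (integrableDr (integrableZlr 2 fi) (integrableZlr 2 gi))) => x.
by rewrite ger0_norm ?sqr_ge0// normc_sqrD_le.
Qed.

Lemma cL2Z c f : cL2 f -> cL2 (fun x => c * f x).
Proof.
move=> fL; have [mf fi] := fL; apply: (@cL2_le _ f (nc c)) => //.
  by apply: cmeasurableM => //; exact: cmeasurable_cst.
by move=> x; rewrite normcM.
Qed.

Lemma cL2N f : cL2 f -> cL2 (fun x => - f x).
Proof. by move=> /(cL2Z (-1)); under eq_fun do rewrite mulN1r. Qed.

Lemma cL2B f g : cL2 f -> cL2 g -> cL2 (fun x => f x - g x).
Proof. by move=> fL gL; apply: cL2D => //; exact: cL2N. Qed.

Lemma sqnormD f g : cL2 f -> cL2 g ->
  sqnorm (fun x => f x + g x) <= 2 * sqnorm f + 2 * sqnorm g.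
Proof.
move=> fL gL; have [mf fi] := fL; have [mg gi] := gL; have [_ fgi] := cL2D fL gL.
rewrite /sqnorm -!RintegralZl// -RintegralD//; [|exact: integrableZlr..].
apply: le_Rintegral => //; first exact: integrableDr (integrableZlr 2 fi) (integrableZlr 2 gi).
by move=> x _; exact: normc_sqrD_le.
Qed.

Lemma sqnormZ c f : cL2 f -> sqnorm (fun x => c * f x) = nc c ^+ 2 * sqnorm f.
Proof.
move=> [mf fi]; rewrite /sqnorm -RintegralZl//.
by apply: eq_Rintegral => x _; rewrite normcM exprMn.
Qed.

Lemma sqnormN f : sqnorm (fun x => - f x) = sqnorm f.
Proof. by apply: eq_Rintegral => x _; rewrite normcN. Qed.

Lemma sqnormB f g : cL2 f -> cL2 g ->
  sqnorm (fun x => f x - g x) <= 2 * sqnorm f + 2 * sqnorm g.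
Proof. by move=> fL gL; rewrite -[sqnorm g]sqnormN; apply: sqnormD => //; exact: cL2N. Qed.

Lemma le_sqnorm f g : cL2 f -> cL2 g -> (forall x, nc (f x) <= nc (g x)) ->
  sqnorm f <= sqnorm g.
Proof.
move=> [_ fi] [_ gi] fg; apply: le_Rintegral => // x _.
by rewrite ler_sqr ?nnegrE ?normc_ge0.
Qed.

Lemma integrable_normcM f g : cL2 f -> cL2 g ->
  mu.-integrable [set: R] (fun x => (nc (f x) * nc (g x))%:E).
Proof.
move=> [mf fi] [mg gi].
apply: (le_integrable_real _ _ (integrableDr fi gi)).
  by apply: measurable_funM; exact: measurable_normc.
move=> x; rewrite ger0_norm ?mulr_ge0 ?normc_ge0//.
have := sqr_ge0 (nc (f x) - nc (g x)).
have := mulr_ge0 (normc_ge0 (f x)) (normc_ge0 (g x)); nra.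
Qed.

Lemma cintegrableM f g : cL2 f -> cL2 g -> cintegrable (fun x => f x * g x).
Proof.
move=> fL gL; have [mf _] := fL; have [mg _] := gL.
apply: (cintegrable_le _ _ (integrable_normcM fL gL)); first exact: cmeasurableM.
by move=> x; rewrite normcM.
Qed.

(** The quadratic is evaluated at its minimiser X / A. When A = 0 it is affine, and X <> 0 is
    impossible because t = (B + 1) / (2 X) would give the value -1. *)
Lemma discriminant_le (A B X : R) : 0 <= A -> 0 <= B ->
  (forall t, 0 <= t ^+ 2 * A - 2 * t * X + B) -> X ^+ 2 <= A * B.
Proof.
move=> A0 B0 H; have [A0'|] := ltP 0 A; last first.
  move=> A0'; have A00 : A = 0 by apply/eqP; rewrite eq_le A0 A0'.
  rewrite A00 in H *.
  have [->|X0] := eqVneq X 0; first by rewrite expr0n mul0r.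
  have := H ((B + 1) / (2 * X)); rewrite mulr0 mul0r add0r.
  have -> : 2 * ((B + 1) / (2 * X)) * X = B + 1 by field.
  by lra.
have := H (X / A).
have -> : (X / A) ^+ 2 * A - 2 * (X / A) * X + B = (A * B - X ^+ 2) / A.
  by field; rewrite gt_eqF.
by rewrite ler_pdivlMr// mul0r subr_ge0.
Qed.

Lemma Rintegral_cauchy_schwarz f g : cL2 f -> cL2 g ->
  (\int[mu]_x (nc (f x) * nc (g x))) ^+ 2 <= sqnorm f * sqnorm g.
Proof.
move=> fL gL; have [mf fi] := fL; have [mg gi] := gL; have fgi := integrable_normcM fL gL.
apply: discriminant_le; [exact: sqnorm_ge0..|move=> t].
have : 0 <= \int[mu]_x ((t * nc (f x) - nc (g x)) ^+ 2).
  by apply: Rintegral_ge0 => x _; exact: sqr_ge0.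
have -> : \int[mu]_x ((t * nc (f x) - nc (g x)) ^+ 2) = \int[mu]_x
    ((t ^+ 2 * nc (f x) ^+ 2 + (- (2 * t)) * (nc (f x) * nc (g x))) + nc (g x) ^+ 2).
  by apply: eq_Rintegral => x _; ring.
rewrite RintegralD//; last exact: integrableDr (integrableZlr _ fi) (integrableZlr _ fgi).
rewrite RintegralD//; [|exact: integrableZlr..].
by rewrite !RintegralZl// mulNr.
Qed.

Lemma cauchy_schwarz f g : cL2 f -> cL2 g ->
  nc (cint (fun x => f x * g x)) ^+ 2 <= sqnorm f * sqnorm g.
Proof.
move=> fL gL; apply: le_trans (Rintegral_cauchy_schwarz fL gL).
rewrite ler_sqr ?nnegrE ?normc_ge0//; last first.
  by apply: Rintegral_ge0 => x _; rewrite mulr_ge0 ?normc_ge0.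
apply: (le_trans (le_normc_cint (cintegrableM fL gL))).
rewrite le_eqVlt; apply/orP; left; apply/eqP.
by apply: eq_Rintegral => x _; rewrite normcM.
Qed.

Lemma cmeasurable_reflect s f : cmeasurable f -> cmeasurable (fun x => f (s - x)).
Proof. by apply: cmeasurable_comp; exact: measurable_reflect. Qed.

Lemma cL2_reflect s f : cL2 f -> cL2 (fun x => f (s - x)).
Proof.
move=> [mf fi]; split; first exact: cmeasurable_reflect.
exact: (integrable_reflect s fi).
Qed.

Lemma sqnorm_reflect s f : cL2 f -> sqnorm (fun x => f (s - x)) = sqnorm f.
Proof.
move=> [mf fi]; congr fine.
by apply: (integral_reflect s (u := fun x => (nc (f x) ^+ 2)%:E)); case/integrableP: fi.
Qed.

(** A translation is the composition of two reflections, so the invariance proved for reflections is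
    enough. *)
Lemma cL2_translate s f : cL2 f -> cL2 (fun x => f (x - s)).
Proof.
move=> /(cL2_reflect (- s)) /(cL2_reflect 0).
by under eq_fun do rewrite sub0r opprK addrC.
Qed.

Lemma sqnorm_translate s f : cL2 f -> sqnorm (fun x => f (x - s)) = sqnorm f.
Proof.
move=> fL; rewrite -(sqnorm_reflect (- s) fL) -(sqnorm_reflect 0 (cL2_reflect (- s) fL)).
by apply: eq_Rintegral => x _; rewrite sub0r opprK addrC.
Qed.

Lemma cmeasurable_indic (A : set R) : measurable A ->
  cmeasurable (fun x => (\1_A x : R)%:C).
Proof. by move=> mA; apply: cmeasurable_real; exact: measurable_indic. Qed.

Lemma integrable_indic_fin (A : set R) : measurable A -> (mu A < +oo)%E ->
  mu.-integrable [set: R] (fun x => (\1_A x)%:E).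
Proof.
move=> mA Afin; apply/integrableP; split.
  by apply/measurable_EFinP; exact: measurable_indic.
rewrite (_ : (\int[mu]_x _)%E = mu A)// -[in RHS](setIT A) -integral_indic//.
by apply: eq_integral => x _; rewrite /= ger0_norm.
Qed.

Lemma cL2_indic (A : set R) : measurable A -> (mu A < +oo)%E ->
  cL2 (fun x => (\1_A x : R)%:C).
Proof.
move=> mA Afin; split; first exact: cmeasurable_indic.
apply: (le_integrable_real _ _ (integrable_indic_fin mA Afin)).
  by apply: measurable_normc_sqr; exact: cmeasurable_indic.
move=> x; rewrite ger0_norm ?sqr_ge0// normc_real real_normK ?num_real//.
by rewrite indicE; case: (_ \in _); rewrite ?expr1n ?expr0n.
Qed.

Lemma sqnorm_indic (A : set R) : measurable A -> (mu A < +oo)%E ->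
  sqnorm (fun x => (\1_A x : R)%:C) = fine (mu A).
Proof.
move=> mA Afin; rewrite -(setIT A) -integral_indic// setIT; congr fine.
apply: eq_integral => x _; rewrite normc_real real_normK ?num_real//.
by rewrite indicE; case: (_ \in _); rewrite ?expr1n ?expr0n.
Qed.

Lemma cL2_bounded f (b : R) (A : set R) : measurable A -> (mu A < +oo)%E ->
  cmeasurable f -> (forall x, A x -> nc (f x) <= b) -> (forall x, ~ A x -> f x = 0) ->
  cL2 f.
Proof.
move=> mA Afin mf fb f0; apply: (cL2_le mf (cL2_indic mA Afin) (b := `|b|)) => x.
rewrite normc_real indicE; have [/set_mem Ax|nAx] := boolP (x \in A).
  by rewrite normr1 mulr1 (le_trans (fb _ Ax))// ler_norm.
rewrite f0 ?normr0 ?mulr0 ?ComplexField.Normc.normc0//.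
by move=> Ax; move: nAx; rewrite mem_set.
Qed.

Lemma cintegrable_cL2 f (A : set R) : measurable A -> (mu A < +oo)%E ->
  cL2 f -> (forall x, ~ A x -> f x = 0) -> cintegrable f.
Proof.
move=> mA Afin fL f0; have := cintegrableM fL (cL2_indic mA Afin).
congr cintegrable; apply/funext => x.
rewrite indicE; have [/set_mem Ax|nAx] := boolP (x \in A); first by rewrite mulr1.
by rewrite mulr0 f0// => Ax; move: nAx; rewrite mem_set.
Qed.

Lemma cL2_mulr f g (b : R) : cmeasurable g -> cL2 f ->
  (forall x, f x != 0 -> nc (g x) <= b) -> cL2 (fun x => g x * f x).
Proof.
move=> mg fL gb; have [mf _] := fL.
apply: (@cL2_le _ f b) => //; first exact: cmeasurableM.
move=> x; rewrite normcM; have [->|fx] := eqVneq (f x) 0.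
  by rewrite ComplexField.Normc.normc0 !mulr0.
by rewrite ler_wpM2r ?normc_ge0// gb.
Qed.

End SquareIntegrable.

(** * Absolutely continuous functions *)

Section AbsoluteContinuity.
Context {R : realType}.
Implicit Types (F G : R -> R) (l : seq (R * R)) (c d x y e : R).

Definition real_abs_continuous c d F : Prop :=
  forall e : R, 0 < e -> exists2 del : R, 0 < del &
    forall (n : nat) (s t : 'I_n -> R),
      (forall i, c <= s i /\ s i <= t i /\ t i <= d) ->
      (forall i j : 'I_n, (i < j)%N -> t i <= s j) ->
      \sum_(i < n) (t i - s i) < del ->
      \sum_(i < n) `|F (t i) - F (s i)| < e.

(* The intervals are listed from right to left. *)
Fixpoint interval_chain c l x : Prop :=
  if l is p :: l' then [/\ p.1 <= p.2, p.2 <= x & interval_chain c l' p.1]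
  else c <= x.

Lemma interval_chain_le c l x : interval_chain c l x -> c <= x.
Proof.
elim: l x => [//|p l IH] x /= [h1 h2 /IH h3].
by rewrite (le_trans h3)// (le_trans h1).
Qed.

Lemma interval_chain_mem c l x p : interval_chain c l x -> p \in l ->
  [/\ c <= p.1, p.1 <= p.2 & p.2 <= x].
Proof.
elim: l x => [//|q l IH] x /= [h1 h2 h3]; rewrite inE => /orP[/eqP ->|/(IH _ h3)[h4 h5 h6]].
  by split => //; exact: interval_chain_le h3.
by split => //; rewrite (le_trans h6)// (le_trans h1).
Qed.

Lemma interval_chain_pairwise c l x : interval_chain c l x ->
  pairwise (fun p q : R * R => q.2 <= p.1) l.
Proof.
elim: l x => [//|q l IH] x /= [h1 h2 h3]; rewrite (IH _ h3) andbT.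
by apply/allP => p /(interval_chain_mem h3)[].
Qed.

Lemma interval_chain_widen c l x y : interval_chain c l x -> x <= y ->
  interval_chain c l y.
Proof.
case: l => [|p l] /=; first exact: le_trans.
by move=> [h1 h2 h3] xy; split => //; exact: le_trans xy.
Qed.

(** The list form of [real_abs_continuous]: adjoining an interval on the right of a family is a
    [cons], which suits both the inductions on families and the supremum argument of
    [zero_derive_const]. *)
Definition chain_abs_continuous c d F : Prop :=
  forall e, 0 < e -> exists2 del : R, 0 < del & forall l,
    interval_chain c l d -> \sum_(p <- l) (p.2 - p.1) < del ->
    \sum_(p <- l) `|F p.2 - F p.1| < e.

Lemma real_abs_continuous_chain c d F :
  real_abs_continuous c d F -> chain_abs_continuous c d F.
Proof.
move=> acF e /acF[del del0 H]; exists del => // l cl.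
pose r := rev l; have rev_sum (K : R * R -> R) :
    \sum_(p <- l) K p = \sum_(i < size r) K (nth (0, 0) r i).
  have -> : \sum_(p <- l) K p = \sum_(p <- r) K p.
    by apply: perm_big; rewrite perm_sym perm_rev.
  by rewrite (big_nth (0, 0)) big_mkord.
rewrite !rev_sum; apply: H => [i|i j ij].
  have : nth (0, 0) r i \in l by rewrite -mem_rev mem_nth.
  by move=> /(interval_chain_mem cl)[].
have sr : size r = size l by exact: size_rev.
have jl : (j < size l)%N by rewrite -sr.
have il : (i < size l)%N by rewrite -sr.
rewrite /r !nth_rev//.
have /(pairwiseP (0, 0)) := interval_chain_pairwise cl.
apply; rewrite ?unfold_in /=.
- by rewrite ltn_subrL (leq_ltn_trans (leq0n _) jl).
- by rewrite ltn_subrL (leq_ltn_trans (leq0n _) jl).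
- by rewrite ltn_sub2l// (leq_ltn_trans ij).
Qed.

(** The intersection with []-oo, x[] is what lets the induction pass: the rest of the chain is
    measured left of [p.1], hence disjointly from the interval [p]. *)
Lemma chain_length_le_measure c l x (U : set R) : measurable U ->
  interval_chain c l x -> (forall p, p \in l -> `]p.1, p.2[ `<=` U) ->
  ((\sum_(p <- l) (p.2 - p.1))%:E <= mu (U `&` `]-oo, x[))%E.
Proof.
move=> mU; elim: l x => [|p l IH] x /=.
  by move=> _ _; rewrite big_nil measure_ge0.
move=> [h1 h2 h3] lU; rewrite big_cons EFinD.
have {}IH : ((\sum_(q <- l) (q.2 - q.1))%:E <= mu (U `&` `]-oo, p.1[))%E.
  by apply: IH => // q ql; apply: lU; rewrite inE ql orbT.
have -> : (p.2 - p.1)%:E = mu `]p.1, p.2[%classic.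
  rewrite lebesgue_measure_itv/= lte_fin; case: ltP => // h4.
  by congr EFin; apply/eqP; rewrite subr_eq0; apply/eqP; lra.
apply: (le_trans (leeD (lexx _) IH)).
rewrite -measureU//=; last 2 first.
- exact: measurableI.
- apply/seteqP; split => y //=; rewrite !in_itv/= => -[/andP[y1 _] [_ y2]]; lra.
apply: le_measure; rewrite ?inE.
- by apply: measurableU => //; exact: measurableI.
- exact: measurableI.
move=> y /= [yp|[Uy]]; last by rewrite !in_itv/= => ?; split => //; lra.
split; first by apply: (lU p) => //; rewrite mem_head.
by move: yp; rewrite !in_itv/= => /andP[_ ?]; lra.
Qed.

Lemma zero_derive_small F (z e : R) : 0 < e -> is_derive z 1 F 0 ->
  exists2 rho, 0 < rho & forall y, `|y - z| < rho -> `|F y - F z| <= e * `|y - z|.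
Proof.
move=> e0 [dF DF].
have : h^-1 *: ((F \o shift z) (h *: (1 : R)) - F z) @[h --> 0^'] --> ('D_1 F z : R) by [].
rewrite DF => /cvgrPdist_lt/(_ _ e0)[rho/= rho0 H].
exists rho => // y yz; have [->|ynz] := eqVneq y z; first by rewrite !subrr normr0 mulr0.
have := H (y - z); rewrite /= sub0r normrN subr_eq0 => /(_ yz ynz).
rewrite sub0r normrN /shift/= [_ *: (1 : R)]mulr1 subrK normrM normfV.
by rewrite ltr_pdivrMl ?normr_gt0 ?subr_eq0// mulrC => /ltW.
Qed.

(** A supremum argument instead of a Vitali covering. The exceptional null set is enclosed in an
    open [U] of measure less than [del]. [P x] says that F can be followed from c to x at the price
    of a slope [e1] plus the variation of F over a chain of intervals inside [U]; that variation is
    below e / 2 by absolute continuity. The points with property P reach d: at a point of the null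
    set an interval in [U] is adjoined, and elsewhere the zero derivative pays with the slope. *)
Lemma zero_derive_const c d F : c <= d -> chain_abs_continuous c d F ->
  {ae mu, forall x : R, x \in `]c, d[ -> is_derive x 1 F 0} -> F d = F c.
Proof.
move=> cd acF [N0 [mN0 N00 HN]].
apply/eqP; rewrite -subr_eq0 -normr_eq0 eq_le normr_ge0 andbT.
apply/ler_addgt0Pr => e e0; rewrite add0r.
(* Then e1 * (d - c) <= e / 2; the [1 +] keeps the divisor positive when c = d. *)
pose e1 := e / 2 / (1 + (d - c)).
have dc0 : 0 <= d - c by rewrite subr_ge0.
have e10 : 0 < e1 by rewrite !divr_gt0// ltr_pwDl.
have e20 : 0 < e / 2 by rewrite divr_gt0.
have [del del0 Hdel] := acF _ e20.
(* The derivative is only known on the open interval, so the endpoints, which the supremum may hit,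
   join the exceptional set. *)
pose N := N0 `|` [set c] `|` [set d].
have mN : measurable N by do 2 apply: measurableU => //.
have N0' : mu N = 0%E.
  apply/negligibleP => //; apply: negligibleU; first apply: negligibleU.
  - by apply/negligibleP.
  - by apply/negligibleP => //; exact: lebesgue_measure_set1.
  - by apply/negligibleP => //; exact: lebesgue_measure_set1.
have [U [oU NU Usmall]] : exists U : set R, [/\ open U, N `<=` U & (mu (U `\` N) < del%:E)%E].
  have Nfin : (mu N < +oo)%E by rewrite N0'.
  exact: lebesgue_regularity_outer.
have mU : measurable U by exact: open_measurable.
have {}Usmall : (mu U < del%:E)%E.
  apply: le_lt_trans Usmall.
  have -> : mu U = (mu (U `\` N) + mu (U `&` N))%E by exact: measureDI.
  have -> : mu (U `&` N) = 0%E; last by rewrite adde0.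
  apply/eqP; rewrite -measure_le0 -N0'; apply: le_measure; rewrite ?inE//.
  exact: measurableI.
pose P x := exists l, [/\ interval_chain c l x, (forall p, p \in l -> `]p.1, p.2[ `<=` U) &
  `|F x - F c| <= e1 * (x - c) + \sum_(p <- l) `|F p.2 - F p.1|].
suff [l [cl lU Hl]] : P d.
  apply: (le_trans Hl); rewrite [leRHS](splitr e) lerD//.
    by rewrite /e1 mulrAC ler_pdivrMr ?ltr_pwDl// ler_pM2l// lerDr.
  apply/ltW/Hdel => //; rewrite -lte_fin; apply: le_lt_trans Usmall.
  apply: (le_trans (chain_length_le_measure mU cl lU)).
  by apply: le_measure; rewrite ?inE//; exact: measurableI.
pose S := [set x | c <= x <= d /\ P x].
have Sc : S c.
  split; first by rewrite lexx.
  by exists [::]; split => //=; rewrite !subrr normr0 big_nil mulr0 addr0.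
have Sub : has_ubound S by exists d => x [/andP[]].
have supS : has_sup S by split => //; exists c.
pose z := sup S.
have cz : c <= z by apply: ub_le_sup.
have zd : z <= d by apply: ge_sup => [|x [/andP[]]//]; exists c.
(* If P passes from points just left of the supremum z to points just right of it, then either z is
   exceeded, which is impossible, or d is reached. *)
have extend rho : 0 < rho ->
    (forall x y, P x -> c <= x <= z -> z - rho < x -> z <= y -> y < z + rho -> y <= d -> P y) -> P d.
  move=> rho0 H.
  have [x [/andP[cx xd] Px] zx] := sup_adherent rho0 supS.
  have xz : x <= z by apply: ub_le_sup => //; split => //; rewrite cx.
  pose y := Num.min (z + rho / 2) d.
  have zy : z <= y by rewrite le_min zd andbT lerDl divr_ge0 ?ltW.
  have yd : y <= d by rewrite ge_min lexx orbT.
  have yrho : y < z + rho by rewrite gt_min; apply/orP; left; lra.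
  have Py : P y by apply: (H x) => //; rewrite cx.
  have Sy : S y by split => //; rewrite yd (le_trans cz zy).
  have : y <= z by exact: ub_le_sup.
  rewrite /y ge_min => /orP[|dz]; first by lra.
  by move: Py; rewrite /y; have -> : Num.min (z + rho / 2) d = d by apply/min_idPr; lra.
have [zN|zN] := pselect (N z).
  have /= := oU _ (NU _ zN); rewrite -/(nbhs z U) => /nbhs_ballP[rho/= rho0 Hrho].
  apply: (extend rho) => // x y [l [cl lU Hl]] /andP[cx xz] zx zy yz yd.
  exists ((x, y) :: l); split => /=.
  - by split => //; exact: le_trans zy.
  - move=> p; rewrite inE => /orP[/eqP -> w /=|/lU//].
    rewrite in_itv/= => /andP[w1 w2]; apply: Hrho.
    by rewrite /ball/= ltr_norml; apply/andP; split; lra.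
  - rewrite big_cons/=; have -> : F y - F c = (F y - F x) + (F x - F c) by ring.
    apply: (le_trans (ler_normD _ _)).
    have : e1 * (x - c) <= e1 * (y - c) by rewrite ler_pM2l//; lra.
    lra.
have dz : is_derive z 1 F 0.
  apply: contrapT => ndz; apply: (zN); left; left; apply: HN => /= H; apply: ndz; apply: H.
  rewrite in_itv/= !lt_neqAle cz zd !andbT; apply/andP; split; apply/eqP => zz; apply: zN.
    by left; right.
  by right.
have [rho rho0 Hrho] := zero_derive_small e10 dz.
apply: (extend rho) => // x y [l [cl lU Hl]] /andP[cx xz] zx zy yz yd.
exists l; split => //.
  by apply: (interval_chain_widen cl); lra.
have h1 : `|F y - F z| <= e1 * (y - z).
  by have := Hrho y; rewrite ger0_norm ?subr_ge0//; apply; lra.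
have h2 : `|F x - F z| <= e1 * (z - x).
  by have := Hrho x; rewrite (distrC x z) ger0_norm ?subr_ge0//; apply; lra.
have -> : F y - F c = (F y - F z) - (F x - F z) + (F x - F c) by ring.
apply: (le_trans (ler_normD _ _)).
have := ler_normB (F y - F z) (F x - F z).
have : e1 * (y - c) = e1 * (y - z) + e1 * (z - x) + e1 * (x - c) by ring.
lra.
Qed.

End AbsoluteContinuity.

(** * The fundamental theorem of calculus for absolutely continuous functions *)

Section FundamentalTheorem.
Context {R : realType}.
Implicit Types (F G g : R -> R) (l : seq (R * R)) (c d x y e : R).

Lemma chain_abs_continuousB c d F G : chain_abs_continuous c d F ->
  chain_abs_continuous c d G -> chain_abs_continuous c d (fun x => F x - G x).
Proof.
move=> acF acG e e0; have e20 : 0 < e / 2 by rewrite divr_gt0.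
have [d1 d10 H1] := acF _ e20; have [d2 d20 H2] := acG _ e20.
exists (Num.min d1 d2); first by rewrite lt_min d10.
move=> l cl; rewrite lt_min => /andP[l1 l2].
rewrite [ltRHS](splitr e); apply: le_lt_trans (ltrD (H1 _ cl l1) (H2 _ cl l2)).
rewrite -big_split/=; apply: ler_sum => p _.
rewrite (_ : _ - _ = (F p.2 - F p.1) - (G p.2 - G p.1)); last by ring.
exact: ler_normB.
Qed.

(** [A] is the union of the intervals of the chain, so that one application of the absolute
    continuity of the integral controls all increments at once. *)
Lemma indefinite_integral_chain g c l x :
  mu.-integrable [set: R] (fun t => (g t)%:E) -> interval_chain c l x ->
  let G y := \int[mu]_(t in `]-oo, y]) g t in
  exists A : set R, [/\ measurable A, A `<=` `]-oo, x],
    (mu A <= (\sum_(p <- l) (p.2 - p.1))%:E)%E &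
    \sum_(p <- l) `|G p.2 - G p.1| <= \int[mu]_(t in A) `|g t|].
Proof.
move=> ig cl G; have igS (A : set R) : measurable A -> mu.-integrable A (EFin \o g).
  by move=> mA; apply: integrableS ig.
have ign (A : set R) : measurable A -> mu.-integrable A (EFin \o (fun t => `|g t|)).
  move=> mA; have ig' : mu.-integrable [set: R] (fun t => `|g t|%:E).
    exact: (integrable_abse ig).
  by apply: integrableS ig'.
elim: l x cl => [|p l IH] x /=.
  by move=> _; exists set0; rewrite measure0 !big_nil Rintegral_set0; split.
move=> [h1 h2 /IH[A [mA Ax muA HA]]].
exists (A `|` `]p.1, p.2]); split.
- by apply: measurableU.
- move=> y /= [/Ax/=|]; rewrite !in_itv/=; first by lra.
  by move=> /andP[]; lra.
- have lp : (mu (`]p.1, p.2]%classic : set R) <= (p.2 - p.1)%:E)%E.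
    rewrite lebesgue_measure_itv/= lte_fin.
    by case: ltP => // h; rewrite lee_fin subr_ge0.
  rewrite big_cons addrC EFinD; apply: (le_trans (measureU2 _ _ _)) => //.
  exact: leeD.
- rewrite big_cons Rintegral_setU//=; last 2 first.
  + by apply: ign; exact: measurableU.
  + apply/disj_setPS => y /= [/Ax/=]; rewrite !in_itv/= => h3 /andP[]; lra.
  have GB : G p.2 - G p.1 = \int[mu]_(t in `]p.1, p.2]) g t.
    apply: Rintegral_itvB; [exact: igS| |]; by rewrite bnd_simp.
  rewrite addrC lerD// GB.
  by apply: le_normr_Rintegral => //; exact: igS.
Qed.

Lemma indefinite_integral_abs_continuous g c d :
  mu.-integrable [set: R] (fun t => (g t)%:E) ->
  chain_abs_continuous c d (fun y => \int[mu]_(t in `]-oo, y]) g t).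
Proof.
move=> ig e e0; have [del [del0 H]] := integral_normr_continuous ig e0.
exists del => // l cl ldel.
have [A [mA _ muA HA]] := indefinite_integral_chain ig cl.
apply: (le_lt_trans HA); apply: H => //.
by apply: (le_lt_trans muA); rewrite lte_fin.
Qed.

(** By Lebesgue differentiation the indefinite integral G of g has derivative g almost everywhere; F
    - G is then absolutely continuous with derivative zero almost everywhere, hence takes equal
    values at c and d. *)
Lemma abs_continuous_FTC F g c d : c <= d -> chain_abs_continuous c d F ->
  mu.-integrable [set: R] (fun t => (g t)%:E) ->
  {ae mu, forall x : R, x \in `]c, d[ -> is_derive x 1 F (g x)} ->
  F d - F c = \int[mu]_(t in `]c, d]) g t.
Proof.
move=> cd acF ig dF.
pose G y := \int[mu]_(t in `]-oo, y]) g t.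
have igS (A : set R) : measurable A -> mu.-integrable A (EFin \o g).
  by move=> mA; apply: integrableS ig.
have dG : {ae mu, forall x : R, derivable G x 1 /\ derive1 G x = g x}.
  apply: FTC1Ny; first by move=> y; exact: igS.
  by apply: open_integrable_locally => //; exact: openT.
have := zero_derive_const cd
  (chain_abs_continuousB acF (indefinite_integral_abs_continuous c d ig)).
rewrite -/G => H; have {}H : F d - G d = F c - G c.
  apply: H; apply: (@filterS2 _ _ (ae_filter_ringOfSetsType mu) _ _ _ _ dG dF).
  move=> x [dGx Gx] dFx cdx.
  have dFx' := dFx cdx.
  have dG' : is_derive x 1 G (g x).
    by apply: DeriveDef => //; rewrite -derive1E.
  by apply: is_derive_eq; rewrite subrr.
have GB : G d - G c = \int[mu]_(t in `]c, d]) g t.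
  apply: Rintegral_itvB; [exact: igS| |]; by rewrite bnd_simp.
rewrite -GB; move: H; lra.
Qed.

End FundamentalTheorem.

(** * Variation of constants for Caratheodory solutions *)

Section VariationOfConstants.
Context {R : realType}.
Implicit Types (f g h : R -> R[i]) (c d x y t s b : R) (z w : R[i]).

Lemma abs_continuous_sub c d x f : abs_continuous c d f -> x <= d ->
  abs_continuous c x f.
Proof.
move=> acf xd e /acf[del del0 H]; exists del => // n s t st.
apply: H => i; have [h1 [h2 h3]] := st i.
by split => //; split => //; exact: le_trans xd.
Qed.

Lemma abs_continuous_Re c d f : abs_continuous c d f ->
  real_abs_continuous c d (fun x => Re (f x)).
Proof.
move=> acf e /acf[del del0 H]; exists del => // n s t st ord sdel.
apply: le_lt_trans (H n s t st ord sdel); apply: ler_sum => i _.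
rewrite -cReN -cReD; exact: Re_le_normc.
Qed.

Lemma abs_continuous_Im c d f : abs_continuous c d f ->
  real_abs_continuous c d (fun x => Im (f x)).
Proof.
move=> acf e /acf[del del0 H]; exists del => // n s t st ord sdel.
apply: le_lt_trans (H n s t st ord sdel); apply: ler_sum => i _.
rewrite -cImN -cImD; exact: Im_le_normc.
Qed.

Lemma real_abs_continuous_continuous c d (F : R -> R) : real_abs_continuous c d F ->
  {within `[c, d], continuous F}.
Proof.
move=> acF; apply/subspace_continuousP => x; rewrite /= in_itv/= => /andP[cx xd].
apply/cvgrPdist_lt => e /acF[del del0 H].
exists del => //= y; rewrite /ball_/= => xy; rewrite in_itv/= => /andP[cy yd].
have [xley|yltx] := leP x y.
- have := H 1%N (fun=> x) (fun=> y); rewrite !big_ord1 distrC; apply.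
  + by [].
  + by move=> i j; rewrite !ord1.
  + by apply: le_lt_trans xy; rewrite distrC ler_norm.
- have := H 1%N (fun=> y) (fun=> x); rewrite !big_ord1; apply.
  + by move=> _; split => //; split => //; exact: ltW.
  + by move=> i j; rewrite !ord1.
  + by apply: le_lt_trans xy; rewrite ler_norm.
Qed.

Lemma within_continuous_bounded c d (F : R -> R) : c <= d ->
  {within `[c, d], continuous F} -> exists M, forall x, c <= x <= d -> `|F x| <= M.
Proof.
move=> cd cF; have [u ucd Hu] := EVT_max cd cF; have [v vcd Hv] := EVT_min cd cF.
exists (`|F u| + `|F v|) => x cxd.
have := Hu x; have := Hv x; rewrite in_itv/= cxd => /(_ isT) h1 /(_ isT) h2.
have := ler_norm (F u); have := ler_norm (- F v); rewrite normrN => h3 h4.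
rewrite ler_norml; have := normr_ge0 (F u); have := normr_ge0 (F v).
by move=> *; apply/andP; split; lra.
Qed.

Lemma abs_continuous_bounded c d f : c <= d -> abs_continuous c d f ->
  exists M, forall x, c <= x <= d -> nc (f x) <= M.
Proof.
move=> cd acf.
have [M1 H1] := within_continuous_bounded cd
  (real_abs_continuous_continuous (abs_continuous_Re acf)).
have [M2 H2] := within_continuous_bounded cd
  (real_abs_continuous_continuous (abs_continuous_Im acf)).
exists (M1 + M2) => x cxd; apply: (le_trans (normc_le_ReIm _)).
by rewrite lerD// ?H1 ?H2.
Qed.

(** The increment of the product splits into [h (t i)] times the increment of f and the increment of
    h times [f (s i)], where f is bounded by absolute continuity. A bounded Lipschitz h suffices
    because the factors needed are exponentials. *)
Lemma abs_continuousM c d f h (M K : R) : c <= d -> abs_continuous c d f ->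
  (forall x, c <= x <= d -> nc (h x) <= M) ->
  (forall x y, c <= x -> x <= y -> y <= d -> nc (h y - h x) <= K * (y - x)) ->
  abs_continuous c d (fun x => h x * f x).
Proof.
move=> cd acf hM hK.
have [N HN] := abs_continuous_bounded cd acf.
have N0 : 0 <= N by apply: le_trans (HN c _); rewrite ?normc_ge0// lexx cd.
have M0 : 0 <= M by apply: le_trans (hM c _); rewrite ?normc_ge0// lexx cd.
move=> e e0.
have e1 : 0 < e / 2 / (M + 1) by rewrite !divr_gt0// ltr_wpDl.
have [del del0 H] := acf _ e1.
pose L := N * `|K| + 1.
have L0 : 0 < L by rewrite ltr_wpDl// mulr_ge0.
exists (Num.min del (e / 2 / L)); first by rewrite lt_min del0 !divr_gt0.
move=> n s t st ord; rewrite lt_min => /andP[sd1 sd2].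
have {}H := H n s t st ord sd1.
have -> : e = (M + 1) * (e / 2 / (M + 1)) + L * (e / 2 / L).
  by field; apply/andP; split; rewrite gt_eqF// ltr_wpDl.
apply: (@le_lt_trans _ _ ((M + 1) * \sum_(i < n) nc (f (t i) - f (s i)) + L * \sum_(i < n) (t i - s i))).
  rewrite !mulr_sumr -big_split/=; apply: ler_sum => i _.
  have [h1 [h2 h3]] := st i.
  have -> : h (t i) * f (t i) - h (s i) * f (s i) =
    h (t i) * (f (t i) - f (s i)) + (h (t i) - h (s i)) * f (s i) by ring.
  apply: (le_trans (le_normcD _ _)); rewrite !normcM.
  apply: lerD.
    rewrite ler_wpM2r ?normc_ge0//; apply: (@le_trans _ _ M); last by lra.
    by apply: hM; rewrite h3 (le_trans h1 h2).
  have a1 := hK _ _ h1 h2 h3.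
  have a2 : nc (f (s i)) <= N by apply: HN; rewrite h1 (le_trans h2).
  have a3 := normc_ge0 (h (t i) - h (s i)); have a4 := normc_ge0 (f (s i)).
  have ts : 0 <= t i - s i by rewrite subr_ge0.
  have a5 : K * (t i - s i) <= `|K| * (t i - s i) by rewrite ler_wpM2r// ler_norm.
  apply: (@le_trans _ _ (`|K| * (t i - s i) * N)).
    by apply: ler_pM => //; exact: le_trans a5.
  by rewrite /L; have : 0 <= (t i - s i) by []; nra.
by rewrite ltrD// ltr_pM2l// ltr_wpDl.
Qed.

Lemma cexp_bound w x d : 0 <= x <= d -> nc (cexp (w * x%:C)) <= expR (nc w * d).
Proof.
move=> /andP[x0 xd]; rewrite normc_cexp ler_expR cReM/= mulr0 subr0.
apply: (@le_trans _ _ (`|Re w| * x)); first by rewrite ler_wpM2r// ler_norm.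
by rewrite ler_pM// Re_le_normc.
Qed.

Lemma cexp_lipschitz w d x y : 0 <= x -> x <= y -> y <= d ->
  nc (cexp (w * y%:C) - cexp (w * x%:C)) <=
  expR (nc w * d) * (2 * nc w * expR (nc w * d)) * (y - x).
Proof.
move=> x0 xy yd; have -> : w * y%:C = w * x%:C + w * (y - x)%:C.
  by rewrite -mulrDr -rmorphD/= addrCA subrr addr0.
rewrite cexpD -[X in _ - X]mulr1 -mulrBr normcM -mulrA ler_pM ?normc_ge0//.
  by apply: cexp_bound; rewrite x0 (le_trans xy).
apply: (le_trans (normc_cexpB1 _)).
rewrite normcM normc_real ger0_norm ?subr_ge0// cReM/= mulr0 subr0 normrM.
rewrite (ger0_norm (_ : 0 <= y - x)) ?subr_ge0//.
rewrite -!mulrA ler_wpM2l// ler_wpM2l ?normc_ge0// mulrC ler_wpM2r ?subr_ge0//.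
by rewrite ler_expR ler_pM ?subr_ge0//; [exact: Re_le_normc|lra].
Qed.

Lemma is_cderive_cexp w x :
  is_cderive x (fun t => cexp (w * t%:C)) (w * cexp (w * x%:C)).
Proof.
case: w => a b.
have E t : cexp ((a +i* b) * t%:C) = (expR (a * t) * cos (b * t)) +i* (expR (a * t) * sin (b * t)).
  by rewrite /cexp cReM cImM/= !mulr0 subr0 add0r.
split.
- rewrite (_ : (fun t => Re _) = fun t => expR (a * t) * cos (b * t)); last first.
    by apply/funext => t; rewrite E.
  by apply: is_derive_eq; rewrite E /GRing.scale/=; ring.
- rewrite (_ : (fun t => Im _) = fun t => expR (a * t) * sin (b * t)); last first.
    by apply/funext => t; rewrite E.
  by apply: is_derive_eq; rewrite E /GRing.scale/=; ring.
Qed.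

Lemma is_cderiveM x f h df dh : is_cderive x f df -> is_cderive x h dh ->
  is_cderive x (fun t => h t * f t) (dh * f x + h x * df).
Proof.
move=> [f1 f2] [h1 h2]; split.
- rewrite (_ : (fun t => Re _) = fun t => Re (h t) * Re (f t) - Im (h t) * Im (f t)); last first.
    by apply/funext => t; rewrite cReM.
  by apply: is_derive_eq; rewrite cReD !cReM /GRing.scale/=; ring.
- rewrite (_ : (fun t => Im _) = fun t => Re (h t) * Im (f t) + Im (h t) * Re (f t)); last first.
    by apply/funext => t; rewrite cImM.
  by apply: is_derive_eq; rewrite cImD !cImM /GRing.scale/=; ring.
Qed.

Lemma cintegrable_bounded f g b : cmeasurable g -> cintegrable f ->
  (forall x, nc (g x) <= b) -> cintegrable (fun x => g x * f x).
Proof.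
move=> mg fi gb; apply: (cintegrable_le _ _ (integrableZlr b (integrable_normc fi))).
  by apply: cmeasurableM => //; exact: cintegrable_measurable.
by move=> x; rewrite normcM ler_wpM2r// normc_ge0.
Qed.

Lemma normc_indic_le1 (A : set R) x : nc ((\1_A x : R)%:C) <= 1.
Proof. by rewrite normc_real indicE; case: (_ \in _); rewrite ?normr1 ?normr0. Qed.

Lemma cintegrable_indicM (A : set R) f : measurable A -> cintegrable f ->
  cintegrable (fun x => (\1_A x : R)%:C * f x).
Proof.
move=> mA fi; apply: (@cintegrable_bounded _ _ 1) => //.
  exact: cmeasurable_indic.
by move=> x; exact: normc_indic_le1.
Qed.

Lemma Rintegral_indicM (A : set R) (u : R -> R) :
  \int[mu]_x (\1_A x * u x) = \int[mu]_(x in A) u x.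
Proof.
rewrite [RHS]Rintegral_mkcond; apply: eq_Rintegral => x _.
by rewrite patchE indicE; case: (_ \in _); rewrite ?mul1r ?mul0r.
Qed.

Lemma abs_continuous_cFTC c d f g : c <= d -> abs_continuous c d f -> cintegrable g ->
  {ae mu, forall x : R, x \in `]c, d[ -> is_cderive x f (g x)} ->
  f d = f c + cint (fun t => (\1_(`]c, d]%classic) t : R)%:C * g t).
Proof.
move=> cd acf [g1 g2] df.
have H1 := @abs_continuous_FTC _ _ _ _ _ cd
  (real_abs_continuous_chain (abs_continuous_Re acf)) g1.
have H2 := @abs_continuous_FTC _ _ _ _ _ cd
  (real_abs_continuous_chain (abs_continuous_Im acf)) g2.
apply: complex_ext; rewrite ?cReD ?cImD/=.
- under eq_Rintegral do rewrite cReM/= mul0r subr0.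
  rewrite Rintegral_indicM -H1 ?subrKC//; apply: (@filterS _ _ (ae_filter_ringOfSetsType mu) _ _ _ df) => x.
  by move=> H /H[].
- under eq_Rintegral do rewrite cImM/= mul0r addr0.
  rewrite Rintegral_indicM -H2 ?subrKC//; apply: (@filterS _ _ (ae_filter_ringOfSetsType mu) _ _ _ df) => x.
  by move=> H /H[].
Qed.

(** The function e^(-w t) f(t) is absolutely continuous with derivative e^(-w t) g(t) almost
    everywhere; integrating over []0, x]] and multiplying by e^(w x) gives the formula. *)
Lemma variation_of_constants w d f g : 0 <= d -> abs_continuous 0 d f ->
  cintegrable g ->
  {ae mu, forall x : R, x \in `]0, d[ -> is_cderive x f (w * f x + g x)} ->
  forall x, 0 <= x <= d ->
  f x = cexp (w * x%:C) * f 0 +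
    cint (fun t => (\1_(`]0, x]%classic) t : R)%:C * (cexp (w * (x - t)%:C) * g t)).
Proof.
move=> d0 acf gi df x /andP[x0 xd].
pose h t := cexp (- w * t%:C).
(* The exponential is unbounded on the line, so the cut to []0, x]] is put into the integrand itself
   to make it integrable. *)
pose g' t := (\1_(`]0, x]%classic) t : R)%:C * h t * g t.
have mh : cmeasurable h.
  apply: cmeasurable_cexp; apply: cmeasurableM; first exact: cmeasurable_cst.
  by apply: cmeasurable_real; exact: measurable_id.
have g'i : cintegrable g'.
  apply: (@cintegrable_bounded _ _ (expR (nc w * x))) => //.
    by apply: cmeasurableM => //; exact: cmeasurable_indic.
  move=> t; rewrite normcM normc_real indicE; case: (boolP (t \in _)) => [|_].
    rewrite inE/= in_itv/= => /andP[t0 tx]; rewrite normr1 mul1r.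
    by rewrite /h -(normcN w); apply: cexp_bound; apply/andP; split; [exact: ltW|].
  by rewrite normr0 mul0r expR_ge0.
have H : h x * f x = h 0 * f 0 + cint (fun t => (\1_(`]0, x]%classic) t : R)%:C * g' t).
  apply: (@abs_continuous_cFTC _ _ (fun t => h t * f t)) => //.
    apply: (@abs_continuousM 0 x f h (expR (nc (- w) * x))
      (expR (nc (- w) * x) * (2 * nc (- w) * expR (nc (- w) * x)))) => //.
    - exact: (abs_continuous_sub acf xd).
    - by move=> y y0x; exact: cexp_bound.
    - by move=> y z y0 yz zx; exact: cexp_lipschitz.
  apply: (@filterS _ _ (ae_filter_ringOfSetsType mu) _ _ _ df) => t H t0x.
  have {}H : is_cderive t f (w * f t + g t).
    by apply: H; move: t0x; rewrite !in_itv/= => /andP[-> tx]; exact: lt_le_trans xd.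
  have := is_cderiveM H (is_cderive_cexp (- w) t).
  rewrite -/(h t); congr is_cderive.
  rewrite /g' indicE mem_set ?mul1r; last first.
    by move: t0x; rewrite /= !in_itv/= => /andP[-> /ltW].
  by ring.
have hK t : cexp (w * t%:C) * h t = 1.
  by rewrite -cexpD mulNr subrr cexp0.
rewrite -[f x]mul1r -(hK x) -mulrA H mulrDr; congr (_ + _).
  by rewrite /h mulr0 cexp0 mul1r.
rewrite -cintZ; last exact: cintegrable_indicM.
congr cint; apply/funext => t; rewrite /g' indicE; case: (_ \in _); last by rewrite !mul0r mulr0.
rewrite !mul1r mulrA; congr (_ * _); rewrite /h -cexpD; congr cexp.
by rewrite rmorphB/=; ring.
Qed.

End VariationOfConstants.

(** * Fubini's theorem for complex-valued functions *)

Section ComplexFubini.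
Context {R : realType}.
Local Notation T := (measurableTypeR R).
Implicit Types (f g k P M : R -> R[i]) (s t v b : R).

Lemma integrable_prod_le (u v : T * T -> R) : measurable_fun setT u -> measurable_fun setT v ->
  (forall p, `|u p| <= v p) ->
  ((\int[@lebesgue_measure R]_x \int[@lebesgue_measure R]_y (v (x, y))%:E < +oo)%E) ->
  (@lebesgue_measure R \x @lebesgue_measure R)%E.-integrable setT (EFin \o u).
Proof.
move=> mfu mfv uv fv; apply/integrable12ltyP; first by apply/measurable_EFinP.
apply: le_lt_trans fv.
have mE (w : T * T -> R) : measurable_fun setT w ->
    measurable_fun setT (fun x : T => (\int[@lebesgue_measure R]_y `|(w (x, y))%:E|)%E).
  move=> mw; apply: (measurable_fun_fubini_tonelli_F (fun p : T * T => `|(w p)%:E|%E)) => //.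
  by apply: measurableT_comp => //; apply/measurable_EFinP.
have v0 p : 0 <= v p by apply: le_trans (uv p).
apply: ge0_le_integral => //.
- by move=> x _; apply: integral_ge0.
- exact: mE.
- have := mE v mfv; apply: eq_measurable_fun => x _; apply: eq_integral => y _.
  by rewrite /= ger0_norm.
move=> x _; apply: ge0_le_integral => //.
- have /measurable_EFinP mu1 : measurable_fun setT (fun y : T => u (x, y)).
    exact: (measurableT_comp mfu (pair1_measurable x)).
  exact: measurableT_comp mu1.
- by apply/measurable_EFinP; exact: (measurableT_comp mfv (pair1_measurable x)).
- by move=> y _; rewrite lee_fin.
Qed.

Lemma Rintegral_Fubini (u : T * T -> R) :
  (@lebesgue_measure R \x @lebesgue_measure R)%E.-integrable setT (EFin \o u) ->
  (forall t, mu.-integrable [set: R] (fun v => (u (t, v))%:E)) ->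
  (forall v, mu.-integrable [set: R] (fun t => (u (t, v))%:E)) ->
  [/\ \int[mu]_t (\int[mu]_v u (t, v)) = \int[mu]_v (\int[mu]_t u (t, v)),
      mu.-integrable [set: R] (fun t => (\int[mu]_v u (t, v))%:E) &
      measurable_fun [set: R] (fun v => \int[mu]_t u (t, v))].
Proof.
move=> iu iu1 iu2; split; last 2 first.
- have := integrable_fubini_F iu; congr integrable; apply/funext => x.
  by rewrite /fubini_F /Rintegral fineK//; apply: integrable_fin_num.
- by apply: measurableT_comp (measurable_fubini_G iu).
have := Fubini iu => /(congr1 fine); rewrite /Rintegral => H.
transitivity (fine (\int[@lebesgue_measure R]_x \int[@lebesgue_measure R]_y (u (x, y))%:E)).
  congr fine; apply: eq_integral => x _.
  by rewrite fineK//; apply: integrable_fin_num.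
rewrite H; congr fine; apply: eq_integral => x _.
by rewrite /= fineK//; apply: integrable_fin_num.
Qed.

Lemma cint_Fubini (h : T * T -> R[i]) (w : T * T -> R) :
  measurable_fun setT (fun p => Re (h p)) -> measurable_fun setT (fun p => Im (h p)) ->
  measurable_fun setT w -> (forall p, nc (h p) <= w p) ->
  ((\int[@lebesgue_measure R]_x \int[@lebesgue_measure R]_y (w (x, y))%:E < +oo)%E) ->
  (forall t, cintegrable (fun v => h (t, v))) ->
  (forall v, cintegrable (fun t => h (t, v))) ->
  [/\ cint (fun t => cint (fun v => h (t, v))) = cint (fun v => cint (fun t => h (t, v))),
      cintegrable (fun t => cint (fun v => h (t, v))) &
      cmeasurable (fun v => cint (fun t => h (t, v)))].
Proof.
move=> mr mi mw hw fw i1 i2.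
have [H1 M1 N1] := @Rintegral_Fubini (fun p => Re (h p))
  (integrable_prod_le mr mw (fun p => le_trans (Re_le_normc _) (hw p)) fw)
  (fun t => (i1 t).1) (fun v => (i2 v).1).
have [H2 M2 N2] := @Rintegral_Fubini (fun p => Im (h p))
  (integrable_prod_le mi mw (fun p => le_trans (Im_le_normc _) (hw p)) fw)
  (fun t => (i1 t).2) (fun v => (i2 v).2).
by split; [exact: complex_ext|split|split].
Qed.

(** The dominating function |P(t)| b |M(s + t - v)| has an inner integral independent of t, by
    reflection, so its double integral is b times the product of the two L1 norms. Square
    integrability makes the convolution of P and M exist for every v, not just for almost every
    one. *)
Lemma cint_swap_convolution P M k s b : cL2 P -> cL2 M -> cintegrable P ->
  cintegrable M -> cmeasurable k -> (forall v, nc (k v) <= b) ->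
  [/\ cint (fun t => P t * cint (fun v => k v * M (s + t - v))) =
      cint (fun v => k v * cint (fun t => P t * M (s + t - v))),
      cintegrable (fun t => P t * cint (fun v => k v * M (s + t - v))) &
      cmeasurable (fun v => k v * cint (fun t => P t * M (s + t - v)))].
Proof.
move=> PL ML Pi Mi mk kb.
have [mP1 mP2] := cintegrable_measurable Pi.
have [mM1 mM2] := cintegrable_measurable Mi.
have [mk1 mk2] := mk.
have b0 : 0 <= b by apply: le_trans (kb 0); exact: normc_ge0.
have mph : @measurable_fun _ _ (T * T)%type T setT (fun p : T * T => s + p.1 - p.2 : R).
  apply: measurable_funB; last exact: measurable_snd.
  by apply: measurable_funD; [exact: measurable_cst|exact: measurable_fst].
have i1 t : cintegrable (fun v => k v * M (s + t - v)).
  by apply: (cintegrable_bounded (b := b)) => //; exact: cintegrable_reflect.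
have i2 v : cintegrable (fun t => P t * M (s + t - v)).
  apply: cintegrableM => //.
  have := cL2_translate (v - s) ML; congr cL2; apply/funext => t; congr M; ring.
pose h (p : T * T) := P p.1 * (k p.2 * M (s + p.1 - p.2)).
pose w (p : T * T) : R := nc (P p.1) * (b * nc (M (s + p.1 - p.2))).
have c1 (f : R -> R[i]) (m1 : cmeasurable f) :
    measurable_fun setT (fun p : T * T => Re (f p.1)) /\ measurable_fun setT (fun p : T * T => Im (f p.1)).
  by case: m1 => m1 m2; split; [exact: (measurableT_comp m1 measurable_fst)|exact: (measurableT_comp m2 measurable_fst)].
have c2 (f : R -> R[i]) (m1 : cmeasurable f) :
    measurable_fun setT (fun p : T * T => Re (f p.2)) /\ measurable_fun setT (fun p : T * T => Im (f p.2)).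
  by case: m1 => m1 m2; split; [exact: (measurableT_comp m1 measurable_snd)|exact: (measurableT_comp m2 measurable_snd)].
have [P1 P2] := c1 _ (cintegrable_measurable Pi).
have [k1 k2] := c2 _ mk.
have M1 : measurable_fun setT (fun p : T * T => Re (M (s + p.1 - p.2))).
  exact: (measurableT_comp mM1 mph).
have M2 : measurable_fun setT (fun p : T * T => Im (M (s + p.1 - p.2))).
  exact: (measurableT_comp mM2 mph).
have [|||||||E IE1 IE2] := @cint_Fubini h w.
- under eq_fun do rewrite /h !cReM cImM.
  by apply: measurable_funB; apply: measurable_funM => //;
    [apply: measurable_funB|apply: measurable_funD]; apply: measurable_funM.
- under eq_fun do rewrite /h !cImM cReM.
  by apply: measurable_funD; apply: measurable_funM => //;
    [apply: measurable_funD|apply: measurable_funB]; apply: measurable_funM.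
- apply: measurable_funM.
    exact: (measurableT_comp (measurable_normc (cintegrable_measurable Pi)) measurable_fst).
  apply: measurable_funM; first exact: measurable_cst.
  exact: (measurableT_comp (measurable_normc (cintegrable_measurable Mi)) mph).
- by move=> p; rewrite /h /w !normcM ler_wpM2l ?normc_ge0// ler_wpM2r ?normc_ge0.
- pose J := (\int[mu]_y (nc (M y))%:E)%E.
  have mM : measurable_fun [set: R] (fun y => (nc (M y))%:E).
    by apply/measurable_EFinP; exact: measurable_normc (cintegrable_measurable Mi).
  have mP : measurable_fun [set: R] (fun y => (nc (P y))%:E).
    by apply/measurable_EFinP; exact: measurable_normc (cintegrable_measurable Pi).
  have Jfin : J \is a fin_num by apply: integrable_fin_num => //; exact: integrable_normc.
  have inner x : (\int[@lebesgue_measure R]_y (w (x, y))%:E =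
      (nc (P x))%:E * (b%:E * J))%E.
    have mMx : measurable_fun [set: R] (fun y => (nc (M (s + x - y)))%:E).
      exact: (measurableT_comp mM (measurable_reflect (s + x))).
    transitivity (\int[mu]_y ((nc (P x) * b)%:E * (nc (M (s + x - y)))%:E))%E.
      by apply: eq_integral => y _; rewrite /w/= -EFinM mulrA.
    have Mx0 (y : R) : setT y -> (0 <= (nc (M (s + x - y)))%:E)%E.
      by move=> _; rewrite lee_fin normc_ge0.
    have b1 : (0 <= nc (P x) * b) by rewrite mulr_ge0 ?normc_ge0.
    rewrite ge0_integralZl_EFin//.
    by rewrite EFinM -muleA; congr (_ * (_ * _))%E; exact: (integral_reflect (s + x) mM).
  under eq_integral do rewrite inner.
  rewrite ge0_integralZr//=.
  + apply: lte_mul_pinfty.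
    * by apply: integral_ge0 => y _; rewrite lee_fin normc_ge0.
    * by apply: integrable_fin_num => //; exact: integrable_normc.
    * by rewrite -(fineK Jfin) -EFinM ltey.
  + by move=> y _; rewrite lee_fin normc_ge0.
  + by rewrite mule_ge0 ?lee_fin// integral_ge0// => y _; rewrite lee_fin normc_ge0.
- by move=> t; exact: (cintegrableZ (P t) (i1 t)).
- move=> v; have := cintegrableZ (k v) (i2 v); congr cintegrable.
  by apply/funext => t; rewrite /h/= mulrCA.
have E1 : (fun t => cint (fun v => h (t, v))) =
    (fun t => P t * cint (fun v => k v * M (s + t - v))).
  by apply/funext => t; rewrite /h/= cintZ.
have E2 : (fun v => cint (fun t => h (t, v))) =
    (fun v => k v * cint (fun t => P t * M (s + t - v))).
  apply/funext => v; transitivity (cint (fun t => k v * (P t * M (s + t - v)))).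
    by congr cint; apply/funext => t; rewrite /h/= mulrCA.
  exact: cintZ.
split; [|exact: (eq_ind _ cintegrable IE1 _ E1)|exact: (eq_ind _ cmeasurable IE2 _ E2)].
exact: (etrans (congr1 cint (esym E1)) (etrans E (congr1 cint E2))).
Qed.

End ComplexFubini.

(** * Diagonalised systems with delay *)

#[global] Arguments cexp : simpl never.
#[global] Arguments ComplexField.Normc.normc : simpl never.

Section DelaySystem.
Context {R : realType}.
Implicit Types (f g P M : R -> R[i]) (a d x t v : R) (w c : R[i]).

Lemma indic_in (A : set R) x : A x -> (\1_A x : R)%:C = 1.
Proof. by move=> Ax; rewrite indicE mem_set. Qed.

Lemma abs_continuous_cmeasurable d f : abs_continuous 0 d f ->
  cmeasurable (fun x => (\1_(`[0, d]%classic) x : R)%:C * f x).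
Proof.
move=> acf.
have H (F : R -> R) : {within `[0, d], continuous F} ->
    measurable_fun [set: R] (fun x => \1_(`[0, d]%classic) x * F x).
  move=> cF; have mF : measurable_fun (`[0, d]%classic : set R) F.
    exact: measurable_realfun.subspace_continuous_measurable_fun.
  have := (measurable_restrictT F (measurable_itv _)).1 mF.
  apply: eq_measurable_fun => x _; rewrite patchE indicE.
  by case: (_ \in _); rewrite ?mul1r ?mul0r.
split.
- under eq_fun do rewrite cReM/= mul0r subr0.
  exact: H (real_abs_continuous_continuous (abs_continuous_Re acf)).
- under eq_fun do rewrite cImM/= mul0r addr0.
  exact: H (real_abs_continuous_continuous (abs_continuous_Im acf)).
Qed.

(** Vanishing is required at every point outside the open interval, not just almost everywhere, so
    that integrands can be rewritten pointwise; the potentials are cut off accordingly. *)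
Definition supported a d P := forall x, ~ (a < x < d) -> P x = 0.

Lemma cintegrable_delayed a d P g : 0 <= a -> a <= d -> cintegrable P ->
  supported a d P -> abs_continuous 0 d g -> cintegrable (fun x => P x * g (x - a)).
Proof.
move=> a0 ad Pi sP acg; have d0 : 0 <= d by apply: le_trans ad.
have [N HN] := abs_continuous_bounded d0 acg.
have N0 : 0 <= N by apply: le_trans (HN 0 _); rewrite ?normc_ge0// lexx d0.
(* Nothing is known about g outside [[0, d]]; where P does not vanish the argument x - a lies in
   that interval, so g may be replaced by its cut-off. *)
pose h x := (\1_(`[0, d]%classic) x : R)%:C * g x.
have := @cintegrable_bounded _ P (fun x => h (x - a)) N.
have -> : (fun x => P x * g (x - a)) = (fun x => h (x - a) * P x).
  apply/funext => x; have [xad|/sP ->] := pselect (a < x < d); last by rewrite mulr0 mul0r.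
  rewrite mulrC; congr (_ * _); rewrite /h indic_in ?mul1r//= in_itv/=.
  by move: xad => /andP[? ?]; apply/andP; split; lra.
apply => //.
  apply: (cmeasurable_comp (phi := fun x => x - a)); last exact: abs_continuous_cmeasurable.
  by apply: measurable_funB => //; exact: measurable_cst.
move=> x; rewrite /h normcM normc_real indicE; case: (boolP (x - a \in _)) => [|_].
  by rewrite inE/= in_itv/= normr1 mul1r => /HN.
by rewrite normr0 mul0r.
Qed.

(** One line of the diagonalised system: w+ is [f] with w = i l and c = - i, while w- satisfies the
    same equation with both signs reversed, M for P, and f and g exchanged. *)
Definition delay_equation a d w c P f g :=
  {ae mu, forall x : R, x \in `]0, d[ ->
    is_cderive x f (w * f x + c * (P x * g (x - a)))}.

Lemma delay_variation a d w c P f g : 0 <= a -> a <= d -> cintegrable P ->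
  supported a d P -> abs_continuous 0 d f -> abs_continuous 0 d g ->
  delay_equation a d w c P f g -> forall x, 0 <= x <= d ->
  f x = cexp (w * x%:C) * f 0 +
    cint (fun t => (\1_(`]0, x]%classic) t : R)%:C *
                   (cexp (w * (x - t)%:C) * (c * (P t * g (t - a))))).
Proof.
move=> a0 ad Pi sP acf acg df x x0d; apply: (@variation_of_constants _ w d f) => //.
- exact: le_trans ad.
- by apply: cintegrableZ; exact: (cintegrable_delayed a0 ad).
Qed.

Lemma delay_solution_initial a d w c P f g : 0 <= a -> a <= d -> cintegrable P ->
  supported a d P -> abs_continuous 0 d f -> abs_continuous 0 d g ->
  delay_equation a d w c P f g -> forall x, 0 <= x <= a ->
  f x = cexp (w * x%:C) * f 0.
Proof.
move=> a0 ad Pi sP acf acg df x /andP[x0 xa].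
rewrite (delay_variation a0 ad Pi sP acf acg df); last by rewrite x0 (le_trans xa).
rewrite -[RHS]addr0 -(@cint0 R); congr (_ + _); congr cint; apply/funext => t.
rewrite indicE; case: (boolP (t \in _)) => [|_]; last by rewrite mul0r.
rewrite inE/= in_itv/= => /andP[t0 tx]; rewrite sP ?mul0r ?mulr0//.
by move=> /andP[?]; lra.
Qed.

(** For x <= 2a the delayed argument t - a stays below a, where g is a pure exponential. The phases
    w (x - t) and - w (t - a) then add up to w (x + a - 2 t). *)
Lemma delay_solution_second a d w c P f g : 0 <= a -> a <= d -> cintegrable P ->
  supported a d P -> abs_continuous 0 d f -> abs_continuous 0 d g ->
  delay_equation a d w c P f g ->
  (forall x, 0 <= x <= a -> g x = cexp (- w * x%:C) * g 0) ->
  forall x, 0 <= x <= 2 * a -> x <= d ->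
  f x = cexp (w * x%:C) * f 0 + c * g 0 *
    cint (fun t => (\1_(`]0, x]%classic) t : R)%:C * (cexp (w * (x + a - 2 * t)%:C) * P t)).
Proof.
move=> a0 ad Pi sP acf acg df g0 x /andP[x0 xa] xd.
rewrite (delay_variation a0 ad Pi sP acf acg df); last by rewrite x0.
congr (_ + _); rewrite -cintZ; last first.
  under eq_fun do rewrite mulrA.
  apply: (@cintegrable_bounded _ _ _ (expR (nc w * (x + a)))) => //.
    apply: cmeasurableM; first by exact: cmeasurable_indic.
    apply: cmeasurable_cexp; apply: cmeasurableM; first exact: cmeasurable_cst.
    apply: cmeasurable_real; apply: measurable_funB; first exact: measurable_cst.
    by apply: measurable_funM => //; exact: measurable_cst.
  move=> t; rewrite normcM normc_real indicE; case: (boolP (t \in _)) => [|_].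
    rewrite inE/= in_itv/= normr1 mul1r => /andP[t0 tx].
    rewrite normc_cexp ler_expR cReM/= mulr0 subr0 (le_trans (ler_norm _))// normrM.
    apply: ler_pM => //; first exact: Re_le_normc.
    by rewrite ler_norml; apply/andP; split; lra.
  by rewrite normr0 mul0r expR_ge0.
congr cint; apply/funext => t.
rewrite indicE; case: (boolP (t \in _)) => [|_]; last by rewrite !mul0r mulr0.
rewrite inE/= in_itv/= => /andP[t0 tx].
have [tad|/sP ->] := pselect (a < t < d); last by rewrite !(mul0r, mulr0).
rewrite g0; last by apply/andP; split; move/andP : tad => [? ?]; lra.
rewrite !mul1r -[(x + a - 2 * t)%R](_ : (x - t) - (t - a) = _); last by ring.
rewrite [((x - t) - (t - a))%:C]rmorphB/= mulrBr cexpD -[- (w * _)]mulNr; ring.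
Qed.

(** The phase of a path that evolves with - w from a to v and with w from v to d: the exponential of
    the term with one delay. *)
Definition delay_exp a d w v : R[i] := cexp (w * (d + a - 2 * v)%:C).

Lemma cmeasurable_cexp_affine w (x y : R) : cmeasurable (fun t => cexp (w * (x + y * t)%:C)).
Proof.
apply: cmeasurable_cexp; apply: cmeasurableM; first exact: cmeasurable_cst.
apply: cmeasurable_real; apply: measurable_funD; first exact: measurable_cst.
by apply: measurable_funM => //; exact: measurable_cst.
Qed.

Lemma cmeasurable_cexp_affineB w (x y : R) : cmeasurable (fun t => cexp (w * (x - y * t)%:C)).
Proof.
apply: cmeasurable_cexp; apply: cmeasurableM; first exact: cmeasurable_cst.
apply: cmeasurable_real; apply: measurable_funB; first exact: measurable_cst.
by apply: measurable_funM => //; exact: measurable_cst.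
Qed.

Lemma cmeasurable_delay_exp a d w : cmeasurable (delay_exp a d w).
Proof. exact: cmeasurable_cexp_affineB. Qed.

Lemma cexp_real_bound w (x b : R) : `|x| <= b -> nc (cexp (w * x%:C)) <= expR (nc w * b).
Proof.
move=> xb; rewrite normc_cexp ler_expR cReM/= mulr0 subr0.
rewrite (le_trans (ler_norm _))// normrM.
by apply: ler_pM => //; exact: Re_le_normc.
Qed.

Lemma delay_exp_bound a d w v : 0 <= a -> 0 <= v <= d ->
  nc (delay_exp a d w v) <= expR (nc w * (d + a)).
Proof.
move=> a0 /andP[v0 vd]; apply: cexp_real_bound.
by rewrite ler_norml; apply/andP; split; lra.
Qed.

Lemma cintegrable_indic_bounded (A : set R) g f b : measurable A -> cmeasurable g ->
  cintegrable f -> 0 <= b -> (forall x, A x -> nc (g x) <= b) ->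
  cintegrable (fun x => (\1_A x : R)%:C * (g x * f x)).
Proof.
move=> mA mg fi b0 gb; under eq_fun do rewrite mulrA.
apply: (cintegrable_bounded (b := b) _ fi).
  by apply: cmeasurableM => //; exact: cmeasurable_indic.
move=> x; rewrite normcM normc_real indicE; case: (boolP (x \in A)) => [|_].
  by rewrite inE normr1 mul1r => /gb.
by rewrite normr0 mul0r.
Qed.

Lemma cintegrable_delay_exp a d w P : 0 <= a -> cintegrable P -> supported a d P ->
  cintegrable (fun v => delay_exp a d w v * P v).
Proof.
move=> a0 Pi sP.
have -> : (fun v => delay_exp a d w v * P v) =
    (fun v => (\1_(`[0, d]%classic) v : R)%:C * (delay_exp a d w v * P v)).
  apply/funext => v; have [/andP[h1 h2]|/sP ->] := pselect (a < v < d); last by rewrite !mulr0.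
  rewrite indic_in; first by rewrite mul1r.
  by rewrite /= in_itv/=; apply/andP; split; lra.
apply: (cintegrable_indic_bounded (b := expR (nc w * (d + a)))) => //.
  exact: cmeasurable_delay_exp.
by move=> v /=; rewrite in_itv/=; exact: delay_exp_bound.
Qed.

(** The term with two delays, at times s <= t - a and t, has the phase d - 2 t + 2 s. The
    substitution v = a/2 + t - s gives it the form d + a - 2 v of [delay_exp], turns M(s) into M(a/2
    + t - v), and turns the constraint s <= t - a into v >= 3a/2. *)
Definition delay_kernel a d P M v : R[i] :=
  (\1_(`[3 / 2 * a, d]%classic) v : R)%:C * cint (fun t => P t * M (a / 2 + t - v)).

Lemma delay_kernel_measurable a d P M : cL2 P -> cL2 M -> cintegrable P ->
  cintegrable M -> cmeasurable (delay_kernel a d P M).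
Proof.
move=> PL ML Pi Mi.
by have [_ _] := cint_swap_convolution (a / 2) PL ML Pi Mi
  (cmeasurable_indic (measurable_itv `[3 / 2 * a, d])) (normc_indic_le1 _).
Qed.

(** The upper end comes from t < d together with a < a/2 + t - v. Half a delay is lost at either end
    of []a, d[], and this is what makes the inversion in [delay_kernel_data] possible. *)
Lemma delay_kernel_supported a d P M : 0 < a -> supported a d P -> supported a d M ->
  forall v, ~ (3 / 2 * a <= v < d - a / 2) -> delay_kernel a d P M v = 0.
Proof.
move=> a0 sP sM v nv; rewrite /delay_kernel indicE.
have [|_] := boolP (v \in _); last by rewrite mul0r.
rewrite inE/= in_itv/= => /andP[v1 v2].
rewrite (_ : (fun t => P t * M (a / 2 + t - v)) = fun=> 0) ?cint0 ?mulr0//.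
apply/funext => t; have [/andP[t1 t2]|/sP ->] := pselect (a < t < d); last by rewrite mul0r.
rewrite sM ?mulr0// => /andP[h1 h2]; apply: nv; rewrite v1/=; lra.
Qed.

Lemma delay_kernel_bound a d P M v : cL2 P -> cL2 M ->
  nc (delay_kernel a d P M v) ^+ 2 <= sqnorm P * sqnorm M.
Proof.
move=> PL ML; rewrite normcM exprMn -[leRHS]mul1r.
apply: ler_pM; rewrite ?sqr_ge0//.
  by rewrite expr_le1 ?normc_ge0// normc_indic_le1.
have E t : a / 2 + t - v = t - (v - a / 2) by ring.
rewrite -(sqnorm_translate (v - a / 2) ML).
under [in leLHS]eq_fun do rewrite E.
exact: (cauchy_schwarz PL (cL2_translate _ ML)).
Qed.

Lemma delay_kernel_cL2 a d P M : 0 < a -> cL2 P -> cL2 M -> cintegrable P ->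
  cintegrable M -> cL2 (delay_kernel a d P M).
Proof.
move=> a0 PL ML Pi Mi.
(* From x ^ 2 <= y follows x <= 1 + y, which bounds the kernel without a square root. *)
apply: (@cL2_bounded _ _ (1 + sqnorm P * sqnorm M) `[3 / 2 * a, d]) => //.
- by rewrite lebesgue_measure_itv/=; case: ifP => // _; rewrite -EFinB ltey.
- exact: delay_kernel_measurable.
- move=> v _; have := delay_kernel_bound a d v PL ML.
  have := normc_ge0 (delay_kernel a d P M v); set x := nc _; nra.
- move=> v nv; rewrite /delay_kernel indicE memNset ?mul0r//.
Qed.

Lemma delay_kernel_supportedW a d P M : 0 < a -> supported a d P -> supported a d M ->
  supported a d (delay_kernel a d P M).
Proof.
move=> a0 sP sM v nv; apply: delay_kernel_supported => // /andP[h1 h2].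
by apply: nv; apply/andP; split; lra.
Qed.

Lemma cintegrable_supported a d P : cL2 P -> supported a d P -> cintegrable P.
Proof.
move=> PL sP; apply: (@cintegrable_cL2 _ _ `]a, d[) => //.
by rewrite lebesgue_measure_itv/=; case: ifP => // _; rewrite -EFinB ltey.
Qed.

Lemma delay_kernel_cintegrable a d P M : 0 < a -> cL2 P -> cL2 M -> cintegrable P ->
  cintegrable M -> supported a d P -> supported a d M ->
  cintegrable (delay_kernel a d P M).
Proof.
move=> a0 PL ML Pi Mi sP sM; apply: (@cintegrable_supported a d).
  exact: delay_kernel_cL2.
exact: delay_kernel_supportedW.
Qed.

Lemma delay_kernel_inner a d w M t : 0 <= a -> a < t < d -> cintegrable M -> supported a d M ->
  cint (fun s => (\1_(`]0, t - a]%classic) s : R)%:C * (cexp (w * (d - 2 * t + 2 * s)%:C) * M s)) =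
  cint (fun v => (\1_(`[3 / 2 * a, d]%classic) v : R)%:C * delay_exp a d w v * M (a / 2 + t - v)).
Proof.
move=> a0 /andP[at_ td] Mi sM.
rewrite -(cint_reflect (a / 2 + t)); last first.
  apply: cmeasurableM; first exact: cmeasurable_indic.
  apply: cmeasurableM; last exact: cintegrable_measurable.
  exact: cmeasurable_cexp_affine.
congr cint; apply/funext => v.
have [/andP[s1 s2]|/sM ->] := pselect (a < a / 2 + t - v < d); last by rewrite !mulr0.
rewrite mulrA; congr (_ * _); congr (_ * _).
  congr (_%:C); rewrite !indicE; congr (_%:R); congr nat_of_bool.
  apply/idP/idP; rewrite !inE/= !in_itv/= => /andP[h1 h2]; apply/andP; split; lra.
by rewrite /delay_exp; congr (cexp (_ * _%:C)); lra.
Qed.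

(** As d <= 3a, the delayed argument t - a is below 2a, where [delay_solution_second] makes g
    explicit. The initial values - c and c together with c^2 = -1 leave the linear term with
    coefficient -1 and the quadratic one with coefficient - c. *)
Lemma delay_variation_end a d w c P f g : 0 < a -> a <= d -> d <= 3 * a -> c * c = -1 ->
  cintegrable P -> supported a d P -> forall M,
  cintegrable M -> supported a d M ->
  abs_continuous 0 d f -> abs_continuous 0 d g ->
  delay_equation a d w c P f g -> delay_equation a d (- w) (- c) M g f ->
  f 0 = - c -> g 0 = c -> forall t, a < t < d ->
  cexp (w * (d - t)%:C) * (c * (P t * g (t - a))) =
  - (delay_exp a d w t * P t) - c * (P t *
    cint (fun v => (\1_(`[3 / 2 * a, d]%classic) v : R)%:C * delay_exp a d w v * M (a / 2 + t - v))).
Proof.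
move=> a0 ad da cc Pi sP M Mi sM acf acg df dg f0 g0 t tad.
have a0' := ltW a0; have [t1 t2] := andP tad.
have fini := delay_solution_initial a0' ad Pi sP acf acg df.
have gt : g (t - a) = c * cexp (- w * (t - a)%:C) - cint (fun s =>
    (\1_(`]0, t - a]%classic) s : R)%:C * (cexp (- w * (t - a + a - 2 * s)%:C) * M s)).
  rewrite (delay_solution_second a0' ad Mi sM acg acf dg).
  - by rewrite f0 g0 mulrNN cc mulN1r mulrC.
  - by move=> y ya; rewrite opprK fini.
  - by apply/andP; split; lra.
  - lra.
have expand (e1 e2 p I : R[i]) : e1 * (c * (p * (c * e2 - I))) =
    c * c * (p * (e1 * e2)) - c * (p * (e1 * I)) by ring.
rewrite gt expand -(delay_kernel_inner w a0' tad Mi sM); congr (_ - _).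
  rewrite cc -cexpD mulN1r mulrC; congr (- (cexp _ * _)).
  rewrite mulNr -mulrBr; congr (_ * _); rewrite -rmorphB/=; congr (_%:C); lra.
congr (_ * (_ * _)); rewrite -cintZ; last first.
  apply: (cintegrable_indic_bounded (b := expR (nc (- w) * d))) => //.
    exact: cmeasurable_cexp_affineB.
  move=> s; rewrite /= in_itv/= => /andP[s0 st]; apply: cexp_real_bound.
  by rewrite ler_norml; apply/andP; split; lra.
congr cint; apply/funext => s; rewrite mulrCA; congr (_ * _).
rewrite mulrA -cexpD; congr (cexp _ * _).
by rewrite mulNr -mulrBr; congr (_ * _); rewrite -rmorphB/=; congr (_%:C); lra.
Qed.

(** Variation of constants at the right end with the integrand of [delay_variation_end]; exchanging
    the integrals in the quadratic term collects everything under the single exponential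
    [delay_exp]. *)
Lemma delay_representation a d w c P M f g : 0 < a -> a <= d -> d <= 3 * a ->
  c * c = -1 -> cL2 P -> cL2 M -> cintegrable P -> cintegrable M ->
  supported a d P -> supported a d M ->
  abs_continuous 0 d f -> abs_continuous 0 d g ->
  delay_equation a d w c P f g -> delay_equation a d (- w) (- c) M g f ->
  f 0 = - c -> g 0 = c ->
  f d = - c * cexp (w * d%:C) -
    cint (fun v => delay_exp a d w v * (P v + c * delay_kernel a d P M v)).
Proof.
move=> a0 ad da cc PL ML Pi Mi sP sM acf acg df dg f0 g0.
have a0' := ltW a0; have d0 : 0 <= d by apply: le_trans ad.
have T t : (\1_(`]0, d]%classic) t : R)%:C * (cexp (w * (d - t)%:C) * (c * (P t * g (t - a)))) =
  - (delay_exp a d w t * P t) - c * (P t *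
    cint (fun v => (\1_(`[3 / 2 * a, d]%classic) v : R)%:C * delay_exp a d w v * M (a / 2 + t - v))).
  have [tad|/sP ->] := pselect (a < t < d); last by rewrite !(mul0r, mulr0) subr0 oppr0.
  have [t1 t2] := andP tad; rewrite indic_in.
    rewrite mul1r; have H := (delay_variation_end a0 ad da cc Pi sP Mi sM acf acg df dg f0 g0 tad). exact: H.
  by rewrite /= in_itv/= (ltW t2) (lt_trans a0 t1).
have := delay_variation a0' ad Pi sP acf acg df; move=> /(_ d); rewrite d0 lexx => /(_ isT) ->.
rewrite f0 mulrC (funext T) => {T}.
have mk : cmeasurable (fun v => (\1_(`[3 / 2 * a, d]%classic) v : R)%:C * delay_exp a d w v).
  by apply: cmeasurableM; [exact: cmeasurable_indic|exact: cmeasurable_delay_exp].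
have kb v : nc ((\1_(`[3 / 2 * a, d]%classic) v : R)%:C * delay_exp a d w v) <= expR (nc w * (d + a)).
  rewrite normcM normc_real indicE; case: (boolP (v \in _)) => [|_].
    rewrite inE/= in_itv/= normr1 mul1r => /andP[v0 vd]; apply: delay_exp_bound => //.
    by rewrite vd andbT (le_trans _ v0)// mulr_ge0.
  by rewrite normr0 mul0r expR_ge0.
have Pe := cintegrable_delay_exp w a0' Pi sP.
have Ki := delay_kernel_cintegrable a0 PL ML Pi Mi sP sM.
have Ke := cintegrable_delay_exp w a0' Ki (delay_kernel_supportedW a0 sP sM).
have cKe := cintegrableZ c Ke.
have Ne := cintegrableN Pe.
have [swap PJ _] := cint_swap_convolution (a / 2) PL ML Pi Mi mk kb.
rewrite (cintB Ne (cintegrableZ c PJ)) (cintN Pe) (cintZ c PJ) swap {swap PJ}.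
have -> : (fun v => (\1_(`[3 / 2 * a, d]%classic) v : R)%:C * delay_exp a d w v *
   cint (fun t => P t * M (a / 2 + t - v))) = (fun v => delay_exp a d w v * delay_kernel a d P M v).
  by apply/funext => v; rewrite /delay_kernel mulrCA mulrA.
rewrite -(cintZ c Ke) -opprD -(cintD Pe cKe).
congr (_ - _); congr cint; apply/funext => v.
by rewrite mulrDr; congr (_ + _); rewrite mulrCA.
Qed.

End DelaySystem.

(** * Density of trigonometric polynomials *)

Section TrigonometricPolynomials.
Context {R : realType}.
Implicit Types (f g : R -> R[i]) (x y b : R) (c : R[i]) (p q : {poly R[i]}).

Definition unit_exp x : R[i] := cexp (2 * x)*i.

Lemma unit_expN x : unit_exp (- x) * unit_exp x = 1.
Proof.
rewrite /unit_exp -cexpD (_ : _ + _ = 0) ?cexp0//.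
by apply: complex_ext; rewrite ?cReD ?cImD/= ?addr0//; ring.
Qed.

Lemma normc_unit_exp x : nc (unit_exp x) = 1.
Proof. by rewrite normc_cexp/= expR0. Qed.

(** A Laurent polynomial in e^(2ix), written as an ordinary polynomial times a negative power, so
    that products and sums reduce to those of [{poly R[i]}]. *)
Definition trigonometric f := exists N p, forall x,
  f x = unit_exp (- x) ^+ N * p.[unit_exp x].

Lemma trigonometric_cst c : trigonometric (fun=> c).
Proof. by exists 0%N, c%:P => x; rewrite expr0 mul1r hornerC. Qed.

Lemma trigonometricM f g : trigonometric f -> trigonometric g ->
  trigonometric (fun x => f x * g x).
Proof.
move=> [N [p fp]] [M [q gq]]; exists (N + M)%N, (p * q) => x.
by rewrite fp gq hornerM exprD mulrACA.
Qed.

Lemma trigonometricD f g : trigonometric f -> trigonometric g ->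
  trigonometric (fun x => f x + g x).
Proof.
move=> [N [p fp]] [M [q gq]]; exists (N + M)%N, (p * 'X^M + q * 'X^N) => x.
have E n : unit_exp (- x) ^+ n * unit_exp x ^+ n = 1.
  by rewrite -exprMn unit_expN expr1n.
have K1 (u v w z : R[i]) : u * w * (v * z) = u * v * (w * z) by ring.
have K2 (u v w z : R[i]) : u * w * (v * z) = v * u * (w * z) by ring.
rewrite fp gq hornerD !hornerM !hornerXn mulrDr exprD; congr (_ + _).
  by rewrite -[LHS]mulr1 -(E M) K1.
by rewrite -[LHS]mulr1 -(E N) K2.
Qed.

Lemma trigonometricX f n : trigonometric f -> trigonometric (fun x => f x ^+ n).
Proof.
move=> tf; elim: n => [|n IH].
  by under eq_fun do rewrite expr0; exact: trigonometric_cst.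
by under eq_fun do rewrite exprS; exact: trigonometricM.
Qed.

Lemma trigonometricN f : trigonometric f -> trigonometric (fun x => - f x).
Proof.
move=> tf; under eq_fun do rewrite -mulN1r.
by apply: trigonometricM => //; exact: trigonometric_cst.
Qed.

Lemma cos_unit_exp x y :
  (cos (2 * x - y))%:C = (unit_exp x * cexp (- y)*i + unit_exp (- x) * cexp y*i) / 2.
Proof.
rewrite /unit_exp -!cexpD.
have -> : (2 * x)*i + (- y)*i = (2 * x - y)*i by apply: complex_ext; rewrite ?cReD ?cImD/=; ring.
have -> : (2 * - x)*i + y*i = (- (2 * x - y))*i by apply: complex_ext; rewrite ?cReD ?cImD/=; ring.
have -> : cexp (2 * x - y)*i + cexp (- (2 * x - y))*i = 2 * (cos (2 * x - y))%:C.
  rewrite mulr_natl mulr2n; apply: complex_ext; rewrite ?cReD ?cImD/= !expR0 !mul1r ?cosN ?sinN; ring.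
by rewrite mulrAC divff ?mul1r// pnatr_eq0.
Qed.

Lemma trigonometric_cos y : trigonometric (fun x => (cos (2 * x - y))%:C).
Proof.
have E x : (cos (2 * x - y))%:C = unit_exp x * (cexp (- y)*i / 2) + unit_exp (- x) * (cexp y*i / 2).
  by rewrite cos_unit_exp mulrDl !mulrA.
under eq_fun do rewrite E; apply: trigonometricD; apply: trigonometricM; try exact: trigonometric_cst.
  by exists 0%N, 'X => x; rewrite expr0 mul1r hornerX.
by exists 1%N, 1 => x; rewrite expr1 hornerC mulr1.
Qed.

Lemma cmeasurable_unit_exp b : cmeasurable (fun x => unit_exp (b * x)).
Proof.
apply: cmeasurable_cexp; split => /=; first exact: measurable_cst.
by do 2 (apply: measurable_funM; first exact: measurable_cst).
Qed.

Lemma cmeasurableX f n : cmeasurable f -> cmeasurable (fun x => f x ^+ n).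
Proof.
move=> mf; elim: n => [|n IH].
  by under eq_fun do rewrite expr0; exact: cmeasurable_cst.
by under eq_fun do rewrite exprS; exact: cmeasurableM.
Qed.

Lemma trigonometric_sum N p x : unit_exp (- x) ^+ N * p.[unit_exp x] =
  \sum_(k < size p) p`_k * (unit_exp (- x) ^+ N * unit_exp x ^+ k).
Proof. by rewrite horner_coef mulr_sumr; apply: eq_bigr => k _; rewrite mulrCA. Qed.

Lemma cmeasurable_sum (I : Type) (s : seq I) (F : I -> R -> R[i]) :
  (forall i, cmeasurable (F i)) -> cmeasurable (fun x => \sum_(i <- s) F i x).
Proof.
move=> mF; elim: s => [|i s IH].
  by under eq_fun do rewrite big_nil; exact: cmeasurable_cst.
by under eq_fun do rewrite big_cons; exact: cmeasurableD.
Qed.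

Lemma cmeasurable_monomial N k :
  cmeasurable (fun x => unit_exp (- x) ^+ N * unit_exp x ^+ k).
Proof.
apply: cmeasurableM; apply: cmeasurableX.
  by have := cmeasurable_unit_exp (- 1); under eq_fun do rewrite mulN1r.
by have := cmeasurable_unit_exp 1; under eq_fun do rewrite mul1r.
Qed.

Lemma normc_monomial N k x : nc (unit_exp (- x) ^+ N * unit_exp x ^+ k) = 1.
Proof. by rewrite normcM !normcX !normc_unit_exp !expr1n mulr1. Qed.

Lemma trigonometric_measurable f : trigonometric f -> cmeasurable f.
Proof.
move=> [N [p fp]]; rewrite (funext fp); under eq_fun do rewrite trigonometric_sum.
apply: cmeasurable_sum => k; apply: cmeasurableM; first exact: cmeasurable_cst.
exact: cmeasurable_monomial.
Qed.

Lemma trigonometric_bounded f : trigonometric f -> exists b, forall x, nc (f x) <= b.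
Proof.
move=> [N [p fp]]; exists (\sum_(k < size p) nc p`_k) => x.
rewrite fp trigonometric_sum (le_trans (normc_sum _ _ _))//.
by apply: ler_sum => k _; rewrite normcM normc_monomial mulr1.
Qed.

Definition period : set R := `]0, pi]%classic.

Lemma measurable_period : measurable period.
Proof. exact: measurable_itv. Qed.

Definition cut f x : R[i] := (\1_period x : R)%:C * f x.

Lemma mu_period : mu period = pi%:E.
Proof. by rewrite /period lebesgue_measure_itv/= lte_fin pi_gt0 -EFinB subr0. Qed.

Lemma cmeasurable_cut f : cmeasurable f -> cmeasurable (cut f).
Proof.
move=> mf; apply: cmeasurableM => //.
exact: (cmeasurable_indic measurable_period).
Qed.

Lemma cut_in f x : period x -> cut f x = f x.
Proof. by move=> px; rewrite /cut indic_in// mul1r. Qed.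

Lemma cut_out f x : ~ period x -> cut f x = 0.
Proof. by move=> px; rewrite /cut indicE memNset// mul0r. Qed.

Lemma cL2_cut_bounded f b : cmeasurable f -> (forall x, nc (f x) <= b) -> cL2 (cut f).
Proof.
move=> mf fb; apply: (@cL2_bounded _ _ b period).
- exact: measurable_period.
- by rewrite mu_period ltey.
- exact: cmeasurable_cut.
- by move=> x px; rewrite cut_in.
- by move=> x px; rewrite cut_out.
Qed.

Lemma cL2_cut_trigonometric f : trigonometric f -> cL2 (cut f).
Proof.
move=> tf; have [b fb] := trigonometric_bounded tf.
by apply: (cL2_cut_bounded _ fb); exact: trigonometric_measurable.
Qed.

Definition trig_approx f := cL2 f /\ forall e : R, 0 < e ->
  exists2 T, trigonometric T & sqnorm (fun x => f x - cut T x) <= e.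

Lemma trig_approx_trigonometric T : trigonometric T -> trig_approx (cut T).
Proof.
move=> tT; split; first exact: cL2_cut_trigonometric.
move=> e e0; exists T => //; rewrite /sqnorm (@eq_Rintegral _ _ _ _ _ (fun=> 0)).
  by rewrite Rintegral_cst//= mul0r ltW.
by move=> x _; rewrite subrr ComplexField.Normc.normc0 expr0n.
Qed.

Lemma trig_approx_limit f : cL2 f -> (forall e : R, 0 < e ->
  exists2 g, trig_approx g & sqnorm (fun x => f x - g x) <= e) -> trig_approx f.
Proof.
move=> fL H; split => // e e0; have e4 : 0 < e / 4 by rewrite divr_gt0.
have [g [gL Hg] fg] := H _ e4; have [T tT gT] := Hg _ e4; exists T => //.
have := sqnormD (cL2B fL gL) (cL2B gL (cL2_cut_trigonometric tT)).
have -> : (fun x => f x - g x + (g x - cut T x)) = (fun x => f x - cut T x).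
  by apply/funext => x; rewrite addrA subrK.
by move=> /le_trans; apply; lra.
Qed.

Lemma cut_D f g : cut (fun x => f x + g x) = (fun x => cut f x + cut g x).
Proof. by apply/funext => x; rewrite /cut mulrDr. Qed.

Lemma trig_approxD f g : trig_approx f -> trig_approx g ->
  trig_approx (fun x => f x + g x).
Proof.
move=> [fL Hf] [gL Hg]; split; first exact: cL2D.
move=> e e0; have e4 : 0 < e / 4 by rewrite divr_gt0.
have [S tS fS] := Hf _ e4; have [T tT gT] := Hg _ e4.
exists (fun x => S x + T x); first exact: trigonometricD.
have := sqnormD (cL2B fL (cL2_cut_trigonometric tS)) (cL2B gL (cL2_cut_trigonometric tT)).
have -> : (fun x => f x - cut S x + (g x - cut T x)) =
    (fun x => f x + g x - cut (fun x => S x + T x) x).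
  by apply/funext => x; rewrite cut_D opprD addrACA.
by move=> /le_trans; apply; lra.
Qed.

Lemma trig_approxZ c f : trig_approx f -> trig_approx (fun x => c * f x).
Proof.
move=> [fL Hf]; split; first exact: cL2Z.
move=> e e0; have ce : 0 < e / (nc c ^+ 2 + 1) by rewrite divr_gt0// ltr_wpDl ?sqr_ge0.
have [T tT fT] := Hf _ ce; exists (fun x => c * T x).
  by apply: trigonometricM => //; exact: trigonometric_cst.
have -> : (fun x => c * f x - cut (fun x => c * T x) x) = (fun x => c * (f x - cut T x)).
  by apply/funext => x; rewrite mulrBr /cut mulrCA.
rewrite sqnormZ; last exact: cL2B fL (cL2_cut_trigonometric tT).
have c0 := sqr_ge0 (nc c); apply: (le_trans (ler_wpM2l c0 fT)).
rewrite mulrA ler_pdivrMr; last by lra.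
by nra.
Qed.

Lemma trig_approxB f g : trig_approx f -> trig_approx g ->
  trig_approx (fun x => f x - g x).
Proof.
move=> fA gA; have := trig_approxD fA (trig_approxZ (-1) gA).
by under eq_fun do rewrite mulN1r.
Qed.

Lemma trig_approx0 : trig_approx (fun=> 0).
Proof.
have := trig_approx_trigonometric (trigonometric_cst 0); congr trig_approx.
by apply/funext => x; rewrite /cut mulr0.
Qed.

Lemma trig_approx_sum (I : Type) (s : seq I) (F : I -> R -> R[i]) :
  (forall i, trig_approx (F i)) -> trig_approx (fun x => \sum_(i <- s) F i x).
Proof.
move=> AF; elim: s => [|i s IH].
  by under eq_fun do rewrite big_nil; exact: trig_approx0.
by under eq_fun do rewrite big_cons; exact: trig_approxD.
Qed.

Lemma sqnorm_dominated (F : nat -> R -> R[i]) f (G : R -> R) : (forall n, cL2 (F n)) -> cL2 f ->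
  mu.-integrable [set: R] (fun x => (G x)%:E) ->
  (forall n x, nc (f x - F n x) ^+ 2 <= G x) ->
  {ae mu, forall x : R, (fun n => nc (f x - F n x)) @ \oo --> (0 : R)} ->
  forall e : R, 0 < e -> exists n, sqnorm (fun x => f x - F n x) <= e.
Proof.
move=> FL fL Gi FG cvF e e0.
pose h n x := (nc (f x - F n x) ^+ 2)%:E.
have [|||||_ _] := @dominated_convergence _ _ _ mu setT measurableT h (cst 0%E) (fun x => (G x)%:E).
- by move=> n; apply/measurable_EFinP; apply: measurable_normc_sqr;
    apply: cmeasurableB; [case: fL|case: (FL n)].
- exact: measurable_cst.
- apply: (@filterS _ _ (ae_filter_ringOfSetsType mu) _ _ _ cvF) => x cvx _.
  apply: cvg_EFin; first by near=> n.
  have : (fun n => nc (f x - F n x) * nc (f x - F n x)) @ \oo --> (0 * 0 : R).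
    by apply: cvgM.
  by rewrite mulr0.
- exact: Gi.
- apply: (@filterE _ _ (ae_filter_ringOfSetsType mu)) => x n _.
  by rewrite /h/= lee_fin ger0_norm ?sqr_ge0// FG.
rewrite integral_cst// mul0e => /fine_cvgP[_ /cvgrPdist_le/(_ _ e0)[n _ /(_ n (leqnn n))]].
rewrite sub0r normrN /= => Hn; exists n.
by apply: le_trans Hn; rewrite ler_norm.
Unshelve. all: by end_near. Qed.

End TrigonometricPolynomials.

(** * Approximation of indicator functions by trigonometric polynomials *)

Section TrigonometricDensity.
Context {R : realType}.
Implicit Types (f g : R -> R[i]) (x y b s : R) (A : set R).

Lemma real_complexD x y : (x + y)%:C = x%:C + y%:C :> R[i].
Proof. by apply: complex_ext; rewrite ?cReD ?cImD/= ?addr0. Qed.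

Lemma real_complexN x : (- x)%:C = - x%:C :> R[i].
Proof. by apply: complex_ext; rewrite ?cReN ?cImN/= ?oppr0. Qed.

Lemma real_complexB x y : (x - y)%:C = x%:C - y%:C :> R[i].
Proof. by rewrite real_complexD real_complexN. Qed.

Lemma real_complexM x y : (x * y)%:C = x%:C * y%:C :> R[i].
Proof. by apply: complex_ext; rewrite ?cReM ?cImM/= ?mulr0 ?mul0r ?subr0 ?addr0. Qed.

Lemma real_complex1 : (1 : R)%:C = 1 :> R[i].
Proof. by []. Qed.

Lemma real_complexX x n : (x ^+ n)%:C = x%:C ^+ n :> R[i].
Proof.
elim: n => [|n IH]; first by rewrite !expr0.
by rewrite !exprS real_complexM IH.
Qed.

Lemma real_complex_sum (I : Type) (s : seq I) (F : I -> R) :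
  (\sum_(i <- s) F i)%:C = \sum_(i <- s) (F i)%:C :> R[i].
Proof.
elim: s => [|i s IH]; first by rewrite !big_nil.
by rewrite !big_cons real_complexD IH.
Qed.

Lemma one_sub_expn_ge s n : 0 <= s <= 1 -> 1 - n%:R * s <= (1 - s) ^+ n.
Proof.
move=> /andP[s0 s1]; elim: n => [|n IH]; first by rewrite mul0r subr0 expr0.
rewrite exprS; have h : 0 <= 1 - s by rewrite subr_ge0.
apply: (le_trans _ (ler_wpM2l h IH)); rewrite -natr1.
have : 0 <= n%:R * s ^+ 2 by rewrite mulr_ge0 ?sqr_ge0. nra.
Qed.

(** The counterpart of Bernoulli's inequality. With s = x^n and 2^n as exponent, Bernoulli bounds (1
    - x^n)^(2^n) below by 1 - (2x)^n, useful for x < 1/2, and this one bounds it above by 1 / (1 +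
    (2x)^n), useful for x > 1/2. *)
Lemma one_sub_expn_le s n : 0 <= s <= 1 -> (1 - s) ^+ n * (1 + n%:R * s) <= 1.
Proof.
move=> /andP[s0 s1]; have h : 0 <= 1 - s by rewrite subr_ge0.
elim: n => [|n IH]; first by rewrite mul0r addr0 expr0 mulr1.
apply: le_trans IH; rewrite exprS -mulrA mulrCA ler_wpM2l ?exprn_ge0//.
rewrite -natr1; have : 0 <= n%:R * s ^+ 2 by rewrite mulr_ge0 ?sqr_ge0.
by have := sqr_ge0 s; nra.
Qed.

(* The polynomials (1 - x^n)^(2^n) converge to a step function on [0, 1] with jump at
   1/2; composed with affine functions of cos (2 x - b), they approximate indicators of
   intervals by trigonometric polynomials. *)
Lemma step_cvg1 x : 0 <= x < 1 / 2 ->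
  (fun n => (1 - x ^+ n) ^+ (2 ^ n)%N) @ \oo --> (1 : R).
Proof.
move=> /andP[x0 x2]; have c : `|2 * x| < 1 by rewrite ger0_norm ?mulr_ge0//; lra.
have := cvg_expr c => /cvgrPdist_le H; apply/cvgrPdist_le => e /H.
apply: filterS => n; rewrite sub0r normrN normrX ger0_norm ?mulr_ge0// => Hn.
have xn : 0 <= x ^+ n <= 1 by rewrite exprn_ge0// exprn_ile1//; lra.
have := one_sub_expn_ge (2 ^ n) xn; rewrite natrX -exprMn => h.
have h1 : (1 - x ^+ n) ^+ (2 ^ n) <= 1.
  by move/andP: xn => [? ?]; rewrite exprn_ile1//; lra.
by rewrite ger0_norm; lra.
Qed.

Lemma step_cvg0 x : 1 / 2 < x <= 1 ->
  (fun n => (1 - x ^+ n) ^+ (2 ^ n)%N) @ \oo --> (0 : R).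
Proof.
move=> /andP[x2 x1]; have x0 : 0 < 2 * x by lra.
have c : `|(2 * x)^-1| < 1.
  by rewrite ger0_norm ?invr_ge0 ?(ltW x0)// invf_lt1//; lra.
have := cvg_expr c => /cvgrPdist_le H; apply/cvgrPdist_le => e /H.
apply: filterS => n; rewrite sub0r normrN normrX ger0_norm ?invr_ge0 ?(ltW x0)// => Hn.
have xn : 0 <= x ^+ n <= 1 by rewrite exprn_ge0 ?exprn_ile1//; lra.
have := one_sub_expn_le (2 ^ n) xn; rewrite natrX -exprMn => h.
have q0 : 0 <= (1 - x ^+ n) ^+ (2 ^ n).
  by move/andP: xn => [? ?]; rewrite exprn_ge0//; lra.
rewrite sub0r normrN ger0_norm//; apply: le_trans Hn.
rewrite exprVn -div1r ler_pdivlMr ?exprn_gt0//; apply: le_trans h.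
by rewrite ler_wpM2l// lerDr.
Qed.

Lemma trig_approx_dominated (F : nat -> R -> R[i]) f (G : R -> R) :
  (forall n, trig_approx (F n)) -> cL2 f ->
  mu.-integrable [set: R] (fun x => (G x)%:E) ->
  (forall n x, nc (f x - F n x) ^+ 2 <= G x) ->
  {ae mu, forall x : R, (fun n => nc (f x - F n x)) @ \oo --> (0 : R)} ->
  trig_approx f.
Proof.
move=> FA fL Gi FG cvF; apply: trig_approx_limit => // e e0.
have [n Hn] := sqnorm_dominated (fun n => (FA n).1) fL Gi FG cvF e0.
by exists (F n).
Qed.

Definition cut_set A x : R[i] := (\1_(period `&` A) x : R)%:C.

Lemma cut_setE A x : cut_set A x = (\1_period x * \1_A x : R)%:C.
Proof. by rewrite /cut_set indicI. Qed.

Lemma cL2_cut_set A : measurable A -> cL2 (cut_set A).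
Proof.
move=> mA; apply: cL2_indic; first by apply: measurableI => //; exact: measurable_period.
apply: (@le_lt_trans _ _ (mu (@period R))); last by rewrite mu_period ltey.
apply: le_measure; rewrite ?inE//; last exact: measurable_period.
by apply: measurableI => //; exact: measurable_period.
Qed.

Lemma integrable_period : mu.-integrable [set: R] (fun x => (\1_(@period R) x)%:E).
Proof. by apply: integrable_indic_fin; [exact: measurable_period|rewrite mu_period ltey]. Qed.

Lemma trig_approx_setT : trig_approx (cut_set setT).
Proof.
have := trig_approx_trigonometric (@trigonometric_cst R 1); congr trig_approx.
by apply/funext => x; rewrite /cut/cut_set setIT mulr1.
Qed.

(** For 0 < b <= pi, t(x) = 1/2 - sin x sin(b - x) / 2 is affine in cos(2x - b). On []0, pi[] sin x
    is positive and sin(b - x) has the sign of b - x, so t is below 1/2 exactly left of b, and the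
    step polynomials of t converge to the indicator except possibly at b and pi. For other b the ray
    misses the period or contains it. *)
Lemma trig_approx_ray b : trig_approx (cut_set `]-oo, b[).
Proof.
have [b0|b0] := leP b 0.
  rewrite (_ : cut_set _ = fun=> 0); first exact: trig_approx0.
  apply/funext => x; rewrite /cut_set indicE memNset// => -[].
  by rewrite /period/= !in_itv/= => /andP[? ?]; lra.
have [bpi|bpi] := ltP pi b.
  rewrite (_ : cut_set _ = cut_set setT); first exact: trig_approx_setT.
  apply/funext => x; rewrite /cut_set; congr ((\1_ _ _)%:C).
  apply/seteqP; split => y; rewrite /period/= !in_itv/= => -[/andP[h1 h2] h3]; split => //.
    by rewrite h1.
    by rewrite h1.
  lra.
pose t x : R := 1 / 2 - (cos (2 * x - b) - cos b) / 4.
have t01 x : 0 <= t x <= 1.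
  have := cos_le1 (2 * x - b); have := cos_geN1 (2 * x - b).
  have := cos_le1 b; have := cos_geN1 b.
  by rewrite /t => *; apply/andP; split; lra.
have tE x : t x = 1 / 2 - sin x * sin (b - x) / 2.
  have E (u v : R) : 1 / 2 - sin u * sin v / 2 = 1 / 2 - (cos (u - v) - cos (u + v)) / 4.
    by rewrite cosB cosD; field.
  by rewrite E /t; congr (_ - (cos _ - cos _) / _); ring.
pose q n x : R := (1 - t x ^+ n) ^+ (2 ^ n).
have tq n : trigonometric (fun x => (q n x)%:C).
  have E x : (q n x)%:C = (1 - ((1 / 2 + cos b / 4)%:C - (1 / 4)%:C * (cos (2 * x - b))%:C) ^+ n) ^+ (2 ^ n).
    have tx : (t x)%:C = (1 / 2 + cos b / 4)%:C - (1 / 4)%:C * (cos (2 * x - b))%:C.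
      by rewrite -real_complexM -real_complexB /t; congr (_%:C); field.
    by rewrite -tx -[in RHS]real_complex1 -real_complexX -real_complexB -real_complexX.
  under eq_fun do rewrite E; apply: trigonometricX.
  apply: trigonometricD; first exact: trigonometric_cst.
  apply: trigonometricN; apply: trigonometricX.
  apply: trigonometricD; first exact: trigonometric_cst.
  apply: trigonometricN; apply: trigonometricM; first exact: trigonometric_cst.
  exact: trigonometric_cos.
have q01 n x : 0 <= q n x <= 1.
  have /andP[h1 h2] := t01 x.
  have h3 : 0 <= t x ^+ n <= 1 by rewrite exprn_ge0// exprn_ile1.
  by rewrite /q; move/andP: h3 => [? ?]; rewrite exprn_ge0 ?exprn_ile1//; lra.
have D n x : cut_set `]-oo, b[ x - cut (fun x => (q n x)%:C) x =
    ((\1_(@period R) x : R) * ((x < b)%R%:R - q n x))%:C.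
  rewrite cut_setE /cut -real_complexM -real_complexB; congr (_%:C).
  rewrite mulrBr; congr (_ * _ - _); rewrite indicE; congr (_%:R); congr nat_of_bool.
  by apply/idP/idP; rewrite inE/= in_itv.
apply: (@trig_approx_dominated (fun n => cut (fun x => (q n x)%:C)) _ (fun x => \1_(@period R) x : R)).
- by move=> n; exact: trig_approx_trigonometric.
- exact: cL2_cut_set.
- exact: integrable_period.
- move=> n x; rewrite D normc_real real_normK ?num_real// exprMn.
  have -> : (\1_(@period R) x : R) ^+ 2 = \1_(@period R) x.
    by rewrite indicE; case: (_ \in _); rewrite ?expr1n ?expr0n.
  rewrite ler_piMr//.
  by have /andP[h1 h2] := q01 n x; case: (x < b)%R => /=; nra.
exists ([set b] `|` [set pi]); split.
- by apply: measurableU.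
- apply/negligibleP; first exact: measurableU.
  by apply: negligibleU; apply/negligibleP => //; exact: lebesgue_measure_set1.
move=> x /= H; apply: contrapT => /not_orP[/eqP xb /eqP xpi]; apply: H.
under eq_fun do rewrite D normc_real.
have [px|px] := pselect (period x); last first.
  under eq_fun do rewrite indicE memNset// mul0r normr0.
  exact: cvg_cst.
under eq_fun do rewrite indicE mem_set// mul1r.
move: px; rewrite /period/= in_itv/= => /andP[x0 xpi'].
have xltpi : x < pi by rewrite lt_neqAle xpi.
have sx : 0 < sin x by apply: sin_gt0_pi; rewrite x0.
have nsub (u : nat -> R) (l : R) : u @ \oo --> l -> (fun n => `|l - u n|) @ \oo --> (0 : R).
  move=> ul; have : (fun n => `|l - u n|) @ \oo --> `|l - l|.
    by apply: cvg_norm; apply: cvgB => //; exact: cvg_cst.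
  by rewrite subrr normr0.
have [xltb|blex] := ltP x b.
  apply: nsub; apply: step_cvg1; have /andP[-> _] := t01 x; rewrite /= tE.
  have : 0 < sin (b - x) by apply: sin_gt0_pi; apply/andP; split; lra.
  by move=> h; have := mulr_gt0 sx h; lra.
apply: nsub; apply: step_cvg0; have /andP[_ ->] := t01 x; rewrite andbT tE.
have bx : b < x by rewrite lt_neqAle eq_sym xb.
have : 0 < sin (x - b) by apply: sin_gt0_pi; apply/andP; split; lra.
by move=> h; have := mulr_gt0 sx h; rewrite -(opprB x b) sinN; lra.
Qed.

(** Dynkin induction: the open left rays are stable under intersection and generate the Borel sets,
    and approximability passes to complements and, by dominated convergence, to countable disjoint
    unions. *)
Lemma trig_approx_set A : measurable A -> trig_approx (cut_set A).
Proof.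
move=> mA.
have mE : @measurable _ (measurableTypeR R) = <<s (@RGenInftyO.G R) >>.
  exact: RGenInftyO.measurableE.
apply: (@dynkin_induction _ (measurableTypeR R) (@RGenInftyO.G R) (fun A => trig_approx (cut_set A)) mE).
- move=> _ _ [x ->] [y ->]; exists (Num.min x y).
  apply/seteqP; split => z /=; rewrite !in_itv/= lt_min; last by move=> /andP[].
  by move=> [-> ->].
- exact: trig_approx_setT.
- by move=> _ [x ->]; exact: trig_approx_ray.
- move=> S mS AS; have := trig_approxB trig_approx_setT AS; congr trig_approx.
  apply/funext => x; rewrite !cut_setE -real_complexB -mulrBr; congr ((_ * _)%:C).
  by rewrite !indicE in_setT in_setC; case: (x \in S); rewrite ?subrr ?subr0.
- move=> F mF tF AF.
  pose S n x := \sum_(k < n) cut_set (F k) x.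
  have SE n x : S n x = ((\1_(@period R) x : R) * \sum_(k < n) (\1_(F k) x : R))%:C.
    rewrite mulr_sumr real_complex_sum; apply: eq_bigr => k _; exact: cut_setE.
  have S1 n x k : F k x -> \sum_(j < n) (\1_(F j) x : R) = (k < n)%:R :> R.
    move=> Fkx; have [kn|nk] := ltnP k n.
      rewrite (bigD1 (Ordinal kn))//= indicE mem_set// big1 ?addr0// => j jk.
      rewrite indicE memNset// => Fjx; move/trivIsetP : tF => /(_ j k I I).
      have -> : (j != k :> nat) by apply: contra jk => /eqP jk; apply/eqP/val_inj.
      by move=> /(_ isT)/seteqP[/(_ x) + _]; apply.
    rewrite big1// => j _; rewrite indicE memNset// => Fjx.
    move/trivIsetP : tF => /(_ j k I I).
    have -> : (j != k :> nat) by rewrite neq_ltn (leq_trans (ltn_ord j) nk).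
    by move=> /(_ isT)/seteqP[/(_ x) + _]; apply.
  have S0 n x : ~ (\bigcup_k F k) x -> \sum_(j < n) (\1_(F j) x : R) = 0 :> R.
    by move=> nF; rewrite big1// => j _; rewrite indicE memNset// => Fjx; apply: nF; exists j.
  have mU : measurable (\bigcup_k F k) by exact: bigcup_measurable.
  apply: (@trig_approx_dominated S _ (fun x => \1_(@period R) x : R)).
  + by move=> n; exact: trig_approx_sum.
  + exact: cL2_cut_set.
  + exact: integrable_period.
  + move=> n x; rewrite cut_setE SE -real_complexB -mulrBr normc_real real_normK ?num_real// exprMn.
    have -> : (\1_(@period R) x : R) ^+ 2 = \1_(@period R) x.
      by rewrite indicE; case: (_ \in _); rewrite ?expr1n ?expr0n.
    rewrite ler_piMr//; have [[k _ Fkx]|nU] := pselect ((\bigcup_k F k) x).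
      rewrite (S1 _ _ _ Fkx) indicE mem_set; last by exists k.
      by case: (k < n)%N; rewrite ?subrr ?subr0 ?expr0n ?expr1n.
    by rewrite S0// indicE memNset// subrr expr0n.
  + apply: (@filterE _ _ (ae_filter_ringOfSetsType mu)) => x.
    under eq_fun do rewrite cut_setE SE -real_complexB -mulrBr normc_real.
    have [[k _ Fkx]|nU] := pselect ((\bigcup_k F k) x).
      apply/cvgrPdist_le => e e0; exists k.+1 => // n /= kn.
      have I1 : \1_(\bigcup_k F k) x = 1 :> R by rewrite indicE mem_set//; exists k.
      rewrite (S1 _ _ _ Fkx) kn I1.
      by rewrite subrr mulr0 !normr0 subrr normr0 ltW.
    have I0 : \1_(\bigcup_k F k) x = 0 :> R by rewrite indicE memNset.
    under eq_fun do rewrite S0// subr0 I0 mulr0 normr0.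
    exact: cvg_cst.
- by rewrite -mE.
Qed.

End TrigonometricDensity.

(** * Density in L2 and the lower Parseval bound *)

Section TrigonometricCompleteness.
Context {R : realType}.
Implicit Types (f g W : R -> R[i]) (u : R -> R) (x y b s : R) (A : set R).
Import HBNNSimple.

Lemma trig_approx_sfun (h : {nnsfun (measurableTypeR R) >-> R}) :
  (forall x, ~ period x -> h x = 0) -> trig_approx (fun x => (h x)%:C).
Proof.
move=> h0.
have [s hs] : exists s : seq R, forall x, h x = \sum_(y <- s) y * \1_(h @^-1` [set y]) x.
  exists (finmap.enum_fset (fset_set (range h))) => x.
  by rewrite {1}fimfunE fsbig_finite.
have hE x : (h x)%:C = \sum_(y <- s) y%:C * cut_set (h @^-1` [set y]) x.
  have -> : h x = (\1_(@period R) x : R) * h x.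
    have [px|px] := pselect (period x); first by rewrite indicE mem_set ?mul1r.
    by rewrite h0// mulr0.
  rewrite {1}hs mulr_sumr real_complex_sum.
  by apply: eq_bigr => y _; rewrite cut_setE -real_complexM mulrCA.
under eq_fun do rewrite hE; apply: trig_approx_sum => y.
by apply: trig_approxZ; apply: trig_approx_set; exact: (measurable_funPTI h (measurable_set1 y)).
Qed.

Lemma trig_approx_nonneg u : measurable_fun [set: R] u -> (forall x, 0 <= u x) ->
  (forall x, ~ period x -> u x = 0) ->
  mu.-integrable [set: R] (fun x => (u x ^+ 2)%:E) ->
  trig_approx (fun x => (u x)%:C).
Proof.
move=> mfu u0 up ui.
have muE : measurable_fun [set: measurableTypeR R] (fun x => (u x)%:E) by apply/measurable_EFinP.
pose h n : {nnsfun (measurableTypeR R) >-> R} := nnsfun_approx measurableT muE n.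
have hu n x : h n x <= u x.
  by rewrite /h nnsfun_approxE -lee_fin; apply: le_approx => // y _; rewrite lee_fin.
have h0 n x : 0 <= h n x by [].
have cvh x : (fun n => h n x) @ \oo --> u x.
  have := @cvg_nnsfun_approx _ _ _ setT measurableT _ muE (fun y _ => u0 y) x I.
  by move=> /fine_cvg.
apply: (@trig_approx_dominated _ (fun n x => (h n x)%:C) _ (fun x => u x ^+ 2)) => //.
- move=> n; apply: trig_approx_sfun => x px; apply/eqP; rewrite eq_le h0 andbT.
  by rewrite (le_trans (hu _ _))// up.
- split; first exact: cmeasurable_real.
  move: ui; congr integrable; apply/funext => x.
  by rewrite normc_real real_normK ?num_real.
- move=> n x; rewrite -real_complexB normc_real real_normK ?num_real//.
  by rewrite ler_sqr ?nnegrE ?subr_ge0// lerBlDr lerDl.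
- apply: (@filterE _ _ (ae_filter_ringOfSetsType mu)) => x.
  under eq_fun do rewrite -real_complexB normc_real.
  rewrite -(normr0 R) -(subrr (u x)).
  by apply: cvg_norm; apply: cvgB => //; exact: cvg_cst.
Qed.

Lemma trig_approx_real u : measurable_fun [set: R] u ->
  (forall x, ~ period x -> u x = 0) ->
  mu.-integrable [set: R] (fun x => (u x ^+ 2)%:E) ->
  trig_approx (fun x => (u x)%:C).
Proof.
move=> mfu up ui.
have pos (v : R -> R) : measurable_fun [set: R] v -> (forall x, ~ period x -> v x = 0) ->
    mu.-integrable [set: R] (fun x => (v x ^+ 2)%:E) ->
    trig_approx (fun x => (Num.max (v x) 0)%:C).
  move=> mv vp vi; apply: trig_approx_nonneg.
  - by apply: measurable_maxr => //; exact: measurable_cst.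
  - by move=> x; rewrite le_max lexx orbT.
  - by move=> x px; rewrite vp// maxxx.
  - apply: (le_integrable_real _ _ vi).
      by apply: measurable_funX; apply: measurable_maxr => //; exact: measurable_cst.
    move=> x; rewrite ger0_norm ?sqr_ge0//; case: (leP (v x) 0) => // _.
    by rewrite expr0n sqr_ge0.
have -> : (fun x => (u x)%:C) = (fun x => (Num.max (u x) 0)%:C - (Num.max (- u x) 0)%:C).
  apply/funext => x; rewrite -real_complexB; congr (_%:C).
  case: (leP (u x) 0); case: (leP (- u x) 0); lra.
apply: trig_approxB; first exact: pos.
apply: pos => //.
- exact: measurable_funN.
- by move=> x px; rewrite up// oppr0.
- by under eq_fun do rewrite sqrrN.
Qed.

(** Indicators give simple functions, monotone approximation gives nonnegative functions, and
    positive, negative, real and imaginary parts give the rest; no convergence of Fourier series is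
    involved. *)
Lemma trigonometric_dense f : cL2 f -> (forall x, ~ period x -> f x = 0) -> trig_approx f.
Proof.
move=> [[m1 m2] fi] fp.
have fE : f = (fun x => (Re (f x))%:C + 'i * (Im (f x))%:C).
  by apply/funext => x; apply: complex_ext; rewrite ?cReD ?cImD ?cReM ?cImM/=; ring.
rewrite fE; apply: trig_approxD; last apply: trig_approxZ.
- apply: trig_approx_real => //; first by move=> x px; rewrite fp.
  apply: (le_integrable_real (measurable_funX 2 m1) _ fi) => x.
  by rewrite ger0_norm ?sqr_ge0// normc_sqr lerDl sqr_ge0.
- apply: trig_approx_real => //; first by move=> x px; rewrite fp.
  apply: (le_integrable_real (measurable_funX 2 m2) _ fi) => x.
  by rewrite ger0_norm ?sqr_ge0// normc_sqr lerDr sqr_ge0.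
Qed.

(** The coefficient is not normalised, whence the factor pi in the Parseval bound; W is meant to
    vanish outside [period], so the integral runs over the whole line. *)
Definition fourier W (n : int) : R[i] := cint (fun x => cexp (- (2 * n%:~R * x))*i * W x).

Lemma real_complex_nat m : m%:R = (m%:R : R)%:C :> R[i].
Proof. by elim: m => [//|m IH]; rewrite -!natr1 real_complexD IH. Qed.

Lemma conjc_cexp y : (cexp y*i)^*%C = cexp (- y)*i.
Proof. by apply: complex_ext; rewrite /cexp/= expR0 ?cosN ?sinN ?mul1r. Qed.

Lemma cexp_2pi (n : int) : cexp (2 * n%:~R * pi)*i = 1 :> R[i].
Proof.
have nat_case (m : nat) : cexp (2 * m%:R * pi)*i = 1 :> R[i].
  have -> : (2 * m%:R * pi)*i = m%:R * (pi *+ 2)*i :> R[i].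
    rewrite real_complex_nat.
    by apply: complex_ext; rewrite ?cReM ?cImM/=; ring.
  rewrite cexp_natM (_ : cexp _ = 1) ?expr1n//.
  by apply: complex_ext; rewrite /cexp/= expR0 ?cos2pi ?sin2pi mul1r.
case: n => m; first exact: nat_case.
rewrite NegzE mulrNz.
have -> : (2 * - (m.+1)%:~R * pi)*i = - (2 * m.+1%:R * pi)*i :> R[i].
  by apply: complex_ext; rewrite ?cReN ?cImN/= ?oppr0//; ring.
by have := cexpNM (2 * m.+1%:R * pi : R)*i; rewrite nat_case mulr1.
Qed.

Lemma monomial_cexp N k x :
  unit_exp (- x) ^+ N * unit_exp x ^+ k = cexp (2 * (k%:Z - N%:Z)%:~R * x)*i :> R[i].
Proof.
rewrite /unit_exp -!cexp_natM -cexpD !real_complex_nat mulrzBr; congr cexp.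
by apply: complex_ext; rewrite !(cReD, cImD, cReM, cImM)/=; ring.
Qed.

(** For n <> 0, w = 2 i n times the integral is e^(w pi) - e^0 = 0 by the fundamental theorem. *)
Lemma cint_period_exp (n : int) :
  cint (fun x => cut (fun x => cexp (2 * n%:~R * x)*i) x) = ((n == 0)%:R * pi)%:C :> R[i].
Proof.
have [->|n0] := eqVneq n 0.
  rewrite mul1r; transitivity (cint (fun x => (\1_(@period R) x : R)%:C)).
    congr cint; apply/funext => x; rewrite /cut mulr0 mul0r.
    by rewrite (_ : _ *i = 0) ?cexp0 ?mulr1.
  apply: complex_ext; rewrite /cint/=.
    transitivity (fine (mu (@period R))); last by rewrite mu_period.
    by rewrite -(setIT period) -integral_indic ?setIT//; exact: measurable_period.
  by rewrite Rintegral_cst// mul0r.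
rewrite mul0r; pose w : R[i] := (2 * n%:~R)*i.
have w0 : w != 0.
  rewrite /w eq_complex/= eqxx/= mulf_neq0// ?pnatr_eq0//.
  by rewrite intr_eq0.
have wE x : (2 * n%:~R * x)*i = w * x%:C.
  by apply: complex_ext; rewrite ?cReM ?cImM/=; ring.
have pi0 : 0 <= pi :> R by exact: pi_ge0.
have acw : abs_continuous 0 (pi : R) (fun x => cexp (w * x%:C)).
  have ac1 : abs_continuous 0 (pi : R) (fun=> 1 : R[i]).
    move=> e e0; exists 1 => // m s t _ _ _.
    by rewrite big1// => i _; rewrite subrr ComplexField.Normc.normc0.
  have := @abs_continuousM R 0 pi (fun=> 1) (fun x => cexp (w * x%:C)) _ _ pi0 ac1
    (fun x h0 => cexp_bound w h0) (fun x y h1 h2 h3 => cexp_lipschitz w h1 h2 h3).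
  by congr abs_continuous; apply/funext => x; rewrite mulr1.
have wi : cintegrable (cut (fun x => w * cexp (w * x%:C))).
  apply: (@cintegrable_cL2 _ _ period); [exact: measurable_period|by rewrite mu_period ltey| |by move=> x; exact: cut_out].
  apply: (@cL2_cut_bounded _ _ (nc w)).
    apply: cmeasurableM; first exact: cmeasurable_cst.
    apply: cmeasurable_cexp; apply: cmeasurableM; first exact: cmeasurable_cst.
    by apply: cmeasurable_real; exact: measurable_id.
  move=> x; rewrite normcM normc_cexp /w cReM/= mul0r mulr0 subrr expR0 mulr1.
  exact: lexx.
have H := abs_continuous_cFTC pi0 acw wi.
have {}H : cexp (w * pi%:C) = cexp (w * 0%:C) +
    cint (fun t => (\1_(`]0, pi]%classic) t : R)%:C * cut (fun x => w * cexp (w * x%:C)) t).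
  apply: H; apply: (@filterE _ _ (ae_filter_ringOfSetsType mu)) => x.
  rewrite in_itv/= => /andP[x0 xpi]; rewrite cut_in; first exact: is_cderive_cexp.
  by rewrite /period/= in_itv/= x0 ltW.
have E1 : cexp (w * pi%:C) = 1 by rewrite -wE cexp_2pi.
have E0 : cexp (w * 0%:C) = 1 by rewrite mulr0 cexp0.
move: H; rewrite E1 E0 => /(congr1 (fun z => z - 1)).
rewrite subrr addrAC subrr add0r => H.
have {}H : w * cint (cut (fun x => cexp (2 * n%:~R * x)*i)) = 0.
  rewrite -cintZ; last first.
    have := cintegrableZ w^-1 wi; congr cintegrable; apply/funext => x.
    by rewrite /cut mulrCA (mulKf w0) wE.
  rewrite [RHS]H; congr cint; apply/funext => x.
  have [px|px] := pselect (period x); last by rewrite !cut_out ?mulr0.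
  by rewrite indic_in// mul1r !cut_in// wE.
by move/eqP: H; rewrite mulf_eq0 (negbTE w0)/= => /eqP.
Qed.

Lemma normc_cexp_im y : nc (cexp y*i) = 1.
Proof. by rewrite normc_cexp/= expR0. Qed.

Lemma cmeasurable_cexp_im s : cmeasurable (fun x => cexp (s * x)*i).
Proof.
apply: cmeasurable_cexp; split => /=; first exact: measurable_cst.
by apply: measurable_funM => //; exact: measurable_cst.
Qed.

Lemma cintegrable_cexp_im s W : cintegrable W -> cintegrable (fun x => cexp (s * x)*i * W x).
Proof.
move=> Wi; apply: (cintegrable_bounded (b := 1)) => //; first exact: cmeasurable_cexp_im.
by move=> x; rewrite normc_cexp_im.
Qed.

Lemma cintegrable_period W : cL2 W -> (forall x, ~ period x -> W x = 0) -> cintegrable W.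
Proof.
move=> WL Wp; apply: (cintegrable_cL2 measurable_period _ WL Wp).
by rewrite mu_period ltey.
Qed.

Lemma conjcM (z w : R[i]) : (z * w)^*%C = z^*%C * w^*%C.
Proof. by case: z => a b; case: w => c d; apply: complex_ext; rewrite ?cReM ?cImM/=; ring. Qed.

Lemma conjc_sum (I : Type) (r : seq I) (F : I -> R[i]) :
  (\sum_(i <- r) F i)^*%C = \sum_(i <- r) (F i)^*%C.
Proof. by rewrite rmorph_sum. Qed.

Lemma trigonometricE N (p : {poly R[i]}) x : unit_exp (- x) ^+ N * p.[unit_exp x] =
  \sum_(k < size p) p`_k * cexp (2 * (k%:Z - N%:Z)%:~R * x)*i.
Proof. by rewrite trigonometric_sum; apply: eq_bigr => k _; rewrite monomial_cexp. Qed.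

Lemma cint_conj_trigonometric W N (p : {poly R[i]}) :
  cintegrable W -> (forall x, ~ period x -> W x = 0) ->
  cint (fun x => W x * (cut (fun x => unit_exp (- x) ^+ N * p.[unit_exp x]) x)^*%C) =
  \sum_(k < size p) (p`_k)^*%C * fourier W (k%:Z - N%:Z).
Proof.
move=> Wi Wp.
have Fi (k : 'I_(size p)) : cintegrable (fun x => (p`_k)^*%C * (cexp (- (2 * (k%:Z - N%:Z)%:~R * x))*i * W x)).
  apply: cintegrableZ; have := cintegrable_cexp_im (- (2 * (k%:Z - N%:Z)%:~R)) Wi.
  by under eq_fun do rewrite mulNr.
transitivity (cint (fun x => \sum_(k < size p) (p`_k)^*%C *
    (cexp (- (2 * (k%:Z - N%:Z)%:~R * x))*i * W x))).
  congr cint; apply/funext => x; have [px|px] := pselect (period x); last first.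
    by rewrite Wp// mul0r big1// => k _; rewrite !mulr0.
  rewrite cut_in// trigonometricE conjc_sum mulr_sumr; apply: eq_bigr => k _.
  by rewrite conjcM conjc_cexp [RHS]mulrA [RHS]mulrC.
rewrite cint_sum//; apply: eq_bigr => k _; rewrite cintZ//.
have := cintegrable_cexp_im (- (2 * (k%:Z - N%:Z)%:~R)) Wi.
by under eq_fun do rewrite mulNr.
Qed.

Lemma fourier_trigonometric N (p : {poly R[i]}) (k : 'I_(size p)) :
  fourier (cut (fun x => unit_exp (- x) ^+ N * p.[unit_exp x])) (k%:Z - N%:Z) =
  pi%:C * p`_k.
Proof.
have Fi (l : 'I_(size p)) : cintegrable (cut (fun x => cexp (2 * (l%:Z - k%:Z)%:~R * x)*i)).
  apply: cintegrable_period; last by move=> x; exact: cut_out.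
  apply: (@cL2_cut_bounded _ _ 1); first exact: cmeasurable_cexp_im.
  by move=> x; rewrite normc_cexp_im.
transitivity (cint (fun x => \sum_(l < size p) p`_l * cut (fun x => cexp (2 * (l%:Z - k%:Z)%:~R * x)*i) x)).
  congr cint; apply/funext => x; have [px|px] := pselect (period x); last first.
    by rewrite cut_out// mulr0 big1// => l _; rewrite cut_out// mulr0.
  rewrite cut_in// trigonometricE mulr_sumr; apply: eq_bigr => l _.
  rewrite cut_in// mulrCA -cexpD; congr (_ * cexp _).
  by apply: complex_ext; rewrite !(cReD, cImD)/= ?addr0// !mulrzBr; ring.
rewrite cint_sum; last by move=> l; exact: cintegrableZ.
rewrite (bigD1 k)//= cintZ// cint_period_exp subrr eqxx mul1r mulrC big1 ?addr0// => l lk.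
rewrite cintZ// cint_period_exp subr_eq0 (_ : (l%:Z == k%:Z) = false) ?mul0r ?mulr0//.
by apply/negbTE; apply: contra lk => /eqP[lk]; apply/eqP/val_inj.
Qed.

Lemma normc_sqrB_conj (z w : R[i]) :
  2 * Re (z * w^*%C) = nc z ^+ 2 + nc w ^+ 2 - nc (z - w) ^+ 2.
Proof. by case: z => a b; case: w => c d; rewrite !normc_sqr/=; ring. Qed.

Lemma Re_cint_conj W f : cL2 W -> cL2 f ->
  2 * Re (cint (fun x => W x * (f x)^*%C)) =
  sqnorm W + sqnorm f - sqnorm (fun x => W x - f x).
Proof.
move=> WL fL; have [_ Wi] := WL; have [_ fi] := fL; have [_ Wfi] := cL2B WL fL.
have Pi : cintegrable (fun x => W x * (f x)^*%C).
  have [[m1 m2] _] := fL; apply: cintegrableM => //; apply: (@cL2_le _ _ f 1) => //.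
    split; first by move: m1; congr measurable_fun; apply/funext => x; case: (f x).
    have := measurable_funN m2; congr measurable_fun; apply/funext => x /=; by case: (f x).
  by move=> x; rewrite mul1r; case: (f x) => a b /=; rewrite /ComplexField.Normc.normc sqrrN.
rewrite /= -RintegralZl//; last exact: Pi.1.
rewrite /sqnorm -RintegralD// -RintegralB//; last exact: integrableDr.
by apply: eq_Rintegral => x _; rewrite normc_sqrB_conj.
Qed.

Lemma conj_mul_amgm (t : R) (z w : R[i]) : 0 < t ->
  2 * Re (z^*%C * w) <= t * nc z ^+ 2 + nc w ^+ 2 / t.
Proof.
move=> t0; case: z => a b; case: w => c d; rewrite !normc_sqr/=.
have e : t * ((c ^+ 2 + d ^+ 2) / t) = c ^+ 2 + d ^+ 2 by field; rewrite gt_eqF.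
rewrite -(ler_pM2l t0) [leRHS]mulrDr e.
have := sqr_ge0 (t * a - c); have := sqr_ge0 (t * b - d); nra.
Qed.

(* Density reduces Parseval's lower bound to the expansion of |W - T|^2 for a
   trigonometric polynomial T. *)
Lemma fourier_lower_bound W (S : R) : cL2 W -> (forall x, ~ period x -> W x = 0) ->
  (forall s : seq int, uniq s -> \sum_(n <- s) nc (fourier W n) ^+ 2 <= S) ->
  pi * sqnorm W <= S.
Proof.
move=> WL Wp HS; apply/ler_addgt0Pr => e e0.
have pi0 : 0 < pi :> R := pi_gt0 R.
have epi : 0 < e / pi by rewrite divr_gt0.
have [_ WA] := trigonometric_dense WL Wp.
have [T tT WT] := WA _ epi; have [N [p TE]] := tT.
pose T1 := cut (fun x => unit_exp (- x) ^+ N * p.[unit_exp x]).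
have TT : cut T = T1 by apply/funext => x; rewrite /T1 /cut TE.
have T1L : cL2 T1 by rewrite -TT; exact: cL2_cut_trigonometric.
have T1p x : ~ period x -> T1 x = 0 by exact: cut_out.
have Wi := cintegrable_period WL Wp.
have T1i := cintegrable_period T1L T1p.
have H1 := Re_cint_conj WL T1L; rewrite cint_conj_trigonometric// in H1.
have H2 : sqnorm T1 = \sum_(k < size p) pi * nc p`_k ^+ 2.
  have := Re_cint_conj T1L T1L; rewrite cint_conj_trigonometric//.
  rewrite (_ : sqnorm (fun x => T1 x - T1 x) = 0); last first.
    rewrite /sqnorm (@eq_Rintegral _ _ _ _ _ (fun=> 0)) ?Rintegral_cst//= ?mul0r//.
    by move=> x _; rewrite subrr ComplexField.Normc.normc0 expr0n.
  rewrite subr0 => H; apply: (@mulfI _ (2 : R)); first by rewrite pnatr_eq0.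
  rewrite [LHS]mulr_natl mulr2n -H; congr (_ * _); rewrite cRe_sum.
  apply: eq_bigr => k _; rewrite fourier_trigonometric; case: (p`_k) => a b.
  by rewrite normc_sqr/=; ring.
rewrite TT in WT.
(* The arithmetic-geometric inequality is weighted by pi because this reproduces [sqnorm T1], as
   computed in [H2], which then cancels against [H1]. *)
have H3 : 2 * Re (\sum_(k < size p) (p`_k)^*%C * fourier W (k%:Z - N%:Z)) <= sqnorm T1 + S / pi.
  rewrite H2 cRe_sum mulr_sumr.
  apply: (@le_trans _ _ (\sum_(k < size p) (pi * nc p`_k ^+ 2 + nc (fourier W (k%:Z - N%:Z)) ^+ 2 / pi))).
    by apply: ler_sum => k _; exact: conj_mul_amgm.
  rewrite big_split/= lerD2l -mulr_suml ler_pM2r ?invr_gt0//.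
  have := HS [seq (k%:Z - N%:Z) | k <- iota 0 (size p)].
  rewrite big_map -[size p]subn0 -/(index_iota _ _) big_mkord subn0; apply.
  rewrite map_inj_uniq ?iota_uniq// => i j /= /addIr [] //.
have : sqnorm W <= S / pi + e / pi by lra.
by rewrite -mulrDl ler_pdivlMr// mulrC.
Qed.

End TrigonometricCompleteness.

(** * Sampling near the integers *)

Section Sampling.
Context {R : realType}.
Implicit Types (W : R -> R[i]) (a s v x y : R) (w l k z : R[i]).

Lemma integral_affine_sqr a : a < pi ->
  \int[mu]_(v in `[a, pi]) ((pi + a - 2 * v) ^+ 2) = (pi - a) ^+ 3 / 3 :> R.
Proof.
move=> api; pose F v : R := - (pi + a - 2 * v) ^+ 3 / 6.
have dF v : is_derive v 1 F ((pi + a - 2 * v) ^+ 2).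
  by apply: is_derive_eq; rewrite /GRing.scale/=; field.
have cF v : {for v, continuous F}.
  apply: differentiable_continuous; apply/derivable1_diffP.
  exact: (@ex_derive _ _ _ _ _ _ _ (dF v)).
have dq v : is_derive v 1 (fun v => (pi + a - 2 * v) ^+ 2 : R) (- 4 * (pi + a - 2 * v)).
  by apply: is_derive_eq; rewrite /GRing.scale/=; ring.
have := @continuous_FTC2 R (fun v => (pi + a - 2 * v) ^+ 2) F a pi api.
move=> H; rewrite /Rintegral H.
- by rewrite -EFinB /= /F; field.
- apply: derivable_within_continuous => v _; exact: (@ex_derive _ _ _ _ _ _ _ (dq v)).
- split.
  + by move=> v _; exact: (@ex_derive _ _ _ _ _ _ _ (dF v)).
  + by apply: cvg_at_right_filter; exact: cF.
  + by apply: cvg_at_left_filter; exact: cF.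
- by move=> v _; rewrite derive1E; exact: derive_val.
Qed.

(** The factor by which 2 |k| is multiplied to bound e^(i k (pi + a - 2v)) - 1. The phase is centred
    at the midpoint of [[a, pi]], which gives this function the small squared norm (pi - a)^3 /
    3. *)
Definition affine_window a v : R[i] := ((\1_(`[a, pi]%classic) v : R) * (pi + a - 2 * v))%:C.

Lemma cL2_affine_window a : 0 <= a -> cL2 (affine_window a).
Proof.
move=> a0; apply: (@cL2_bounded _ _ (pi + a) `[a, pi]) => //.
- by rewrite lebesgue_measure_itv/=; case: ifP => // _; rewrite -EFinB ltey.
- apply: cmeasurable_real; apply: measurable_funM; first exact: measurable_indic.
  apply: measurable_funB; first exact: measurable_cst.
  by apply: measurable_funM => //; exact: measurable_cst.
- move=> v av; rewrite normc_real indicE mem_set// mul1r.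
  move: av; rewrite /= in_itv/= => /andP[? ?].
  by rewrite ler_norml; apply/andP; split; lra.
- by move=> v av; rewrite /affine_window indicE memNset// mul0r.
Qed.

Lemma sqnorm_affine_window a : a < pi -> sqnorm (affine_window a) = (pi - a) ^+ 3 / 3.
Proof.
move=> api; rewrite -integral_affine_sqr// -Rintegral_indicM; apply: eq_Rintegral => v _.
rewrite normc_real real_normK ?num_real// exprMn indicE.
by case: (_ \in _); rewrite ?expr1n ?expr0n.
Qed.

Lemma delay_expD a w z v : delay_exp a pi (w + z) v = delay_exp a pi w v * delay_exp a pi z v :> R[i].
Proof. by rewrite /delay_exp mulrDl cexpD. Qed.

Lemma normc_delay_exp_im a x v : nc (delay_exp a pi x*i v) = 1 :> R.
Proof. by rewrite normc_cexp cReM/= mul0r mulr0 subrr expR0. Qed.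

Lemma i_real x : 'i * x%:C = x*i :> R[i].
Proof. by apply: complex_ext; rewrite ?cReM ?cImM/=; ring. Qed.

Lemma normc_i : nc ('i : R[i]) = 1.
Proof. by rewrite /ComplexField.Normc.normc expr0n add0r expr1n sqrtr1. Qed.

Lemma delay_exp_perturbation a k v : 2 * pi / 5 <= a -> a <= v <= pi -> nc k <= 1 / 2 ->
  nc (delay_exp a pi ('i * k) v - 1) <= 2 * nc k * nc (affine_window a v).
Proof.
move=> a5 av k2; have pi32 := @pi_lt32 R; have pi0 := pi_gt0 R.
have y : `|pi + a - 2 * v| <= pi - a.
  by move/andP: av => [? ?]; rewrite ler_norml; apply/andP; split; lra.
apply: (le_trans (normc_cexpB1_le2 _)).
  apply: (le_trans (Re_le_normc _)); rewrite !normcM normc_i mul1r normc_real.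
  (* Here (pi - a) / 2 <= 3 pi / 10 < 1 by [pi_lt32], so the sharp exponential bound with factor 2
     applies. *)
  apply: (@le_trans _ _ (1 / 2 * (pi - a))); last by lra.
  by apply: ler_pM => //; exact: normc_ge0.
rewrite !normcM normc_i mul1r !normc_real indicE mem_set/= ?in_itv//= mul1r mulrA.
exact: lexx.
Qed.

Lemma cintegrable_delay_expW a w W : 0 <= a -> cL2 W -> supported a pi W ->
  cintegrable (fun v => delay_exp a pi w v * W v).
Proof.
move=> a0 WL Ws; apply: cintegrable_delay_exp => //.
exact: (cintegrable_supported WL Ws).
Qed.

Lemma sampling_difference a x k W : 2 * pi / 5 <= a -> a < pi -> cL2 W -> supported a pi W ->
  nc k <= 1 / 2 ->
  nc (cint (fun v => delay_exp a pi ('i * x%:C) v * W v) -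
      cint (fun v => delay_exp a pi ('i * (x%:C + k)) v * W v)) ^+ 2 <=
  4 * nc k ^+ 2 * ((pi - a) ^+ 3 / 3) * sqnorm W.
Proof.
move=> a5 api WL Ws k2; have pi0 := pi_gt0 R; have a0 : 0 <= a by lra.
rewrite -cintB; [|exact: cintegrable_delay_expW..].
pose h v := (\1_(`[a, pi]%classic) v : R)%:C * (delay_exp a pi ('i * x%:C) v - delay_exp a pi ('i * (x%:C + k)) v).
have hE v : nc (h v) <= 2 * nc k * nc (affine_window a v).
  rewrite /h (mulrDr 'i) delay_expD -{1}[delay_exp a pi ('i * x%:C) v]mulr1 -mulrBr.
  rewrite !normcM i_real normc_delay_exp_im mul1r normc_real indicE.
  have [|_] := boolP (v \in _); last by rewrite normr0 mul0r !mulr_ge0 ?normc_ge0.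
  rewrite inE/= in_itv/= normr1 mul1r => av.
  by rewrite normcBC; exact: delay_exp_perturbation.
have hL : cL2 h.
  apply: (cL2_le _ (cL2_affine_window a0) hE).
  apply: cmeasurableM; first exact: cmeasurable_indic.
  by apply: cmeasurableB; exact: cmeasurable_delay_exp.
have -> : (fun v => delay_exp a pi ('i * x%:C) v * W v - delay_exp a pi ('i * (x%:C + k)) v * W v) =
    (fun v => h v * W v).
  apply/funext => v; rewrite -mulrBl; have [/andP[h1 h2]|/Ws ->] := pselect (a < v < pi); last by rewrite !mulr0.
  by rewrite /h indic_in ?mul1r//= in_itv/= !ltW.
apply: (le_trans (cauchy_schwarz hL WL)); rewrite ler_wpM2r ?sqnorm_ge0//.
rewrite -sqnorm_affine_window//.
have -> : 4 * nc k ^+ 2 = nc ((2 * nc k)%:C) ^+ 2 :> R.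
  by rewrite normc_real real_normK ?num_real//; ring.
rewrite -sqnormZ; last exact: cL2_affine_window.
apply: le_sqnorm => //; first by apply: cL2Z; exact: cL2_affine_window.
by move=> v; rewrite [leRHS]normcM normc_real ger0_norm ?mulr_ge0 ?normc_ge0.
Qed.

(** The exponential at n - s is e^(-2inv) e^(2isv) times the constant e^(i (n - s)(pi + a)), which
    has modulus one; the shift s is absorbed into W without changing its modulus. *)
Lemma cint_sampling_node a s n W : 0 <= a -> cL2 W -> supported a pi W ->
  nc (cint (fun v => delay_exp a pi ('i * (n%:~R - s)%:C) v * W v)) =
  nc (fourier (fun v => cexp (2 * s * v)*i * W v) n).
Proof.
move=> a0 WL Ws.
rewrite /fourier -[RHS]mul1r -[X in _ = X * _](normc_cexp_im ((n%:~R - s) * (pi + a))) -normcM -cintZ.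
  congr (nc (cint _)); apply/funext => v; rewrite mulrA -mulrA -[in RHS]mulrA.
  rewrite !mulrA -!cexpD /delay_exp i_real; congr (cexp _ * _).
  by apply: complex_ext; rewrite !(cReD, cImD, cReM, cImM)/=; ring.
under eq_fun do rewrite -mulNr.
have Wi := cintegrable_supported WL Ws.
by apply: cintegrable_cexp_im; exact: cintegrable_cexp_im.
Qed.

(** A quantitative Paley-Wiener perturbation argument: the Parseval bound holds for the samples at n
    - s, and the cost of replacing them by the samples at n - s + k_n is a multiple of [sqnorm W]
    smaller than pi, so it can be absorbed on the left. *)
Lemma sampling a s (k : int -> R[i]) W (S : R) : 2 * pi / 5 <= a -> a < pi ->
  cL2 W -> supported a pi W ->
  (forall r : seq int, uniq r -> \sum_(n <- r) nc (k n) ^+ 2 <= 1 / 4) ->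
  (forall r : seq int, uniq r -> \sum_(n <- r)
     nc (cint (fun v => delay_exp a pi ('i * ((n%:~R - s)%:C + k n)) v * W v)) ^+ 2 <= S) ->
  sqnorm W <= 30 * S.
Proof.
move=> a5 api WL Ws Hk HS.
have pi32 := @pi_lt32 R; have pi2 := pi_ge2 R; have a0 : 0 <= a by lra.
pose V v := cexp (2 * s * v)*i * W v.
have VW v : nc (V v) = nc (W v) by rewrite /V normcM normc_cexp_im mul1r.
have VL : cL2 V.
  apply: (@cL2_le _ _ W 1) => //; last by move=> v; rewrite VW mul1r.
  by apply: cmeasurableM; [exact: cmeasurable_cexp_im|case: WL].
have sVW : sqnorm V = sqnorm W by apply: eq_Rintegral => v _; rewrite VW.
have k2 n : nc (k n) <= 1 / 2.
  have := Hk [:: n] isT; rewrite big_seq1 => h.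
  by rewrite -(@ler_sqr R) ?nnegrE ?normc_ge0//; lra.
have Vp v : ~ period v -> V v = 0.
  move=> nv; rewrite /V Ws ?mulr0// => /andP[h1 h2]; apply: nv.
  by rewrite /period/= in_itv/=; apply/andP; split; lra.
have H := @fourier_lower_bound R V (10 * S + (10 / 27) * (pi - a) ^+ 3 * sqnorm W) VL Vp.
have {}H : pi * sqnorm V <= 10 * S + (10 / 27) * (pi - a) ^+ 3 * sqnorm W.
  apply: H => r ur.
  pose y n := cint (fun v => delay_exp a pi ('i * ((n%:~R - s)%:C + k n)) v * W v).
  apply: (@le_trans _ _ (\sum_(n <- r) (10 * nc (y n) ^+ 2 +
      (40 / 27) * (pi - a) ^+ 3 * sqnorm W * nc (k n) ^+ 2))).
    apply: ler_sum => n _; rewrite -(cint_sampling_node s n a0 WL Ws).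
    have := sampling_difference (n%:~R - s) a5 api WL Ws (k2 n).
    rewrite -/(y n); set x := cint _ => h.
    (* Young's inequality with weights 1/10 and 9/10: the right side exceeds the left by |10 y -
       x|^2 / 9. A weight close to 1 on the perturbation is needed, since with 2 and 2 it would
       exceed pi in the worst case. Summed up, it contributes (10/9) (pi - a)^3 / 3 = (10/27) (pi -
       a)^3, at most 0.08 pi^3. *)
    have h2 : nc x ^+ 2 <= 10 * nc (y n) ^+ 2 + 10 / 9 * nc (x - y n) ^+ 2.
      rewrite !normc_sqr cReD cImD cReN cImN.
      have := sqr_ge0 (10 * Re (y n) - Re x); have := sqr_ge0 (10 * Im (y n) - Im x); nra.
    apply: (le_trans h2); rewrite lerD2l.
    apply: (@le_trans _ _ (10 / 9 * (4 * nc (k n) ^+ 2 * ((pi - a) ^+ 3 / 3) * sqnorm W))).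
      by rewrite ler_wpM2l.
    by rewrite le_eqVlt; apply/orP; left; apply/eqP; field.
  rewrite big_split/= -!mulr_sumr; apply: lerD.
    by rewrite ler_wpM2l//; exact: HS.
  have c0 : 0 <= (pi - a) ^+ 3 * sqnorm W.
    by rewrite mulr_ge0 ?sqnorm_ge0// exprn_ge0//; lra.
  have := Hk r ur; nra.
rewrite sVW in H.
have p3 : (pi - a) ^+ 3 <= (3 * pi / 5) ^+ 3 by apply: lerXn2r; rewrite ?nnegrE; lra.
have W0 := sqnorm_ge0 W.
have {}p3 : (10 / 27) * (pi - a) ^+ 3 * sqnorm W <= (8 / 100) * pi ^+ 3 * sqnorm W.
  by rewrite ler_wpM2r//; lra.
have pp : pi ^+ 2 <= 1024 / 100 :> R by nra.
have : pi * (1 - 8 / 100 * pi ^+ 2) * sqnorm W <= 10 * S by lra.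
(* The margin pi - 0.08 pi^3 is bounded below using 2 <= pi and pi^2 <= 10.24; since 10 / 0.36 < 30,
   the constant 30 results. *)
have q : 36 / 100 <= (pi : R) * (1 - 8 / 100 * pi ^+ 2).
  have u18 : 18 / 100 <= 1 - 8 / 100 * (pi : R) ^+ 2 by lra.
  apply: (@le_trans _ _ (2 * (18 / 100))); first by lra.
  by apply: ler_pM.
have := ler_wpM2r W0 q; lra.
Qed.

End Sampling.

(** * Stability of the data recovered from the zeros *)

Section Zeros.
Context {R : realType}.
Implicit Types (W : R -> R[i]) (a s v x y : R) (w l k z sg : R[i]).

(** In a strip |Im l| <= 1/2 and for |y| <= pi, e^(pi/2) bounds the exponential itself; the
    remaining factors come from |e^z - 1| <= 2 |z| e^|Re z| with |z| <= pi |l - l'| and |l - l'| <=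
    1. *)
Definition exp_lipschitz_const : R := expR (pi / 2) * (2 * pi) * expR pi.

Local Notation B := exp_lipschitz_const.

Lemma exp_lipschitz_const_gt0 : 0 < B.
Proof. by rewrite !mulr_gt0 ?expR_gt0// pi_gt0. Qed.

Lemma Re_iM l y : Re ('i * l * y%:C) = - Im l * y.
Proof. by rewrite !cReM !cImM/=; ring. Qed.

Lemma normc_cexp_i l y : `|y| <= pi -> `|Im l| <= 1 / 2 ->
  nc (cexp ('i * l * y%:C)) <= expR (pi / 2).
Proof.
move=> ypi l12; rewrite normc_cexp ler_expR Re_iM (le_trans (ler_norm _))// normrM normrN.
have := ler_pM (normr_ge0 _) (normr_ge0 _) l12 ypi; lra.
Qed.

Lemma cexp_i_lipschitz l l' y : `|y| <= pi -> `|Im l'| <= 1 / 2 -> nc (l - l') <= 1 ->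
  nc (cexp ('i * l * y%:C) - cexp ('i * l' * y%:C)) <= B * nc (l - l').
Proof.
move=> ypi l12 ll1; have pi0 := pi_gt0 R.
have -> : 'i * l * y%:C = 'i * l' * y%:C + 'i * (l - l') * y%:C by ring.
rewrite cexpD -[X in _ - X]mulr1 -mulrBr normcM.
have h1 := normc_cexp_i ypi l12.
have h2 := normc_cexpB1 ('i * (l - l') * y%:C).
have h3 : expR `|Re ('i * (l - l') * y%:C)| <= expR pi.
  rewrite ler_expR Re_iM normrM normrN -[leRHS]mul1r.
  by apply: ler_pM => //; rewrite (le_trans (Im_le_normc _)).
rewrite !normcM normc_i mul1r normc_real in h2.
have n0 := normc_ge0 (l - l').
have h4 : 2 * (nc (l - l') * `|y|) * expR `|Re ('i * (l - l') * y%:C)| <=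
    2 * (nc (l - l') * pi) * expR pi.
  by apply: ler_pM => //; rewrite ?mulr_ge0 ?expR_ge0// ler_wpM2l// ler_wpM2l.
have -> : B * nc (l - l') = expR (pi / 2) * (2 * (nc (l - l') * pi) * expR pi).
  by rewrite /exp_lipschitz_const; ring.
by apply: ler_pM => //; rewrite ?normc_ge0// (le_trans h2).
Qed.

(** The free term is -2 sin(pi l) for sg = 1 and 2 i cos(pi l) for sg = -1. *)
Definition char_integral a sg W l : R[i] :=
  'i * (cexp ('i * l * pi%:C) - sg * cexp ('i * l * (- pi)%:C)) -
  cint (fun v => delay_exp a pi ('i * l) v * W v).

(** The points n - s are zeros of the free term: s = 0 goes with sg = 1 and s = 1/2 with sg = -1. *)
Definition nodes s sg := nc sg = 1 /\
  forall n : int, cexp ('i * (n%:~R - s)%:C * pi%:C) = sg * cexp ('i * (n%:~R - s)%:C * (- pi)%:C).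

(** Bounding all finite partial sums states an l2 bound without any infinite sum. *)
Definition small_l2 (k : int -> R[i]) (S : R) :=
  forall r : seq int, uniq r -> \sum_(n <- r) nc (k n) ^+ 2 <= S.

Lemma small_l2_le (k : int -> R[i]) n : small_l2 k (1 / 4) -> nc (k n) <= 1 / 2.
Proof.
move=> Hk; have := Hk [:: n] isT; rewrite big_seq1 => h.
by rewrite -(@ler_sqr R) ?nnegrE ?normc_ge0//; lra.
Qed.

Lemma free_term_lipschitz sg l l' : nc sg = 1 -> `|Im l'| <= 1 / 2 -> nc (l - l') <= 1 ->
  nc ((cexp ('i * l * pi%:C) - sg * cexp ('i * l * (- pi)%:C)) -
      (cexp ('i * l' * pi%:C) - sg * cexp ('i * l' * (- pi)%:C))) <= 2 * B * nc (l - l').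
Proof.
move=> sg1 l2 ll1; have pi0 := pi_ge0 R.
have -> : (cexp ('i * l * pi%:C) - sg * cexp ('i * l * (- pi)%:C)) -
      (cexp ('i * l' * pi%:C) - sg * cexp ('i * l' * (- pi)%:C)) =
  (cexp ('i * l * pi%:C) - cexp ('i * l' * pi%:C)) -
      sg * (cexp ('i * l * (- pi)%:C) - cexp ('i * l' * (- pi)%:C)) by ring.
apply: (le_trans (le_normcB _ _)); rewrite normcM sg1 mul1r.
have h1 := @cexp_i_lipschitz l l' pi; rewrite ger0_norm// in h1.
have h2 := @cexp_i_lipschitz l l' (- pi); rewrite normrN ger0_norm// in h2.
have {}h1 := h1 (lexx _) l2 ll1; have {}h2 := h2 (lexx _) l2 ll1; lra.
Qed.

Definition W_bound : R := 30 * (B ^+ 2).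

(** At a zero the integral equals the free term, which vanishes at n - s and is therefore at most 2
    B |k_n|. The squares add up to at most 4 B^2 / 4 = B^2, and [sampling] multiplies by 30. *)
Lemma zeros_bound a s sg (k : int -> R[i]) W : 2 * pi / 5 <= a -> a < pi ->
  cL2 W -> supported a pi W -> nodes s sg -> small_l2 k (1 / 4) ->
  (forall n, char_integral a sg W ((n%:~R - s)%:C + k n) = 0) ->
  sqnorm W <= W_bound.
Proof.
move=> a5 api WL Ws [sg1 nd] Hk Hz; apply: (sampling (s := s) a5 api WL Ws Hk) => r ur.
apply: (@le_trans _ _ (\sum_(n <- r) 4 * B ^+ 2 * nc (k n) ^+ 2)); last first.
  rewrite -mulr_sumr; have := Hk r ur; have := sqr_ge0 B; nra.
apply: ler_sum => n _; have := Hz n; rewrite /char_integral => /eqP.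
rewrite subr_eq0 => /eqP <-; rewrite normcM normc_i mul1r.
set l := _ + k n; pose l' : R[i] := (n%:~R - s)%:C.
have lk : l - l' = k n by rewrite /l /l' addrC addKr.
have kn := small_l2_le n Hk.
have := @free_term_lipschitz sg l l' sg1; rewrite lk nd subrr subr0 => H.
have -> : 4 * B ^+ 2 * nc (k n) ^+ 2 = (2 * B * nc (k n)) ^+ 2 by ring.
rewrite ler_sqr ?nnegrE ?normc_ge0 ?mulr_ge0 ?normc_ge0 ?(ltW exp_lipschitz_const_gt0)//.
apply: H; last lra.
  by rewrite /= normr0; lra.
exact: pi_ge0.
Qed.

Lemma cint_exp_lipschitz a l l' W : 0 <= a -> a < pi -> cL2 W -> supported a pi W ->
  `|Im l'| <= 1 / 2 -> nc (l - l') <= 1 ->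
  nc (cint (fun v => delay_exp a pi ('i * l) v * W v) -
      cint (fun v => delay_exp a pi ('i * l') v * W v)) ^+ 2 <=
  B ^+ 2 * nc (l - l') ^+ 2 * pi * sqnorm W.
Proof.
move=> a0 api WL Ws l2 ll1.
rewrite -cintB; [|exact: cintegrable_delay_expW..].
pose h v := (\1_(`[a, pi]%classic) v : R)%:C * (delay_exp a pi ('i * l) v - delay_exp a pi ('i * l') v).
have B0 := ltW exp_lipschitz_const_gt0; have n0 := normc_ge0 (l - l').
have hE v : nc (h v) <= (B * nc (l - l')) * nc ((\1_(`[a, pi]%classic) v : R)%:C).
  rewrite /h normcM mulrC normc_real indicE.
  have [|_] := boolP (v \in _); last by rewrite normr0 !mulr0.
  rewrite inE/= in_itv/= normr1 !mulr1 => /andP[av vpi].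
  by apply: cexp_i_lipschitz => //; rewrite ler_norml; apply/andP; split; lra.
have mfin : (mu (`[a, pi]%classic : set R) < +oo)%E.
  by rewrite lebesgue_measure_itv/=; case: ifP => // _; rewrite -EFinB ltey.
have IL : cL2 (fun v => (\1_(`[a, pi]%classic) v : R)%:C) by apply: cL2_indic.
have hL : cL2 h.
  apply: (cL2_le _ IL hE); apply: cmeasurableM; first exact: cmeasurable_indic.
  by apply: cmeasurableB; exact: cmeasurable_delay_exp.
have -> : (fun v => delay_exp a pi ('i * l) v * W v - delay_exp a pi ('i * l') v * W v) =
    (fun v => h v * W v).
  apply/funext => v; rewrite -mulrBl; have [/andP[h1 h2]|/Ws ->] := pselect (a < v < pi); last by rewrite !mulr0.
  by rewrite /h indic_in ?mul1r//= in_itv/= !ltW.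
apply: (le_trans (cauchy_schwarz hL WL)); rewrite ler_wpM2r ?sqnorm_ge0//.
apply: (@le_trans _ _ ((B * nc (l - l')) ^+ 2 * (pi - a))); last first.
  by rewrite exprMn ler_wpM2l ?mulr_ge0 ?sqr_ge0//; lra.
have <- : sqnorm (fun v => (\1_(`[a, pi]%classic) v : R)%:C) = pi - a.
  by rewrite sqnorm_indic// lebesgue_measure_itv/= lte_fin api.
have -> : (B * nc (l - l')) ^+ 2 = nc ((B * nc (l - l'))%:C) ^+ 2 :> R.
  by rewrite normc_real real_normK ?num_real.
rewrite -sqnormZ//; apply: le_sqnorm => //; first exact: cL2Z.
move=> v; rewrite [leRHS]normcM.
have -> : nc ((B * nc (l - l'))%:C) = B * nc (l - l').
  by rewrite normc_real ger0_norm// mulr_ge0.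
exact: hE.
Qed.

Definition W_lipschitz : R := 30 * (B ^+ 2 * (8 + 2 * pi * W_bound)).

(** [sampling] is applied to W - W' at the zeros of the second problem. The 8 in [W_lipschitz] comes
    from the free terms and 2 pi [W_bound] from the displaced frequency under W, which is where the
    a priori bound of [zeros_bound] enters. *)
Lemma zeros_stability a s sg (k k' : int -> R[i]) W W' (S : R) : 2 * pi / 5 <= a -> a < pi ->
  cL2 W -> supported a pi W -> cL2 W' -> supported a pi W' -> nodes s sg ->
  small_l2 k (1 / 4) -> small_l2 k' (1 / 4) ->
  (forall n, char_integral a sg W ((n%:~R - s)%:C + k n) = 0) ->
  (forall n, char_integral a sg W' ((n%:~R - s)%:C + k' n) = 0) ->
  small_l2 (fun n => k n - k' n) S ->
  sqnorm (fun v => W v - W' v) <= W_lipschitz * S.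
Proof.
move=> a5 api WL Ws W'L W's nd Hk Hk' Hz Hz' HS.
have a0 : 0 <= a by have := pi_gt0 R; lra.
have Wb := zeros_bound a5 api WL Ws nd Hk Hz; have [sg1 _] := nd.
have DL := cL2B WL W'L.
have Ds : supported a pi (fun v => W v - W' v) by move=> v nv; rewrite Ws// W's// subrr.
rewrite /W_lipschitz -mulrA; apply: (sampling (s := s) a5 api DL Ds Hk') => r ur.
have B2 := sqr_ge0 B.
have Wb0 : 0 <= W_bound by rewrite mulr_ge0.
have pi0 := pi_ge0 R.
apply: (@le_trans _ _ (\sum_(n <- r) B ^+ 2 * (8 + 2 * pi * W_bound) * nc (k n - k' n) ^+ 2)); last first.
  rewrite -mulr_sumr ler_wpM2l//; last exact: HS.
  by rewrite mulr_ge0// addr_ge0// mulr_ge0// mulr_ge0.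
apply: ler_sum => n _.
set l := (n%:~R - s)%:C + k n; set l' := (n%:~R - s)%:C + k' n.
have ll : l - l' = k n - k' n by rewrite /l /l'; ring.
have kn := small_l2_le n Hk; have kn' := small_l2_le n Hk'.
have ll1 : nc (l - l') <= 1 by rewrite ll (le_trans (le_normcB _ _))//; lra.
have l2 : `|Im l'| <= 1 / 2.
  by rewrite /l' cImD/= add0r (le_trans (Im_le_normc _)).
have h1 := free_term_lipschitz sg1 l2 ll1.
have h2 := cint_exp_lipschitz a0 api WL Ws l2 ll1.
(* Each characteristic integral vanishes at its own zero. Adding and subtracting the integral of W
   at [l] leaves only differences of one and the same function between [l] and [l']. *)
have E : cint (fun v => delay_exp a pi ('i * l') v * (W v - W' v)) =
    (cint (fun v => delay_exp a pi ('i * l') v * W v) - cint (fun v => delay_exp a pi ('i * l) v * W v)) -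
    'i * ((cexp ('i * l' * pi%:C) - sg * cexp ('i * l' * (- pi)%:C)) -
      (cexp ('i * l * pi%:C) - sg * cexp ('i * l * (- pi)%:C))).
  transitivity (cint (fun v => delay_exp a pi ('i * l') v * W v) -
      cint (fun v => delay_exp a pi ('i * l') v * W' v)).
    rewrite -cintB; [|exact: cintegrable_delay_expW..].
    by congr cint; apply/funext => v; rewrite mulrBr.
  move: (Hz n) (Hz' n); rewrite /char_integral -/l -/l' => /eqP; rewrite subr_eq0 => /eqP <-.
  by move=> /eqP; rewrite subr_eq0 => /eqP <-; ring.
rewrite E -ll.
move: h1 h2; set T := cexp ('i * l * _) - _; set T' := cexp ('i * l' * _) - _.
set I := cint (fun v => delay_exp a pi ('i * l) v * W v); set I' := cint _ => h1 h2.
apply: (le_trans (normc_sqrD_le _ _)); rewrite normcN normcM normc_i mul1r.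
rewrite (normcBC I') (normcBC T').
have n0 := normc_ge0 (l - l').
have h3 : nc (T - T') ^+ 2 <= 4 * (B ^+ 2 * nc (l - l') ^+ 2).
  have -> : 4 * (B ^+ 2 * nc (l - l') ^+ 2) = (2 * B * nc (l - l')) ^+ 2 by ring.
  by rewrite ler_sqr ?nnegrE ?normc_ge0 ?(le_trans (normc_ge0 _) h1).
have h4 : B ^+ 2 * nc (l - l') ^+ 2 * pi * sqnorm W <= B ^+ 2 * nc (l - l') ^+ 2 * pi * W_bound.
  by apply: ler_wpM2l => //; rewrite !mulr_ge0 ?sqr_ge0.
have -> : B ^+ 2 * (8 + 2 * pi * W_bound) * nc (l - l') ^+ 2 =
   2 * (B ^+ 2 * nc (l - l') ^+ 2 * pi * W_bound) + 2 * (4 * (B ^+ 2 * nc (l - l') ^+ 2)) by ring.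
lra.
Qed.

End Zeros.

(** * Inverting the quadratic map from the potentials to the data *)

Section KernelStability.
Context {R : realType}.
Implicit Types (P M F H : R -> R[i]) (a v t : R) (c : R[i]).

Lemma cint_delay_product F H a v : cL2 F -> cL2 H ->
  cintegrable (fun t => F t * H (a / 2 + t - v)).
Proof.
move=> FL HL; apply: cintegrableM => //.
have := cL2_translate (v - a / 2) HL; congr cL2; apply/funext => t; congr H; ring.
Qed.

Lemma delay_kernelB a F F' H H' : cL2 F -> cL2 F' -> cL2 H -> cL2 H' ->
  (fun v => delay_kernel a pi F H v - delay_kernel a pi F' H' v) =
  (fun v => delay_kernel a pi (fun t => F t - F' t) H v +
            delay_kernel a pi F' (fun t => H t - H' t) v).
Proof.
move=> FL F'L HL H'L; apply/funext => v; rewrite /delay_kernel -mulrBr -mulrDr; congr (_ * _).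
rewrite -cintB; [|exact: cint_delay_product..].
rewrite -cintD; [|exact: (cint_delay_product a v (cL2B FL F'L) HL)|exact: (cint_delay_product a v F'L (cL2B HL H'L))].
by congr cint; apply/funext => t; ring.
Qed.

(** The pointwise Cauchy-Schwarz bound on the kernel is integrated over an interval of length pi. *)
Lemma sqnorm_delay_kernel a F H : 0 < a -> cL2 F -> cL2 H -> cintegrable F -> cintegrable H ->
  sqnorm (delay_kernel a pi F H) <= pi * (sqnorm F * sqnorm H).
Proof.
move=> a0 FL HL Fi Hi; have S0 : 0 <= sqnorm F * sqnorm H by rewrite mulr_ge0 ?sqnorm_ge0.
have KL := delay_kernel_cL2 pi a0 FL HL Fi Hi.
have pL : cL2 (fun v => (\1_(@period R) v : R)%:C).
  by apply: cL2_indic; [exact: measurable_period|rewrite mu_period ltey].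
have -> : pi * (sqnorm F * sqnorm H) =
    sqnorm (fun v => (Num.sqrt (sqnorm F * sqnorm H))%:C * (\1_(@period R) v : R)%:C).
  rewrite (sqnormZ _ pL) [in RHS]normc_real real_normK ?num_real// sqr_sqrtr// mulrC.
  by rewrite sqnorm_indic ?mu_period ?ltey//; exact: measurable_period.
apply: le_sqnorm => //; first exact: cL2Z.
move=> v; rewrite [leRHS]normcM !normc_real (ger0_norm (sqrtr_ge0 _)).
have [pv|npv] := pselect (period v); last first.
  rewrite [X in nc X <= _](_ : _ = 0) ?ComplexField.Normc.normc0 ?mulr_ge0 ?sqrtr_ge0//.
  rewrite /delay_kernel indicE memNset ?mul0r// /= in_itv/= => /andP[h1 h2].
  by apply: npv; rewrite /period/= in_itv/= h2 andbT (lt_le_trans _ h1)// mulr_gt0.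
rewrite indicE mem_set// normr1 mulr1.
move: (delay_kernel_bound a pi v FL HL) (normc_ge0 (delay_kernel a pi F H v)).
move: (nc _) => x xS x0.
by rewrite -(@ler_sqr R) ?nnegrE ?sqrtr_ge0// sqr_sqrtr.
Qed.

(** The function that multiplies the exponential in [delay_representation] at d = pi. *)
Definition delay_data a c P M v : R[i] := P v + c * delay_kernel a pi P M v.

(* For 2 pi / 5 <= a the kernel vanishes off [3a/2, pi - a/2[ and only involves P on
   ]2a, pi[ and M on ]a, pi - a[, where the data coincide with P and M. *)
Lemma delay_kernel_data a c c' P M : 2 * pi / 5 <= a -> a < pi / 2 ->
  supported a pi P -> supported a pi M ->
  delay_kernel a pi (delay_data a c P M) (delay_data a c' M P) = delay_kernel a pi P M.
Proof.
move=> a5 a2 sP sM; have pi0 := pi_gt0 R; have a0 : 0 < a by lra.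
have outP G H d : supported a pi G -> supported a pi H -> forall t, ~ (a < t < pi) ->
    delay_data a d G H t = 0.
  move=> sG sH t nt; rewrite /delay_data sG// add0r delay_kernel_supported ?mulr0//.
  by move=> /andP[h1 h2]; apply: nt; apply/andP; split; lra.
apply/funext => v; rewrite /delay_kernel indicE.
have [|_] := boolP (v \in _); last by rewrite !mul0r.
rewrite inE/= in_itv/= => /andP[v1 v2]; congr (_ * cint _); apply/funext => t.
have [/andP[t1 t2]|nt] := pselect (a < t < pi); last by rewrite outP// sP// !mul0r.
have [/andP[s1 s2]|ns] := pselect (a < a / 2 + t - v < pi); last first.
  by rewrite [X in _ * X]outP// [M _]sM// !mulr0.
(* On these arguments the correction vanishes, twice by 5a >= 2 pi: t > v + a/2 >= 2a >= pi - a/2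
   for the first factor, and a/2 + t - v < pi - a <= 3a/2 for the second. *)
congr (_ * _).
- by rewrite /delay_data delay_kernel_supported ?mulr0 ?addr0// => /andP[h1 h2]; lra.
- by rewrite /delay_data delay_kernel_supported ?mulr0 ?addr0// => /andP[h1 h2]; lra.
Qed.

Lemma cL2_delay_data a c P M : 2 * pi / 5 <= a -> cL2 P -> cL2 M ->
  supported a pi P -> supported a pi M -> cL2 (delay_data a c P M).
Proof.
move=> a5 PL ML sP sM; have pi0 := pi_gt0 R; have a0 : 0 < a by lra.
have Pi := cintegrable_supported PL sP; have Mi := cintegrable_supported ML sM.
by apply: cL2D => //; apply: cL2Z; exact: delay_kernel_cL2.
Qed.

Lemma supported_delay_data a c P M : 0 < a ->
  supported a pi P -> supported a pi M -> supported a pi (delay_data a c P M).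
Proof.
move=> a0 sP sM t nt; rewrite /delay_data sP// add0r.
by rewrite (delay_kernel_supportedW a0 sP sM nt) mulr0.
Qed.

(** By [delay_kernel_data], P is G - c times the kernel of G and H, so the inverse map is explicit.
    Bilinearity splits the difference of kernels into one with G - G' and H and one with G' and H -
    H'; hence just H and G' need to be bounded. *)
Lemma delay_data_stability a c P M P' M' (K : R) : 2 * pi / 5 <= a -> a < pi / 2 ->
  nc c = 1 -> cL2 P -> cL2 M -> cL2 P' -> cL2 M' ->
  supported a pi P -> supported a pi M -> supported a pi P' -> supported a pi M' ->
  sqnorm (delay_data a (- c) M P) <= K -> sqnorm (delay_data a c P' M') <= K ->
  sqnorm (fun v => P v - P' v) <= (2 + 4 * pi * K) *
    (sqnorm (fun v => delay_data a c P M v - delay_data a c P' M' v) +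
     sqnorm (fun v => delay_data a (- c) M P v - delay_data a (- c) M' P' v)).
Proof.
move=> a5 a2 c1 PL ML P'L M'L sP sM sP' sM' GK GK'.
have pi0 := pi_gt0 R; have a0 : 0 < a by move: a5 pi0; clear; lra.
pose G := delay_data a c P M; pose H := delay_data a (- c) M P.
pose G' := delay_data a c P' M'; pose H' := delay_data a (- c) M' P'.
have GL : cL2 G by exact: cL2_delay_data. have HL : cL2 H by exact: cL2_delay_data.
have G'L : cL2 G' by exact: cL2_delay_data. have H'L : cL2 H' by exact: cL2_delay_data.
have sG : supported a pi G by exact: supported_delay_data.
have sH : supported a pi H by exact: supported_delay_data.
have sG' : supported a pi G' by exact: supported_delay_data.
have sH' : supported a pi H' by exact: supported_delay_data.
have dGL := cL2B GL G'L; have dHL := cL2B HL H'L.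
have sdG : supported a pi (fun v => G v - G' v) by move=> v nv; rewrite sG// sG'// subrr.
have sdH : supported a pi (fun v => H v - H' v) by move=> v nv; rewrite sH// sH'// subrr.
pose K1 := delay_kernel a pi (fun t => G t - G' t) H.
pose K2 := delay_kernel a pi G' (fun t => H t - H' t).
have Gi := cintegrable_supported GL sG; have G'i := cintegrable_supported G'L sG'.
have Hi := cintegrable_supported HL sH; have H'i := cintegrable_supported H'L sH'.
have dGi := cintegrable_supported dGL sdG; have dHi := cintegrable_supported dHL sdH.
have K1L : cL2 K1 by exact: delay_kernel_cL2.
have K2L : cL2 K2 by exact: delay_kernel_cL2.
have E : (fun v => P v - P' v) = (fun v => (G v - G' v) + (- c) * (K1 v + K2 v)).
  have KB := delay_kernelB a GL G'L HL H'L.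
  apply/funext => v; have := congr1 (fun f => f v) KB.
  rewrite (delay_kernel_data _ _ a5 a2 sP sM) (delay_kernel_data _ _ a5 a2 sP' sM').
  by rewrite /K1 /K2 => <-; rewrite /G /G' /delay_data; ring.
rewrite E; have K12 := cL2D K1L K2L.
apply: (le_trans (sqnormD dGL (cL2Z (- c) K12))).
rewrite sqnormZ// normcN c1 expr1n mul1r.
have := sqnormD K1L K2L.
have : sqnorm K1 <= pi * (sqnorm (fun v => G v - G' v) * sqnorm H).
  exact: sqnorm_delay_kernel.
have : sqnorm K2 <= pi * (sqnorm G' * sqnorm (fun v => H v - H' v)).
  exact: sqnorm_delay_kernel.
have := sqnorm_ge0 (fun v => G v - G' v); have := sqnorm_ge0 (fun v => H v - H' v).
move: GK GK'; rewrite -/G -/G' -/H -/H'.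
move: (sqnorm H) (sqnorm G') (sqnorm K1) (sqnorm K2) (sqnorm (fun v => K1 v + K2 v)).
move: (sqnorm (fun v => G v - G' v)) (sqnorm (fun v => H v - H' v)).
move: pi0; clear; move: (pi : R) => p p0 x y h g k1 k2 k hK gK y0 x0 k2h k1h kh.
have h4 : p * (x * h) <= p * (x * K) by rewrite !ler_wpM2l// ltW.
have h5 : p * (g * y) <= p * (K * y) by rewrite ler_wpM2l ?(ltW p0)// ler_wpM2r.
lra.
Qed.

End KernelStability.

(** * Combining the two characteristic functions *)

Section Combination.
Context {R : realType}.
Implicit Types (P M F H f g : R -> R[i]) (a v : R) (l sg : R[i]).

Lemma cL2_parallelogram F H : cL2 F -> cL2 H ->
  sqnorm F <= (sqnorm (fun v => F v + H v) + sqnorm (fun v => F v - H v)) / 2 /\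
  sqnorm H <= (sqnorm (fun v => F v + H v) + sqnorm (fun v => F v - H v)) / 2.
Proof.
move=> FL HL; have SL := cL2D FL HL; have DL := cL2B FL HL.
have n2 : nc ((1 / 2)%:C : R[i]) ^+ 2 = 1 / 4.
  by rewrite normc_real real_normK ?num_real//; field.
have E1 : F = (fun v => (1 / 2)%:C * ((F v + H v) + (F v - H v))).
  by apply/funext => v; apply: complex_ext; rewrite ?(cReM, cImM, cReD, cImD, cReN, cImN)/=; field.
have E2 : H = (fun v => (1 / 2)%:C * ((F v + H v) - (F v - H v))).
  by apply/funext => v; apply: complex_ext; rewrite ?(cReM, cImM, cReD, cImD, cReN, cImN)/=; field.
have := sqnormD SL DL; have := sqnormB SL DL.
have -> : sqnorm F = 1 / 4 * sqnorm (fun v => (F v + H v) + (F v - H v)).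
  by rewrite [in LHS]E1 (sqnormZ _ (cL2D SL DL)) n2.
have -> : sqnorm H = 1 / 4 * sqnorm (fun v => (F v + H v) - (F v - H v)).
  by rewrite [in LHS]E2 (sqnormZ _ (cL2B SL DL)) n2.
clear; move: (sqnorm _) (sqnorm _) (sqnorm _) (sqnorm _) => *; split; lra.
Qed.

(** The representation of w- carries the exponential with - i l; the reflection v -> pi + a - v
    turns it into the one of w+, so that both data stand under a single exponential. *)
Definition data_comb a sg P M v : R[i] :=
  delay_data a (- 'i) P M v + sg * delay_data a 'i M P (pi + a - v).

Lemma delay_exp_reflect a w v : delay_exp a pi (- w) (pi + a - v) = delay_exp a pi w v :> R[i].
Proof.
rewrite /delay_exp mulNr -mulrN -real_complexN; congr (cexp (_ * _%:C)); ring.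
Qed.

Lemma char_integral_solution a l sg P M f g : 2 * pi / 5 <= a -> a < pi / 2 ->
  cL2 P -> cL2 M -> supported a pi P -> supported a pi M ->
  abs_continuous 0 pi f -> abs_continuous 0 pi g ->
  delay_equation a pi ('i * l) (- 'i) P f g -> delay_equation a pi (- ('i * l)) 'i M g f ->
  f 0 = 'i -> g 0 = - 'i ->
  f pi + sg * g pi = char_integral a sg (data_comb a sg P M) l.
Proof.
move=> a5 a2 PL ML sP sM acf acg df dg f0 g0.
have pi0 := pi_gt0 R; have a0 : 0 < a by move: a5 pi0; clear; lra.
have api : a <= pi by move: a2 pi0; clear; lra.
have pi3a : pi <= 3 * a by move: a5 pi0; clear; lra.
have Pi := cintegrable_supported PL sP; have Mi := cintegrable_supported ML sM.
have ii : ('i : R[i]) * 'i = -1 by apply: complex_ext; rewrite ?(cReM, cImM)/=; ring.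
have nii : (- 'i : R[i]) * - 'i = -1 by rewrite mulrNN.
have df' : delay_equation a pi (- - ('i * l)) (- 'i) P f g by rewrite opprK.
have dg' : delay_equation a pi (- ('i * l)) (- - 'i) M g f by rewrite opprK.
have f0' : f 0 = - - 'i by rewrite opprK.
rewrite (delay_representation a0 api pi3a nii PL ML Pi Mi sP sM acf acg df dg' f0' g0).
rewrite (delay_representation a0 api pi3a ii ML PL Mi Pi sM sP acg acf dg df' g0 f0).
have GL : cL2 (delay_data a (- 'i) P M) by exact: cL2_delay_data.
have HL : cL2 (delay_data a 'i M P) by exact: cL2_delay_data.
have sG : supported a pi (delay_data a (- 'i) P M) by exact: supported_delay_data.
have sH : supported a pi (delay_data a 'i M P) by exact: supported_delay_data.
have eG := cintegrable_delay_exp ('i * l) (ltW a0) (cintegrable_supported GL sG) sG.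
have eH := cintegrable_delay_exp (- ('i * l)) (ltW a0) (cintegrable_supported HL sH) sH.
have reH := cintegrable_reflect (pi + a) eH.
have := cint_reflect (pi + a) (cintegrable_measurable eH).
rewrite /char_integral /data_comb.
have -> : (fun v => delay_exp a pi ('i * l) v *
     (delay_data a (- 'i) P M v + sg * delay_data a 'i M P (pi + a - v))) =
   (fun v => delay_exp a pi ('i * l) v * delay_data a (- 'i) P M v +
     sg * (delay_exp a pi (- ('i * l)) (pi + a - v) * delay_data a 'i M P (pi + a - v))).
  by apply/funext => v; rewrite delay_exp_reflect mulrDr [in LHS]mulrCA.
rewrite (cintD eG (cintegrableZ sg reH)) (cintZ sg reH) => ->.
rewrite /delay_data real_complexN mulrN -mulNr opprK.
move: (cint _) (cint _) (cexp _) (cexp _) => I J x y; ring.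
Qed.

Lemma cL2_data_comb a sg P M : 2 * pi / 5 <= a -> cL2 P -> cL2 M ->
  supported a pi P -> supported a pi M -> cL2 (data_comb a sg P M).
Proof.
move=> a5 PL ML sP sM; have GL := cL2_delay_data (- 'i) a5 PL ML sP sM.
have HL := cL2_delay_data 'i a5 ML PL sM sP.
exact: (cL2D GL (cL2Z sg (cL2_reflect (pi + a) HL))).
Qed.

Lemma supported_data_comb a sg P M : 0 < a ->
  supported a pi P -> supported a pi M -> supported a pi (data_comb a sg P M).
Proof.
move=> a0 sP sM v nv; have sG := supported_delay_data (- 'i) a0 sP sM.
have sH := supported_delay_data 'i a0 sM sP.
rewrite /data_comb sG// sH ?mulr0 ?addr0// => /andP[h1 h2]; apply: nv.
by apply/andP; split; move: h1 h2; clear; lra.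
Qed.

Lemma sqnorm_halves F H (B1 B2 : R) : cL2 F -> cL2 H ->
  sqnorm (fun v => F v + 1 * H v) <= B1 -> sqnorm (fun v => F v + -1 * H v) <= B2 ->
  sqnorm F <= (B1 + B2) / 2 /\ sqnorm H <= (B1 + B2) / 2.
Proof.
move=> FL HL; under [X in sqnorm X]eq_fun do rewrite mul1r.
under [X in _ -> sqnorm X <= _ -> _]eq_fun do rewrite mulN1r.
have [] := cL2_parallelogram FL HL.
clear; move: (sqnorm _) (sqnorm _) (sqnorm _) (sqnorm _) => *; split; lra.
Qed.

(** The parallelogram identity recovers the two data from their sum and difference, and the
    reflection of the second one is an isometry. Bounds and differences are transferred this way
    before the kernel is inverted. *)
Lemma data_comb_stability a P M P' M' (B E1 E2 : R) : 2 * pi / 5 <= a -> a < pi / 2 ->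
  cL2 P -> cL2 M -> cL2 P' -> cL2 M' ->
  supported a pi P -> supported a pi M -> supported a pi P' -> supported a pi M' ->
  sqnorm (data_comb a 1 P M) <= B -> sqnorm (data_comb a (-1) P M) <= B ->
  sqnorm (data_comb a 1 P' M') <= B -> sqnorm (data_comb a (-1) P' M') <= B ->
  sqnorm (fun v => data_comb a 1 P M v - data_comb a 1 P' M' v) <= E1 ->
  sqnorm (fun v => data_comb a (-1) P M v - data_comb a (-1) P' M' v) <= E2 ->
  sqnorm (fun v => P v - P' v) <= (2 + 4 * pi * B) * (E1 + E2) /\
  sqnorm (fun v => M v - M' v) <= (2 + 4 * pi * B) * (E1 + E2).
Proof.
move=> a5 a2 PL ML P'L M'L sP sM sP' sM' b1 b2 b1' b2' e1 e2.
have GL := cL2_delay_data (- 'i) a5 PL ML sP sM.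
have HL := cL2_delay_data 'i a5 ML PL sM sP.
have G'L := cL2_delay_data (- 'i) a5 P'L M'L sP' sM'.
have H'L := cL2_delay_data 'i a5 M'L P'L sM' sP'.
have rHL := cL2_reflect (pi + a) HL; have rH'L := cL2_reflect (pi + a) H'L.
have [gB hB] := sqnorm_halves GL rHL b1 b2.
have [g'B h'B] := sqnorm_halves G'L rH'L b1' b2'.
have dGL := cL2B GL G'L; have dHL := cL2B HL H'L.
have drHL := cL2_reflect (pi + a) dHL.
have e1' : sqnorm (fun v => (delay_data a (- 'i) P M v - delay_data a (- 'i) P' M' v) +
    1 * (delay_data a 'i M P (pi + a - v) - delay_data a 'i M' P' (pi + a - v))) <= E1.
  apply: le_trans e1; rewrite le_eqVlt; apply/orP; left; apply/eqP; congr sqnorm.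
  by apply/funext => v; rewrite /data_comb; ring.
have e2' : sqnorm (fun v => (delay_data a (- 'i) P M v - delay_data a (- 'i) P' M' v) +
    -1 * (delay_data a 'i M P (pi + a - v) - delay_data a 'i M' P' (pi + a - v))) <= E2.
  apply: le_trans e2; rewrite le_eqVlt; apply/orP; left; apply/eqP; congr sqnorm.
  by apply/funext => v; rewrite /data_comb; ring.
have [dgE dhE] := sqnorm_halves dGL drHL e1' e2'.
rewrite (sqnorm_reflect _ HL) in hB; rewrite (sqnorm_reflect _ H'L) in h'B.
rewrite (sqnorm_reflect _ dHL) in dhE.
have B2 : (B + B) / 2 = B by clear; lra.
rewrite B2 in gB hB g'B h'B.
have ni : nc ('i : R[i]) = 1 by exact: normc_i.
have nni : nc (- 'i : R[i]) = 1 by rewrite normcN.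
have B0 : 0 <= 2 + 4 * pi * B.
  have := le_trans (sqnorm_ge0 _) gB; have := pi_ge0 R; clear.
  by move=> p0 b0; rewrite addr_ge0// !mulr_ge0.
have hH : sqnorm (delay_data a (- - 'i) M P) <= B by rewrite opprK; exact: hB.
have S1 := delay_data_stability a5 a2 nni PL ML P'L M'L sP sM sP' sM' hH g'B.
have S2 := delay_data_stability a5 a2 ni ML PL M'L P'L sM sP sM' sP' gB h'B.
split.
- apply: (le_trans S1); rewrite opprK; apply: ler_wpM2l => //.
  by move: dgE dhE; clear; move: (sqnorm _) (sqnorm _) => *; lra.
- apply: (le_trans S2); apply: ler_wpM2l => //.
  by move: dgE dhE; clear; move: (sqnorm _) (sqnorm _) => *; lra.
Qed.

(* The sign sg = 1 belongs to the condition y_1(pi) = 0 and sg = -1 to y_2(pi) = 0. *)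
Definition zeros a s sg P M (k : int -> R[i]) :=
  forall n, char_integral a sg (data_comb a sg P M) ((n%:~R - s)%:C + k n) = 0.

Definition stability_const : R := (2 + 4 * pi * W_bound) * W_lipschitz.

Lemma spectral_stability a P M P' M' (s1 s2 : R) (k1 k2 k1' k2' : int -> R[i]) (S1 S2 : R) :
  2 * pi / 5 <= a -> a < pi / 2 -> cL2 P -> cL2 M -> cL2 P' -> cL2 M' ->
  supported a pi P -> supported a pi M -> supported a pi P' -> supported a pi M' ->
  nodes s1 1 -> nodes s2 (-1) ->
  small_l2 k1 (1 / 4) -> small_l2 k2 (1 / 4) -> small_l2 k1' (1 / 4) -> small_l2 k2' (1 / 4) ->
  zeros a s1 1 P M k1 -> zeros a s2 (-1) P M k2 ->
  zeros a s1 1 P' M' k1' -> zeros a s2 (-1) P' M' k2' ->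
  small_l2 (fun n => k1 n - k1' n) S1 -> small_l2 (fun n => k2 n - k2' n) S2 ->
  sqnorm (fun v => P v - P' v) <= stability_const * (S1 + S2) /\
  sqnorm (fun v => M v - M' v) <= stability_const * (S1 + S2).
Proof.
move=> a5 a2 PL ML P'L M'L sP sM sP' sM' n1 n2 h1 h2 h1' h2' z1 z2 z1' z2' d1 d2.
have pi0 := pi_gt0 R; have a0 : 0 < a by move: a5 pi0; clear; lra.
have api : a < pi by move: a2 pi0; clear; lra.
have WL sg := cL2_data_comb sg a5 PL ML sP sM.
have W'L sg := cL2_data_comb sg a5 P'L M'L sP' sM'.
have sW sg := supported_data_comb sg a0 sP sM.
have sW' sg := supported_data_comb sg a0 sP' sM'.
have b1 := zeros_bound a5 api (WL 1) (sW 1) n1 h1 z1.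
have b2 := zeros_bound a5 api (WL (-1)) (sW (-1)) n2 h2 z2.
have b1' := zeros_bound a5 api (W'L 1) (sW' 1) n1 h1' z1'.
have b2' := zeros_bound a5 api (W'L (-1)) (sW' (-1)) n2 h2' z2'.
have e1 := zeros_stability a5 api (WL 1) (sW 1) (W'L 1) (sW' 1) n1 h1 h1' z1 z1' d1.
have e2 := zeros_stability a5 api (WL (-1)) (sW (-1)) (W'L (-1)) (sW' (-1)) n2 h2 h2' z2 z2' d2.
have -> : stability_const * (S1 + S2) =
    (2 + 4 * pi * W_bound) * (W_lipschitz * S1 + W_lipschitz * S2).
  by rewrite /stability_const; clear; move: W_bound W_lipschitz => x y; ring.
exact: (data_comb_stability a5 a2 PL ML P'L M'L sP sM sP' sM' b1 b2 b1' b2' e1 e2).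
Qed.

End Combination.

(** * Nodes, sequence norms and cut-off functions *)

Section Norms.
Context {R : realType}.
Implicit Types (f q p : R -> R[i]) (u : int -> R[i]) (D : set R) (a s : R) (sg : R[i]).

(** The quotient of the two exponentials is e^(2 pi i (n - s)) = e^(-2 pi i s), the same for all
    n. *)
Lemma nodes_cexp s sg : nc sg = 1 -> cexp (- (2 * s * pi))*i = sg -> nodes s sg.
Proof.
move=> sg1 sgE; split=> // n.
have -> : 'i * (n%:~R - s)%:C * pi%:C =
    (2 * n%:~R * pi)*i + (- (2 * s * pi))*i + 'i * (n%:~R - s)%:C * (- pi)%:C :> R[i].
  by apply: complex_ext; rewrite ?(cReM, cImM, cReD, cImD)/=; ring.
by rewrite !cexpD cexp_2pi sgE mul1r.
Qed.

Lemma nodes_dirichlet : nodes (0%:R / 2) (1 : R[i]).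
Proof.
apply: nodes_cexp; first exact: ComplexField.Normc.normc1.
by apply: complex_ext; rewrite /cexp/= expR0 mul0r mulr0 mul0r oppr0 ?cos0 ?sin0 ?mulr1 ?mulr0//.
Qed.

Lemma nodes_mixed : nodes (1%:R / 2) (-1 : R[i]).
Proof.
apply: nodes_cexp; first by rewrite normcN; exact: ComplexField.Normc.normc1.
have -> : 2 * (1%:R / 2) * pi = pi :> R by field.
apply: complex_ext; rewrite /cexp/= expR0 ?cosN ?sinN ?cospi ?sinpi ?mul1r ?mulr0 ?oppr0//.
Qed.

Lemma small_l2_esum u (S : R) :
  (\esum_(n in [set: int]) (nc (u n) ^+ 2)%:E <= S%:E)%E -> small_l2 u S.
Proof.
move=> uS r ur; rewrite -lee_fin; apply: le_trans uS; apply: esum_ge.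
exists [set` r]; first by split=> //; exact: finite_seq.
by rewrite -sumEFin -fsbig_seq.
Qed.

Lemma l2normE u : (l2norm u < +oo)%E ->
  exists2 s : R, 0 <= s & l2norm u = s%:E /\ small_l2 u (s ^+ 2).
Proof.
rewrite /l2norm; set S := esum _ _ => Sfin.
have S0 : (0 <= S)%E by apply: esum_ge0 => n _; rewrite lee_fin sqr_ge0.
have [x xE] : exists x : R, S = x%:E.
  by move: S0 Sfin; case: S => [x _ _|_|//]; [exists x|rewrite poweRyr].
have x0 : 0 <= x by rewrite -lee_fin -xE.
exists (Num.sqrt x); first exact: sqrtr_ge0.
split; first by rewrite xE poweR_EFin powR12_sqrt.
by apply: small_l2_esum; rewrite sqr_sqrtr// -xE.
Qed.

(** Here r < 1/2 becomes r^2 < 1/4, the smallness that [sampling] demands. *)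
Lemma l2norm_small u (r : R) : 0 < r < 2^-1 -> (l2norm u <= r%:E)%E -> small_l2 u (1 / 4).
Proof.
move=> /andP[r0 r2] ur; have [|s s0 [us Hs]] := @l2normE u; first exact: le_lt_trans ur (ltry _).
move=> l ul; apply: (le_trans (Hs l ul)).
by move: ur; rewrite us lee_fin => sr; nra.
Qed.

Definition cutoff D f x : R[i] := (\1_D x : R)%:C * f x.

Lemma L2normE D f : L2norm D f = ((\int[mu]_x (nc (cutoff D f x) ^+ 2)%:E) `^ 2^-1)%E.
Proof.
rewrite /L2norm unlock /=; congr (_ `^ _)%E; apply: eq_integral => x _.
rewrite patchE /cutoff indicE; case: ifPn => xD.
  by rewrite mul1r gee0_abs ?lee_fin ?normc_ge0// poweR_EFin powR_mulrn ?normc_ge0.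
by rewrite mul0r abse0 poweR0r ?pnatr_eq0// ComplexField.Normc.normc0 expr0n.
Qed.

Lemma inL2_cutoff D f : measurable D -> inL2 D f -> cL2 (cutoff D f).
Proof.
move=> mD [mRe mIm fin].
have mf : cmeasurable (cutoff D f).
  split.
    have := (measurable_restrictT _ mD).1 mRe; congr measurable_fun.
    by apply/funext => x; rewrite patchE cReM/= indicE; case: ifPn; rewrite !(mul0r, mul1r, subr0).
  have := (measurable_restrictT _ mD).1 mIm; congr measurable_fun.
  by apply/funext => x; rewrite patchE cImM/= indicE; case: ifPn; rewrite !(mul0r, mul1r, addr0).
split=> //; apply/integrableP; split.
  by apply/measurable_EFinP; exact: measurable_normc_sqr.
under eq_integral do rewrite gee0_abs ?lee_fin ?sqr_ge0//.
rewrite ltey; apply/eqP => E; move: fin; rewrite L2normE E poweRyr//.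
Qed.

Lemma L2norm_sqnorm D f : cL2 (cutoff D f) ->
  L2norm D f = (Num.sqrt (sqnorm (cutoff D f)))%:E.
Proof.
move=> [_ /integrable_fin_num fi]; rewrite L2normE -powR12_sqrt ?sqnorm_ge0//.
by rewrite -poweR_EFin /sqnorm /Rintegral fineK// fi.
Qed.

End Norms.

(** * The Dirac system *)

Section Solutions.
Context {R : realType}.
Implicit Types (f g q p : R -> R[i]) (D : set R) (a x c d : R) (l k : R[i]).

Lemma imaginaryE : 'i%C = 'i%R :> R[i].
Proof. by []. Qed.

Lemma cL2_cutoff_sub D D' f : measurable D -> D `<=` D' -> cL2 (cutoff D' f) -> cL2 (cutoff D f).
Proof.
move=> mD DD' fL; have -> : cutoff D f = fun x => (\1_D x : R)%:C * cutoff D' f x.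
  apply/funext => x; rewrite /cutoff !indicE.
  case: (boolP (x \in D)) => [|_]; last by rewrite !mul0r.
  by rewrite inE => /DD' Dx; rewrite mem_set// !mul1r.
apply: (cL2_mulr (b := 1)) => //; first exact: cmeasurable_indic.
by move=> x _; exact: normc_indic_le1.
Qed.

Lemma abs_continuousDZ c d f g k : nc k = 1 -> abs_continuous c d f ->
  abs_continuous c d g -> abs_continuous c d (fun x => f x + k * g x).
Proof.
move=> k1 acf acg e e0; have e20 : 0 < e / 2 by rewrite divr_gt0.
have [d1 d10 H1] := acf _ e20; have [d2 d20 H2] := acg _ e20.
exists (Num.min d1 d2); first by rewrite lt_min d10.
move=> n s t st ord; rewrite lt_min => /andP[l1 l2].
have {}H1 := H1 n s t st ord l1; have {}H2 := H2 n s t st ord l2.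
have -> : e = e / 2 + e / 2 by field.
apply: le_lt_trans (ltrD H1 H2); rewrite -big_split/=; apply: ler_sum => i _.
have -> : f (t i) + k * g (t i) - (f (s i) + k * g (s i)) =
  (f (t i) - f (s i)) + k * (g (t i) - g (s i)) by ring.
by apply: (le_trans (le_normcD _ _)); rewrite normcM k1 mul1r.
Qed.

Lemma is_cderiveDZ x f g df dg k : is_cderive x f df -> is_cderive x g dg ->
  is_cderive x (fun t => f t + k * g t) (df + k * dg).
Proof.
move=> [f1 f2] [g1 g2]; split.
- rewrite (_ : (fun t => _) =
    (fun t => Re (f t) + (Re k * Re (g t) - Im k * Im (g t)))); last first.
    by apply/funext => t; rewrite cReD cReM.
  apply: is_derive_eq; rewrite cReD cReM.
  by rewrite /GRing.scale/=; ring.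
- rewrite (_ : (fun t => _) =
    (fun t => Im (f t) + (Re k * Im (g t) + Im k * Re (g t)))); last first.
    by apply/funext => t; rewrite cImD cImM.
  apply: is_derive_eq; rewrite cImD cImM.
  by rewrite /GRing.scale/=; ring.
Qed.

(** With [minus_potential], these are P and M of the diagonalised system, cut off so that they
    vanish everywhere outside []a, pi[]. *)
Definition plus_potential a q p := cutoff `]a, pi[ (fun x => q x + 'i * p x).
Definition minus_potential a q p := cutoff `]a, pi[ (fun x => q x - 'i * p x).

(** The second column of the matrix equation, solved for the derivatives. The indicator may be
    inserted because Q vanishes almost everywhere on []0, a[]; the point a, excluded from both
    intervals, is a null set. *)
Lemma fundamental_equations a q p l (Y : R -> 'M[R[i]]_2) :
  potential a q p -> fundamental_matrix a q p l Y ->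
  {ae mu, forall x : R, x \in `]0, pi[ ->
    is_cderive x (fun t => Y t 0 1) (- l * Y x 1 1 +
      (\1_(`]a, pi[%classic) x : R)%:C * (p x * Y (x - a) 0 1 - q x * Y (x - a) 1 1)) /\
    is_cderive x (fun t => Y t 1 1) (l * Y x 0 1 -
      (\1_(`]a, pi[%classic) x : R)%:C * (q x * Y (x - a) 0 1 + p x * Y (x - a) 1 1))}.
Proof.
move=> [_ _ Q0] [_ _ HY].
have na : {ae mu, forall x : R, x != a}.
  exists [set a]; split; first exact: measurable_set1.
    by rewrite lebesgue_measure_set1.
  by move=> x /= /negP; rewrite negbK => /eqP.
pose F := ae_filter_ringOfSetsType (@lebesgue_measure R).
have HQY := @filterS2 _ _ F _ _ _ (fun x hx hy => conj hx hy) Q0 HY.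
apply: (@filterS2 _ _ F _ _ _ _ na HQY) => x xa [qx yx] x0pi.
have [dY dYd E] := yx x0pi.
have i0 : ord0 = 0 :> 'I_2 by [].
have i1 : lift ord0 ord0 = 1 :> 'I_2 by apply/val_inj.
have E0 : dY 1 1 + (q x * Y (x - a) 0 1 + p x * Y (x - a) 1 1) = l * Y x 0 1.
  have := congr1 (fun A : 'M[R[i]]_(2, 2) => A 0 1) E.
  rewrite !mxE !big_ord_recl !big_ord0 !mxE/= i1 i0 => <-; ring.
have E1 : - dY 0 1 + (p x * Y (x - a) 0 1 - q x * Y (x - a) 1 1) = l * Y x 1 1.
  have := congr1 (fun A : 'M[R[i]]_(2, 2) => A 1 1) E.
  rewrite !mxE !big_ord_recl !big_ord0 !mxE/= i1 i0 => <-; ring.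
have qp0 : x < a -> q x = 0 /\ p x = 0.
  move=> xlt; have /qx E' : x \in `]0, a[ by move: x0pi; rewrite !in_itv/= xlt => /andP[->].
  have := congr1 (fun A : 'M[R[i]]_(2, 2) => A 0 0) E'.
  have := congr1 (fun A : 'M[R[i]]_(2, 2) => A 0 1) E'.
  by rewrite !mxE.
have cutE (z : R[i]) : (q x = 0 /\ p x = 0 -> z = 0) -> (\1_(`]a, pi[%classic) x : R)%:C * z = z.
  move=> z0; have [xlt|xgt|xE] := ltgtP x a; last by rewrite xE eqxx in xa.
    by rewrite z0 ?mulr0//; exact: qp0.
  by rewrite indic_in ?mul1r//= in_itv/= xgt; move: x0pi; rewrite in_itv/= => /andP[].
split.
- rewrite cutE; last by move=> [-> ->]; rewrite !mul0r subr0.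
  by have := dYd 0 1; congr is_cderive; rewrite mulNr -E1; ring.
- rewrite cutE; last by move=> [-> ->]; rewrite !mul0r addr0.
  by have := dYd 1 1; congr is_cderive; rewrite -E0; ring.
Qed.

Lemma fundamental_delay_equation a q p l (Y : R -> 'M[R[i]]_2) :
  potential a q p -> fundamental_matrix a q p l Y ->
  delay_equation a pi ('i * l) (- 'i) (plus_potential a q p)
    (fun t => Y t 0 1 + 'i * Y t 1 1) (fun t => Y t 0 1 + - 'i * Y t 1 1) /\
  delay_equation a pi (- ('i * l)) 'i (minus_potential a q p)
    (fun t => Y t 0 1 + - 'i * Y t 1 1) (fun t => Y t 0 1 + 'i * Y t 1 1).
Proof.
move=> pot FY; have H := fundamental_equations pot FY.
have ii : 1 + 'i * 'i = 0 :> R[i].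
  by apply: complex_ext; rewrite ?(cReD, cImD, cReM, cImM)/=; ring.
pose F := ae_filter_ringOfSetsType (@lebesgue_measure R).
split; apply: (@filterS _ _ F _ _ _ H) => x /[apply] -[h0 h1].
- have := is_cderiveDZ 'i h0 h1; congr is_cderive; rewrite /plus_potential /cutoff.
  move: (_%:C) (Y (x - a) 0 1) (Y (x - a) 1 1) (Y x 0 1) (Y x 1 1) => e u v y0 y1.
  apply/eqP; rewrite imaginaryE -subr_eq0; apply/eqP.
  (* The two sides agree modulo 1 + i * i; the cofactor is written out so that [ring] can treat i as
     an indeterminate. *)
  transitivity ((1 + 'i * 'i) * (- l * y1 + e * (p x * u - q x * v - 'i * (p x * v)))).
    by ring.
  by rewrite ii mul0r.
- have := is_cderiveDZ (- 'i) h0 h1; congr is_cderive; rewrite /minus_potential /cutoff.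
  move: (_%:C) (Y (x - a) 0 1) (Y (x - a) 1 1) (Y x 0 1) (Y x 1 1) => e u v y0 y1.
  apply/eqP; rewrite imaginaryE -subr_eq0; apply/eqP.
  transitivity ((1 + 'i * 'i) * (- l * y1 + e * (p x * u - q x * v + 'i * (p x * v)))).
    by ring.
  by rewrite ii mul0r.
Qed.

Lemma supported_cutoff a f : supported a pi (cutoff `]a, pi[ f).
Proof.
by move=> x nx; rewrite /cutoff indicE memNset ?mul0r//= in_itv.
Qed.

Lemma potential_cL2 a q p : 0 < a -> potential a q p ->
  [/\ cL2 (cutoff `]a, pi[ q), cL2 (cutoff `]a, pi[ p),
      cL2 (plus_potential a q p) & cL2 (minus_potential a q p)].
Proof.
move=> a0 [Lq Lp _]; have m f : inL2 `]0, pi[ f -> cL2 (cutoff `]a, pi[ f).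
  move=> /(inL2_cutoff (measurable_itv _)); apply: cL2_cutoff_sub => //.
  by move=> x /=; rewrite !in_itv/= => /andP[h1 ->]; rewrite (lt_trans a0 h1).
have q2 := m _ Lq; have p2 := m _ Lp; split => //.
- have := cL2D q2 (cL2Z 'i p2); congr cL2; apply/funext => x; rewrite /plus_potential /cutoff imaginaryE; ring.
- have := cL2B q2 (cL2Z 'i p2); congr cL2; apply/funext => x; rewrite /minus_potential /cutoff imaginaryE; ring.
Qed.

(** The right side is w+ + sg w- at pi: it equals 2 y_1(pi) for sg = 1 and 2 i y_2(pi) for sg =
    -1. *)
Lemma fundamental_char_integral a q p l sg (Y : R -> 'M[R[i]]_2) :
  2 * pi / 5 <= a -> a < pi / 2 -> potential a q p -> fundamental_matrix a q p l Y ->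
  char_integral a sg (data_comb a sg (plus_potential a q p) (minus_potential a q p)) l =
  (1 + sg) * Y pi 0 1 + 'i * (1 - sg) * Y pi 1 1.
Proof.
move=> a5 a2 pot FY; have a0 : 0 < a by have := pi_gt0 R; move: a5; clear; lra.
have [dP dM] := fundamental_delay_equation pot FY; have [Y0 ac _] := FY.
have [_ _ PL ML] := potential_cL2 a0 pot.
have ni : nc 'i = 1 :> R by exact: normc_i.
have nni : nc (- 'i) = 1 :> R by rewrite normcN.
rewrite -(char_integral_solution sg a5 a2 PL ML (supported_cutoff _) (supported_cutoff _)
  (abs_continuousDZ ni (ac 0 1) (ac 1 1)) (abs_continuousDZ nni (ac 0 1) (ac 1 1)) dP dM).
- by rewrite ?imaginaryE; ring.
- by rewrite Y0 !mxE/= mulr1 add0r.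
- by rewrite Y0 !mxE/= mulr1 add0r.
Qed.

Lemma spectrum_zeros a q p (j : 'I_2) (lam : int -> R[i]) (sg : R[i]) :
  sg = (-1) ^+ j ->
  2 * pi / 5 <= a -> a < pi / 2 -> potential a q p -> is_spectrum a q p 0 j lam ->
  zeros a (j%:R / 2) sg (plus_potential a q p) (minus_potential a q p)
    (fun n => lam n - n%:~R + j%:R / 2).
Proof.
move=> sgE a5 a2 pot [Y [FY HY _]] n.
have -> : (n%:~R - j%:R / 2)%:C + (lam n - n%:~R + j%:R / 2) = lam n :> R[i].
  rewrite real_complexB (_ : (j%:R / 2)%:C = j%:R / 2 :> R[i]); last first.
    by rewrite rmorphM/= fmorphV/= !rmorph_nat.
  by rewrite rmorph_int; ring.
(* The index n itself lies in the fibre over [lam n], so the multiplicity m is positive and the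
   derivative of order 0 vanishes there. *)
have [m mE [zm _]] := HY (lam n).
have m0 : (0 < m)%N.
  rewrite lt0n; apply/eqP => m0; move: mE; rewrite m0 II0 card_eq0 => /eqP E.
  by have : [set k | lam k = lam n] n by []; rewrite E.
have := zm 0%N m0; rewrite derive1n0 /char_fun => Y0.
rewrite (fundamental_char_integral _ a5 a2 pot (FY _)).
have r1 : rev_ord 0 = 1 :> 'I_2 by apply/val_inj.
move: Y0; rewrite r1 sgE; clear; case: j => -[|[|//]] j2 /=.
- rewrite (_ : Ordinal j2 = 0); last exact/val_inj.
  by move=> ->; rewrite expr0 subrr !mulr0 mul0r addr0.
- rewrite (_ : Ordinal j2 = 1); last exact/val_inj.
  by move=> ->; rewrite expr1 subrr mulr0 mul0r addr0.
Qed.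

End Solutions.

(** * The stability estimate for the two spectra *)

Lemma stability_const_ge0 (R : realType) : 0 <= @stability_const R.
Proof.
have W0 : 0 <= @W_bound R by rewrite mulr_ge0// sqr_ge0.
have Wl0 : 0 <= @W_lipschitz R.
  rewrite mulr_ge0// mulr_ge0 ?sqr_ge0// addr_ge0// mulr_ge0// mulr_ge0 ?pi_ge0//.
by rewrite mulr_ge0// addr_ge0// mulr_ge0// mulr_ge0 ?pi_ge0.
Qed.

(** The differences of q and of i p are half the sum and half the difference of those of P and M, so
    both squared norms are at most (X + X) / 2. *)
Lemma potential_difference (R : realType) (a : R) (q p qt pt : R -> R[i]) (X : R) : 0 < a ->
  potential a q p -> potential a qt pt ->
  sqnorm (fun v => plus_potential a q p v - plus_potential a qt pt v) <= X ->
  sqnorm (fun v => minus_potential a q p v - minus_potential a qt pt v) <= X ->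
  (L2norm `]a, pi[ (fun x => q x - qt x)%R <= (Num.sqrt X)%:E)%E /\
  (L2norm `]a, pi[ (fun x => p x - pt x)%R <= (Num.sqrt X)%:E)%E.
Proof.
move=> a0 pot pot' PX MX.
have [qL pL _ _] := potential_cL2 a0 pot; have [qL' pL' _ _] := potential_cL2 a0 pot'.
have E f g : cutoff `]a, pi[ (fun x => f x - g x) =
    (fun v => cutoff `]a, pi[ f v - cutoff `]a, pi[ g v) :> (R -> R[i]).
  by apply/funext => v; rewrite /cutoff; ring.
have FL : cL2 (cutoff `]a, pi[ (fun x => q x - qt x)) by rewrite E; exact: cL2B.
have HL : cL2 (cutoff `]a, pi[ (fun x => p x - pt x)) by rewrite E; exact: cL2B.
rewrite !L2norm_sqnorm// !lee_fin.
have [] := cL2_parallelogram FL (cL2Z 'i HL).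
have -> : (fun v => cutoff `]a, pi[ (fun x => q x - qt x) v +
    'i * cutoff `]a, pi[ (fun x => p x - pt x) v) =
    (fun v => plus_potential a q p v - plus_potential a qt pt v).
  by apply/funext => v; rewrite /plus_potential /cutoff ?imaginaryE; ring.
have -> : (fun v => cutoff `]a, pi[ (fun x => q x - qt x) v -
    'i * cutoff `]a, pi[ (fun x => p x - pt x) v) =
    (fun v => minus_potential a q p v - minus_potential a qt pt v).
  by apply/funext => v; rewrite /minus_potential /cutoff ?imaginaryE; ring.
rewrite (sqnormZ _ HL) normc_i expr1n mul1r => h1 h2.
by split; apply: ler_wsqrtr; move: PX MX h1 h2; clear; move: (sqnorm _) (sqnorm _) => *; lra.
Qed.

Theorem theorem5p1 (R : realType) (r : R) (hr : 0 < r < 2^-1) :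
  exists2 C : R, 0 < C &
    forall (a : R) (q p qt pt : R -> R[i]) (lam lamt : 'I_2 -> int -> R[i]),
      2 * pi / 5 <= a < pi / 2 ->
      potential a q p ->
      potential a qt pt ->
      (forall j : 'I_2, is_spectrum a q p 0 j (lam j)) ->
      (forall j : 'I_2, is_spectrum a qt pt 0 j (lamt j)) ->
      (forall j : 'I_2,
        (l2norm (fun n => lam j n - n%:~R + j%:R / 2)%R <= r%:E)%E) ->
      (forall j : 'I_2,
        (l2norm (fun n => lamt j n - n%:~R + j%:R / 2)%R <= r%:E)%E) ->
      (L2norm `]a, pi[ (fun x => q x - qt x)%R
         + L2norm `]a, pi[ (fun x => p x - pt x)%R
       <= C%:E * (l2norm (fun n => lam 0 n - lamt 0 n)%R
                  + l2norm (fun n => lam 1 n - lamt 1 n)%R))%E.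
Proof.
have K0 := stability_const_ge0 R; have s0 := sqrtr_ge0 (@stability_const R).
(* The 2 accounts for the two norms on the left, each at most the square root of [stability_const]
   times t0 + t1; the 1 makes the constant positive in any case. *)
have C0 : 0 < 2 * Num.sqrt (@stability_const R) + 1 by rewrite ltr_wpDl// mulr_ge0.
exists (2 * Num.sqrt (@stability_const R) + 1) => //.
move=> a q p qt pt lam lamt /andP[a5 a2] pot pott spec spect small smallt.
have a0 : 0 < a by move: (pi_gt0 R) a5; clear; lra.
have l0 (u : int -> R[i]) : (0 <= l2norm u)%E by exact: poweR_ge0.
(* With an infinite norm on the right the bound is trivial, since a positive multiple of [+oo] is
   [+oo]. *)
have [d0|] := ltP (l2norm (fun n => lam 0 n - lamt 0 n)) +oo%E; last first.
  rewrite leye_eq => /eqP ->; rewrite addye ?gt0_muley ?lte_fin ?leey//.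
  by rewrite -ltNye (lt_le_trans _ (l0 _)).
have [d1|] := ltP (l2norm (fun n => lam 1 n - lamt 1 n)) +oo%E; last first.
  rewrite leye_eq => /eqP ->; rewrite addey ?gt0_muley ?lte_fin ?leey//.
  by rewrite -ltNye (lt_le_trans _ (l0 _)).
have [t0 t00 [-> S0]] := l2normE d0; have [t1 t10 [-> S1]] := l2normE d1.
have [_ _ PL ML] := potential_cL2 a0 pot; have [_ _ PLt MLt] := potential_cL2 a0 pott.
have diff (j : 'I_2) : (fun n => lam j n - lamt j n) =
    (fun n => (lam j n - n%:~R + j%:R / 2) - (lamt j n - n%:~R + j%:R / 2)).
  by apply/funext => n; ring.
rewrite (diff 0) in S0; rewrite (diff 1) in S1.
have e0 : 1 = (-1) ^+ (0%R : 'I_2) :> R[i] by rewrite expr0.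
have e1 : -1 = (-1) ^+ (1%R : 'I_2) :> R[i] by rewrite expr1.
have [PX MX] := spectral_stability a5 a2 PL ML PLt MLt
  (supported_cutoff _) (supported_cutoff _) (supported_cutoff _) (supported_cutoff _)
  (@nodes_dirichlet R) (@nodes_mixed R)
  (l2norm_small hr (small 0)) (l2norm_small hr (small 1))
  (l2norm_small hr (smallt 0)) (l2norm_small hr (smallt 1))
  (spectrum_zeros e0 a5 a2 pot (spec 0)) (spectrum_zeros e1 a5 a2 pot (spec 1))
  (spectrum_zeros e0 a5 a2 pott (spect 0)) (spectrum_zeros e1 a5 a2 pott (spect 1)) S0 S1.
have [hq hp] := potential_difference a0 pot pott PX MX.
apply: (le_trans (leeD hq hp)); rewrite -!EFinD -EFinM lee_fin.
have le_sum : Num.sqrt (t0 ^+ 2 + t1 ^+ 2) <= t0 + t1.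
  rewrite -[leRHS]ger0_norm ?addr_ge0// -sqrtr_sqr ler_wsqrtr// sqrrD -addrA lerD2l lerDr.
  by rewrite mulrn_wge0// mulr_ge0.
rewrite sqrtrM//.
move: s0 t00 t10 le_sum; clear.
move: (Num.sqrt _) (Num.sqrt _) => s T s0 t00 t10 le_sum; nra.
Qed.
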